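(* Assume the setting described in the context (standing regularity conditions and Gaussian design) and $\Sigma^{(1)}=\Sigma^{(2)}=I$. Then, with high probability over the randomness of $(Z^{(1)},Z^{(2)})$, $$V(\hat\beta;\beta^{(2)})=\sigma^2\frac{n}{p-n}+O(\sigma^2p^{-1/12}),\qquad B_1(\hat\beta;\beta^{(2)})=\frac{p-n}{p}\|\beta^{(2)}\|_2^2+O(p^{-1/12}\|\beta^{(2)}\|_2^2),$$ $$B_2(\hat\beta;\beta^{(2)})=\frac{n_1(p-n_1)}{p(p-n)}\|\tilde\beta\|_2^2+O(p^{-1/12}\|\tilde\beta\|_2^2),\qquad B_3(\hat\beta;\beta^{(2)})=0.$$
   Context: Model. For $k=1$ (source) and $k=2$ (target), $y^{(k)}=X^{(k)}\beta^{(k)}+\epsilon^{(k)}$ with $X^{(k)}=Z^{(k)}(\Sigma^{(k)})^{1/2}\in\mathbb R^{n_k\times p}$, $\Sigma^{(k)}$ deterministic positive definite, $\beta^{(k)}\in\mathbb R^p$ independent of the designs and noises (possibly arbitrary deterministic; statements are conditional on them). Put $n=n_1+n_2$, $\tilde\beta=\beta^{(1)}-\beta^{(2)}$. All sizes and signals may depend on $p$. Standing regularity conditions. $Z^{(1)},Z^{(2)},\epsilon^{(1)},\epsilon^{(2)}$ are mutually independent, and for a fixed $\tau\in(0,1)$: (a) all eigenvalues of $\Sigma^{(1)},\Sigma^{(2)}$ lie in $[\tau,\tau^{-1}]$; (b) entries of $\epsilon^{(k)}$ are independent, mean zero, variance $\sigma^2<\infty$; (c) $p/n_1,\ p/n_2,\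 p/n\in[1+\tau,\tau^{-1}]$. Gaussian design: entries of $Z^{(1)},Z^{(2)}$ are independent $\mathcal N(0,1)$. Estimator and risk terms. $\hat\beta=(X^{(1)\top}X^{(1)}+X^{(2)\top}X^{(2)})^\dagger(X^{(1)\top}y^{(1)}+X^{(2)\top}y^{(2)})$ is the pooled min-$\ell_2$-norm interpolator. With $X=(X^{(1)\top},X^{(2)\top})^\top$, $\hat\Sigma=X^\top X/n$, $S_1=X^{(1)\top}X^{(1)}/n$, its risk $\mathbb E[\|\hat\beta-\beta^{(2)}\|_{\Sigma^{(2)}}^2\mid X]$ (with $\|x\|_A^2=x^\top Ax$) equals $V+B_1+B_2+B_3$, where $V=\frac{\sigma^2}{n}\mathrm{Tr}(\hat\Sigma^\dagger\Sigma^{(2)})$, $B_1=\beta^{(2)\top}(\hat\Sigma^\dagger\hat\Sigma-I)\Sigma^{(2)}(\hat\Sigma^\dagger\hat\Sigma-I)\beta^{(2)}$, $B_2=\tilde\beta^\top S_1\hat\Sigma^\dagger\Sigma^{(2)}\hat\Sigma^\dagger S_1\tilde\beta$, $B_3=2\beta^{(2)\top}(\hat\Sigma^\dagger\hat\Sigma-I)\Sigma^{(2)}\hat\Sigma^\dagger S_1\tilde\beta$. Conventions. ''With high probability'' means with probability tending to $1$ as $p\to\infty$; constants in $O(\cdot)$ depend only on fixed constants such as $\tau$. *)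

(* Defs.v *)
From HB Require Import structures.
From mathcomp Require Import all_boot all_order all_algebra.
From mathcomp Require Import all_classical all_reals all_analysis.

Set Implicit Arguments.
Unset Strict Implicit.
Unset Printing Implicit Defensive.

Import Order.TTheory GRing.Theory Num.Theory.
Import numFieldNormedType.Exports.

Local Open Scope classical_set_scope.
Local Open Scope ring_scope.

Section RealMatrices.
Variable R : realType.

Definition quad_form (p : nat) (A : 'M[R]_p) (x : 'cV[R]_p) : R :=
  (x^T *m A *m x) ord0 ord0.

Definition sq_norm (p : nat) (x : 'cV[R]_p) : R := \sum_i x i ord0 ^+ 2.

Definition symmetric (p : nat) (A : 'M[R]_p) : Prop := A^T = A.

Definition pos_def (p : nat) (A : 'M[R]_p) : Prop :=
  symmetric A /\ forall x, x != 0 -> 0 < quad_form A x.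

Definition pos_semidef (p : nat) (A : 'M[R]_p) : Prop :=
  symmetric A /\ forall x, 0 <= quad_form A x.

(* The unique positive semidefinite square root; the default value 0 is taken
   only when A has no such root, i.e. when A is not positive semidefinite. *)
Definition psd_sqrt (p : nat) (A : 'M[R]_p) : 'M[R]_p :=
  xget 0 [set Q | pos_semidef Q /\ Q *m Q = A].

Definition is_mp_inverse (m n : nat) (A : 'M[R]_(m, n)) (B : 'M[R]_(n, m)) :
    Prop :=
  [/\ A *m B *m A = A, B *m A *m B = B,
      (A *m B)^T = A *m B & (B *m A)^T = B *m A].

(* MathComp's pinvmx is only a one-sided partial inverse, not the
   Moore-Penrose inverse. Existence and uniqueness are mp_inverseP and
   mp_inverse_unique below, so the default value 0 is never used. *)
Definition mp_inverse (m n : nat) (A : 'M[R]_(m, n)) : 'M[R]_(n, m) :=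
  xget 0 [set B | is_mp_inverse A B].

Lemma sq_norm_eq0 (p : nat) (x : 'cV[R]_p) : (sq_norm x == 0) = (x == 0).
Proof.
apply/idP/eqP => [|->]; last first.
  by rewrite /sq_norm big1// => i _; rewrite mxE expr0n.
rewrite psumr_eq0 => [/allP h|i _]; last exact: sqr_ge0.
apply/matrixP => i j; rewrite !mxE (ord1 j); apply/eqP.
by rewrite -sqrf_eq0; apply: h; rewrite mem_index_enum.
Qed.

Lemma trmx_mul_sq_norm (p : nat) (x : 'cV[R]_p) :
  (x^T *m x) ord0 ord0 = sq_norm x.
Proof. by rewrite mxE; apply: eq_bigr => i _; rewrite mxE expr2. Qed.

Lemma gram_unit (m n : nat) (G : 'M[R]_(m, n)) :
  row_free G -> G *m G^T \in unitmx.
Proof.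
move=> Gfree; rewrite -row_free_unit -kermx_eq0; apply/eqP/row_matrixP => i.
rewrite row0; set v := row i _.
have vK : v *m (G *m G^T) = 0.
  by apply: sub_kermxP; exact: row_sub.
have vG0 : v *m G = 0.
  apply: (can_inj (@trmxK _ _ _)); rewrite trmx0; apply/eqP.
  rewrite -sq_norm_eq0 -trmx_mul_sq_norm trmxK trmx_mul mulmxA.
  by rewrite -(mulmxA v) vK mul0mx mxE.
by apply: (row_free_inj Gfree); rewrite vG0 mul0mx.
Qed.

Lemma mp_inverse_factorization (m r n : nat) (F : 'M[R]_(m, r))
    (G : 'M[R]_(r, n)) :
  row_full F -> row_free G -> exists B, is_mp_inverse (F *m G) B.
Proof.
move=> Ffull Gfree.
have uG : G *m G^T \in unitmx by exact: gram_unit.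
have uF : F^T *m F \in unitmx.
  rewrite -{2}(trmxK F); apply: gram_unit.
  by rewrite /row_free mxrank_tr.
pose C := invmx (G *m G^T); pose D := invmx (F^T *m F).
have GC k (Y : 'M[R]_(r, k)) : G *m (G^T *m (C *m Y)) = Y.
  by rewrite (mulmxA G) mulmxA mulmxV// mul1mx.
have DF k (Y : 'M[R]_(r, k)) : D *m (F^T *m (F *m Y)) = Y.
  by rewrite (mulmxA F^T) mulmxA mulVmx// mul1mx.
have AB : F *m G *m (G^T *m C *m D *m F^T) = F *m D *m F^T.
  by rewrite -!mulmxA GC.
have BA : (G^T *m C *m D *m F^T) *m (F *m G) = G^T *m C *m G.
  by rewrite -!mulmxA DF.
have sC : C^T = C by rewrite /C trmx_inv trmx_mul trmxK.
have sD : D^T = D by rewrite /D trmx_inv trmx_mul trmxK.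
exists (G^T *m C *m D *m F^T); split.
- by rewrite AB -!mulmxA DF.
- by rewrite BA -!mulmxA GC.
- by rewrite AB !trmx_mul sD trmxK mulmxA.
- by rewrite BA !trmx_mul sC trmxK mulmxA.
Qed.

Lemma mp_inverse_exists (m n : nat) (A : 'M[R]_(m, n)) :
  exists B, is_mp_inverse A B.
Proof.
rewrite -{1}(mulmx_base A); apply: mp_inverse_factorization.
- exact: col_base_full.
- exact: row_base_free.
Qed.

Lemma mp_inverseP (m n : nat) (A : 'M[R]_(m, n)) :
  is_mp_inverse A (mp_inverse A).
Proof.
by have [B hB] := mp_inverse_exists A; rewrite /mp_inverse; case: xgetP => [C _ //|/(_ B)].
Qed.

Lemma mp_inverse_unique (m n : nat) (A : 'M[R]_(m, n)) (B C : 'M[R]_(n, m)) :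
  is_mp_inverse A B -> is_mp_inverse A C -> B = C.
Proof.
move=> [b1 b2 b3 b4] [c1 c2 c3 c4].
have ABC : A *m B = A *m C.
  rewrite -b3 -{1}c1 -(mulmxA (A *m C)) trmx_mul b3 c3.
  by rewrite mulmxA b1.
have BAC : B *m A = C *m A.
  rewrite -b4 -{1}c1 -mulmxA mulmxA trmx_mul c4 b4.
  by rewrite -mulmxA (mulmxA A) b1.
by rewrite -b2 BAC -mulmxA ABC mulmxA c2.
Qed.

Lemma psd_sqrt1 (p : nat) : psd_sqrt (1%:M : 'M[R]_p) = 1%:M.
Proof.
have psd1 : pos_semidef (1%:M : 'M[R]_p).
  split=> [|x]; first by rewrite /symmetric trmx1.
  by rewrite /quad_form mulmx1 trmx_mul_sq_norm sumr_ge0// => i _; exact: sqr_ge0.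
rewrite /psd_sqrt; case: xgetP => [Q _ [[sQ pQ] QQ]|/(_ 1%:M)]; last first.
  by case; split=> //; rewrite mulmx1.
pose D := Q - 1%:M.
have sD : D^T = D by rewrite /D linearB /= sQ trmx1.
have QD : Q *m D = - D by rewrite /D mulmxBr QQ mulmx1 opprB.
suff D0 : D = 0 by apply/eqP; rewrite -subr_eq0 -/D D0.
suff cD j : col j D = 0.
  by apply/matrixP => i j; have /matrixP/(_ i ord0) := cD j; rewrite !mxE.
have Qc : Q *m col j D = - col j D by rewrite colE mulmxA QD mulNmx.
apply/eqP; rewrite -sq_norm_eq0 eq_le; apply/andP; split; last first.
  by apply: sumr_ge0 => i _; exact: sqr_ge0.
have := pQ (col j D).
by rewrite /quad_form -mulmxA Qc mulmxN mxE trmx_mul_sq_norm oppr_ge0.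
Qed.

End RealMatrices.

Definition mutually_independent (R : realType) (d : measure_display)
    (T : measurableType d) (P : probability T R) (I : finType)
    (X : I -> {RV P >-> R}) : Prop :=
  forall (J : {set I}) (A : I -> set R), (forall i, measurable (A i)) ->
    P (\bigcap_(i in [set` J]) (X i @^-1` A i)) =
    (\prod_(i in J) P (X i @^-1` A i))%E.

(* "With high probability" along a sequence of probability spaces. Measures
   take unspecified values outside the sigma-algebra, hence the measurable
   event F m on which E m holds; when E m itself is measurable one may take
   F m = E m, and the condition says that P (E m) tends to 1. *)
Definition with_high_probability (R : realType) (d : nat -> measure_display)
    (T : forall m, measurableType (d m)) (P : forall m, probability (T m) R)
    (E : forall m, set (T m)) : Prop :=
  exists F : forall m, set (T m),
    [/\ forall m, measurable (F m), forall m, F m `<=` E m &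
        (fun m => P m (F m)) @ \oo --> 1%E].

(* The signals are deterministic: all statements are conditional on them, and
   they are independent of the designs and noises. *)
Record transfer_model (R : realType) := TransferModel {
  num_features : nat;
  size1 : nat;
  size2 : nat;
  Sigma1 : 'M[R]_num_features;
  Sigma2 : 'M[R]_num_features;
  beta1 : 'cV[R]_num_features;
  beta2 : 'cV[R]_num_features;
  sigma : R;
  disp : measure_display;
  Omega : measurableType disp;
  prob : probability Omega R;
  Z1 : 'I_size1 -> 'I_num_features -> {RV prob >-> R};
  Z2 : 'I_size2 -> 'I_num_features -> {RV prob >-> R};
  eps1 : 'I_size1 -> {RV prob >-> R};
  eps2 : 'I_size2 -> {RV prob >-> R}
}.

Section Model.
Variables (R : realType) (M : transfer_model R).
Local Notation p := (num_features M).
Local Notation n1 := (size1 M).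
Local Notation n2 := (size2 M).

Definition total_size : nat := (n1 + n2)%N.

Definition beta_diff : 'cV[R]_p := beta1 M - beta2 M.

(* Mutual independence of the blocks Z1, Z2, eps1, eps2 together with
   independence of the entries inside each block amounts to mutual
   independence of this single family. *)
Definition entries (i : 'I_n1 * 'I_p + 'I_n2 * 'I_p + ('I_n1 + 'I_n2)) :
    {RV (prob M) >-> R} :=
  match i with
  | inl (inl ij) => @Z1 R M ij.1 ij.2
  | inl (inr ij) => @Z2 R M ij.1 ij.2
  | inr (inl i1) => @eps1 R M i1
  | inr (inr i2) => @eps2 R M i2
  end.

Definition independent_entries : Prop := mutually_independent entries.

Definition spectrum_in (tau : R) (S : 'M[R]_p) : Prop :=
  forall a, eigenvalue S a -> tau <= a <= tau^-1.

Definition centered_with_variance (v : R) (X : {RV (prob M) >-> R}) : Prop :=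
  expectation (prob M) X = 0%E /\ variance (prob M) X = v%:E.

Definition aspect_ratio_ok (tau : R) (k : nat) : Prop :=
  1 + tau <= p%:R / k%:R <= tau^-1.

Definition regularity_conditions (tau : R) : Prop :=
  [/\ independent_entries,
      (pos_def (Sigma1 M) /\ spectrum_in tau (Sigma1 M)) /\
      (pos_def (Sigma2 M) /\ spectrum_in tau (Sigma2 M)),
      (forall i, centered_with_variance (sigma M ^+ 2) (@eps1 R M i)) /\
      (forall i, centered_with_variance (sigma M ^+ 2) (@eps2 R M i)) &
      [/\ aspect_ratio_ok tau n1, aspect_ratio_ok tau n2 &
          aspect_ratio_ok tau total_size]].

Definition standard_normal (X : {RV (prob M) >-> R}) : Prop :=
  forall A : set R, measurable A ->
    distribution (prob M) X A = normal_prob 0 1 A.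

(* The independence of the Gaussian entries is part of
   independent_entries. *)
Definition gaussian_design : Prop :=
  (forall i j, standard_normal (@Z1 R M i j)) /\
  (forall i j, standard_normal (@Z2 R M i j)).

Section Realization.
Variable w : Omega M.

Definition X1 : 'M[R]_(n1, p) :=
  (\matrix_(i, j) @Z1 R M i j w) *m psd_sqrt (Sigma1 M).

Definition X2 : 'M[R]_(n2, p) :=
  (\matrix_(i, j) @Z2 R M i j w) *m psd_sqrt (Sigma2 M).

Definition X : 'M[R]_(n1 + n2, p) := col_mx X1 X2.

Definition Sigma_hat : 'M[R]_p := total_size%:R^-1 *: (X^T *m X).

Definition S1 : 'M[R]_p := total_size%:R^-1 *: (X1^T *m X1).

Local Notation pinv_hat := (mp_inverse Sigma_hat).

Definition V_term : R :=
  sigma M ^+ 2 / total_size%:R * \tr (pinv_hat *m Sigma2 M).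

Definition B1_term : R :=
  ((beta2 M)^T *m (pinv_hat *m Sigma_hat - 1%:M) *m Sigma2 M
     *m (pinv_hat *m Sigma_hat - 1%:M) *m beta2 M) ord0 ord0.

Definition B2_term : R :=
  (beta_diff^T *m S1 *m pinv_hat *m Sigma2 M *m pinv_hat *m S1
     *m beta_diff) ord0 ord0.

Definition B3_term : R :=
  2 * ((beta2 M)^T *m (pinv_hat *m Sigma_hat - 1%:M) *m Sigma2 M
         *m pinv_hat *m S1 *m beta_diff) ord0 ord0.

End Realization.
End Model.

(* Main.v *)
Require Import Defs.
From HB Require Import structures.
From mathcomp Require Import all_boot all_order all_algebra.
From mathcomp Require Import all_classical all_reals all_analysis.
From mathcomp Require Import measurable_realfun.
From mathcomp Require Import ring lra zify.
Import Order.TTheory GRing.Theory Num.Theory.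
Import numFieldNormedType.Exports.
Local Open Scope classical_set_scope.
Local Open Scope ring_scope.
Set Implicit Arguments.
Unset Strict Implicit.
Unset Printing Implicit Defensive.

(** Let the rows of the pooled design be added one at a time, those of the source
    first. With identity covariances they are independent standard Gaussian
    vectors [x_0, x_1, ...] in dimension [p]. Let [resid j] be the projection
    onto the complement of the span of the first [j] rows and [gram_inv j] the
    pseudo-inverse of their Gram matrix. Then

    - the variance is [sigma^2] times the trace of [gram_inv n];
    - the bias is the squared norm of [resid n *m beta2];
    - the transfer term is the squared norm of the minimum-norm interpolant that
      fits [beta_diff] on the source rows and 0 on the target rows;
    - the cross term vanishes by the Moore-Penrose identities.

    Each of the first three is driven by a scalar recursion, exact and
    multiplicative ([one_trace_step], [bias_step], [transfer_step]):
    [s_{j+1} = s_j * (1 + eps * (1 + D_j) / d_j)], with a sign [eps]. Here [d_j] is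
    the squared distance of [x_j] to the span of the preceding rows, and
    [D_j = x_j^T H_j x_j - tr H_j] for a matrix [H_j] of Frobenius norm at most 1
    that depends only on the preceding rows. If [d_j] and [D_j] had their mean
    values [p - j] and 0, the product would telescope to the announced limit, up to
    [O(1 / p)].

    The fluctuations are controlled by elementary moments. The [D_j] are martingale
    differences of bounded variance ([mean_sq_qdev]), so their sum with weights of
    order [1 / p] is of order [p^-1/2]. The deviation of [d_j] from [p - j] has a
    fourth moment of order [p^2] ([mean_pow4_qdev]), which controls all [j]
    together. Markov's inequality, applied once to a sum of all these fluctuations
    ([total_excess_event]), bounds them at the scale [r = p^(-1/12)] outside an
    event of probability of order [1 / (p r^4) = r^8].

    On the good event the recursions stay close to the telescoping products:
    a product of factors [1 + eta_j] is close to 1 when the signed sum of the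
    [eta_j] and the sum of their squares are small ([perturbed_product]).

    Conditioning is replaced by a form of Tonelli's theorem ([integral_fresh]): for
    a nonnegative function of the past and of one fresh variable, the fresh
    variable can be averaged first. Every moment bound is therefore obtained entry
    by entry, each step being the average of a polynomial in one normal variable. *)

(** * The past of a family of independent variables *)

Section Adapted.
Context (R : realType) (d : measure_display) (T : measurableType d)
  (P : probability T R) (I : finType) (X : I -> {RV P >-> R}).

(** The events determined by the variables indexed by [J] form the sigma-algebra
    generated by rectangles: a pi-system, on which mutual independence is
    exactly a product formula. *)
Definition rectangles (J : {set I}) : set (set T) :=
  [set A | exists2 B : I -> set R, forall i, measurable (B i) &
           A = \bigcap_(i in [set` J]) (X i @^-1` B i)].

Local Notation past J := (g_sigma_algebraType (rectangles J)).

Definition adapted (J : {set I}) (F : T -> R) :=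
  measurable_fun (setT : set (past J)) F.

Lemma rectangles_measurable (J : {set I}) : rectangles J `<=` measurable.
Proof.
move=> A [B mB ->]; apply: fin_bigcap_measurable; first exact: finite_finset.
by move=> i _; rewrite -[X in measurable X]setTI; exact: measurable_funP.
Qed.

Lemma past_measurable (J : {set I}) (A : set T) :
  measurable (A : set (past J)) -> measurable A.
Proof.
exact: (smallest_sub (@sigma_algebra_measurable _ T) (@rectangles_measurable J)).
Qed.

Lemma measurable_id_past (J : {set I}) :
  measurable_fun (setT : set T) (idfun : T -> past J).
Proof. by move=> _ A mA; rewrite setTI; exact: past_measurable mA. Qed.

Lemma adapted_measurable (J : {set I}) (F : T -> R) :
  adapted J F -> measurable_fun setT F.
Proof. by move=> mF; exact: (measurableT_comp mF (@measurable_id_past J)). Qed.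

Lemma rectangles_setI (J : {set I}) : setI_closed (rectangles J).
Proof.
move=> A B [C mC ->] [D mD ->]; exists (fun i => C i `&` D i).
  by move=> i; exact: measurableI.
apply/seteqP; split => [x [h1 h2] i iJ|x h].
  by split; [exact: h1|exact: h2].
by split=> i iJ; have [] := h i iJ.
Qed.

Lemma rectanglesT (J : {set I}) : rectangles J setT.
Proof.
exists (fun=> setT) => //; apply/seteqP; split => // x _ i _ //.
Qed.

Lemma adaptedX (J : {set I}) (i : I) : i \in J -> adapted J (X i).
Proof.
move=> iJ _ B mB; rewrite setTI; apply: sub_sigma_algebra.
exists (fun j => if j == i then B else setT) => [j|]; first by case: ifP.
apply/seteqP; split => [x Bx j jJ /=|x /(_ i iJ) /=]; last by rewrite eqxx.
by case: eqP => [->|].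
Qed.

Lemma adapted_sub (J K : {set I}) (F : T -> R) :
  J \subset K -> adapted J F -> adapted K F.
Proof.
move=> JK mF.
have mid : measurable_fun (setT : set (past K)) (idfun : past K -> past J).
  move=> _ A mA; rewrite setTI.
  suff h : <<s rectangles J >> `<=` (measurable : set (set (past K))) by exact: h.
  apply: smallest_sub; first exact: sigma_algebra_measurable.
  move=> _ [B mB ->]; apply: sub_sigma_algebra.
  exists (fun j => if j \in J then B j else setT) => [j|]; first by case: ifP.
  apply/seteqP; split => [x h i iK|x h i iJ].
    by rewrite /preimage /=; case: ifP => // iJ; exact: h.
  by have := h i (fintype.subsetP JK _ iJ); rewrite /= (iJ : i \in J).
exact: (measurableT_comp mF mid).
Qed.

Hypothesis indep : mutually_independent X.

(** The pi-lambda theorem carries the product formula from rectangles over to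
    the whole past. *)
Lemma past_indep (J : {set I}) (i : I) (A : set T) (B : set R) :
  i \notin J -> measurable (A : set (past J)) -> measurable B ->
  P (A `&` X i @^-1` B) = (P A * P (X i @^-1` B))%E.
Proof.
move=> iJ mA mB.
have mXB : measurable (X i @^-1` B).
  by rewrite -[X in measurable X]setTI; exact: measurable_funP.
(* Both sides are finite measures in [A] once [B] is fixed: the restriction of
   P to the preimage of B, and P scaled by the mass of that preimage. *)
pose k : {nonneg R} := NngNum (fine_ge0 (measure_ge0 P (X i @^-1` B))).
have kE C : mscale k P C = (P C * P (X i @^-1` B))%E.
  by rewrite /mscale /= fineK ?fin_num_measure// muleC.
rewrite -kE -[LHS]/(mrestr P mXB A).
apply: (@g_sigma_algebra_measure_unique _ R T (rectangles J)
  (@rectangles_measurable J) (fun=> setT) (fun=> rectanglesT J) _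
  _ _ (@rectangles_setI J) _ _ A mA).
- by rewrite bigcup_const//; exists 0%N.
- move=> C [D mD ->] /=; rewrite kE /mrestr.
  pose D' j := if j == i then B else D j.
  have mD' j : measurable (D' j) by rewrite /D'; case: ifP.
  have -> : \bigcap_(j in [set` J]) (X j @^-1` D j) `&` X i @^-1` B =
      \bigcap_(j in [set` (i |: J)]) (X j @^-1` D' j).
    apply/seteqP; split => [x [h Bx] j /=|x h].
      rewrite in_setU1 /D' => /orP[/eqP ->|jJ]; first by rewrite eqxx.
      by case: eqP => [->//|_]; exact: h.
    split=> [j jJ|].
      have := h j; rewrite /= /D' in_setU1 jJ orbT => /(_ isT).
      by case: eqP => // ji; move: iJ; rewrite -ji (jJ : j \in J).
    by have := h i; rewrite /= /D' eqxx setU11; exact.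
  rewrite indep// big_setU1//= {1}/D' eqxx muleC; congr (_ * _)%E.
  rewrite indep//; apply: eq_bigr => j jJ; rewrite /D'.
  by case: eqP => // ji; move: iJ; rewrite -ji jJ.
- by move=> n; rewrite [X in (X < _)%E]/(P _) setTI (le_lt_trans (probability_le1 _ _)) ?ltry.
Qed.

(** This plays the part of conditional expectation. By independence the joint
    law of the past and of a fresh variable is a product measure, so Tonelli's
    theorem integrates the fresh variable first, the past being held fixed. *)
Lemma integral_fresh (J : {set I}) (i : I) (f : past J * R -> \bar R) :
  i \notin J -> measurable_fun setT f -> (forall z, (0 <= f z)%E) ->
  (\int[P]_w f (w, X i w) =
   \int[P]_w \int[distribution P (X i)]_z f (w, z))%E.
Proof.
move=> iJ mf f0.
pose past_id : {RV P >-> past J} :=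
  HB.pack (idfun : T -> past J) (isMeasurableFun.Build _ _ _ _ _ (@measurable_id_past J)).
have mpair : measurable_fun (setT : set T) (fun w : T => (w : past J, X i w)).
  apply: measurable_fun_pair; first exact: measurable_id_past.
  exact: measurable_funP.
pose pair : {RV P >-> (past J * R)%type} :=
  HB.pack (fun w : T => (w : past J, X i w)) (isMeasurableFun.Build _ _ _ _ _ mpair).
transitivity (\int[distribution P pair]_z f z)%E.
  by rewrite ge0_integral_distribution.
transitivity (\int[(distribution P past_id \x distribution P (X i))%E]_z f z)%E.
  apply: eq_measure_integral => A mA _; apply/esym.
  apply: product_measure_unique => // B C mB mC.
  exact: (past_indep iJ mB mC).
rewrite fubini_tonelli1//.
rewrite (@ge0_integral_distribution _ _ _ _ _ P past_id)//.
- exact: measurable_fun_fubini_tonelli_F.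
- by move=> w; apply: integral_ge0.
Qed.

End Adapted.

(** * Moments of the standard normal law *)

Section GaussianMoments.
Context (R : realType).
Local Notation mu := (@lebesgue_measure R).
Local Notation N01 := (@normal_prob R 0 1).

(** The normal law is defined by integrating its density over sets; identifying it with a Radon-Nikodym derivative makes the change
    of variables available for every nonnegative integrand. *)
Lemma ge0_integral_normal_prob (f : R -> \bar R) :
  measurable_fun setT f -> (forall x, 0 <= f x)%E ->
  (\int[N01]_x f x = \int[mu]_x (f x * (normal_pdf 0 1 x)%:E))%E.
Proof.
move=> mf f0.
have dom : N01 `<< mu by exact: normal_prob_dominates.
rewrite -(Radon_Nikodym_SigmaFinite.change_of_variables dom)//.
have mg : measurable_fun setT (Radon_Nikodym_SigmaFinite.f N01 mu).
  exact: (measurable_int _ (Radon_Nikodym_SigmaFinite.f_integrable dom)).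
have mpdf : measurable_fun setT (fun x : R => (normal_pdf 0 1 x)%:E).
  by apply/measurable_EFinP; exact: measurable_normal_pdf.
apply: ae_eq_integral => //; [exact: emeasurable_funM|exact: emeasurable_funM|].
apply: ae_eqe_mul2l => /=.
apply: integral_ae_eq => //=.
- exact: Radon_Nikodym_SigmaFinite.f_integrable.
- by move=> E _ mE; rewrite -(Radon_Nikodym_SigmaFinite.f_integral dom).
Qed.

(** Completing the square turns the exponential tilt of the standard density
    into a translate of it, whose total mass is 1. *)
Lemma normal_mgf (t : R) :
  (\int[N01]_x (expR (t * x))%:E = (expR (t ^+ 2 / 2))%:E)%E.
Proof.
have mexp : measurable_fun setT (fun x : R => (expR (t * x))%:E).
  by apply/measurable_EFinP; apply: measurableT_comp => //; exact: measurable_funM.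
rewrite ge0_integral_normal_prob//.
transitivity (\int[mu]_x ((expR (t ^+ 2 / 2))%:E * (normal_pdf t 1 x)%:E))%E.
  apply: eq_integral => x _; rewrite -!EFinM !normal_pdfE ?oner_eq0//.
  congr (_%:E).
  rewrite /normal_fun mulrCA [RHS]mulrCA -!expRD; congr (_ * expR _).
  by field.
rewrite ge0_integralZl//.
- by rewrite integral_normal_pdf mule1.
- by apply/measurable_EFinP; exact: measurable_normal_pdf.
- by move=> x _; rewrite lee_fin normal_pdf_ge0.
Qed.

Lemma integrable_expR (t : R) : N01.-integrable setT (fun x => (expR (t * x))%:E).
Proof.
apply/integrableP; split.
  by apply/measurable_EFinP; apply: measurableT_comp => //; exact: measurable_funM.
rewrite (_ : (fun _ => _) = (fun x => (expR (t * x))%:E)) ?normal_mgf ?ltry//.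
by apply/funext => x; rewrite abse_EFin ger0_norm ?expR_ge0.
Qed.

Lemma normrX_le_expR (x : R) n : `|x| ^+ n <= n`!%:R * (expR x + expR (- x)).
Proof.
have h (y : R) : 0 <= y -> y ^+ n <= n`!%:R * expR y.
  move=> y0; case: n => [|n]; first by rewrite expr0 mul1r -expR0 ler_expR.
  rewrite mulrC -ler_pdivrMr ?ltr0n ?fact_gt0//.
  by apply: le_trans (expR_ge1Dxn n y0); rewrite lerDr.
rewrite mulrDr; case: (leP 0 x) => x0.
  by rewrite ger0_norm// (le_trans (h _ x0))// lerDl mulr_ge0 ?expR_ge0.
rewrite ltr0_norm// (le_trans (h (- x) _)) ?oppr_ge0 ?ltW//.
by rewrite ltrDr mulr_gt0 ?expR_gt0 ?ltr0n ?fact_gt0.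
Qed.

Lemma integrable_normal_moment n : N01.-integrable setT (fun x => (x ^+ n)%:E).
Proof.
have iE : N01.-integrable setT (fun x => (n`!%:R%:E * ((expR (1 * x))%:E +
    (expR (- 1 * x))%:E)%E)%E).
  by apply: integrableZl => //; apply: integrableD => //; exact: integrable_expR.
apply: le_integrable iE => //.
- by apply/measurable_EFinP; exact: exprn_measurable.
- move=> x _; rewrite -EFinD -EFinM !abse_EFin lee_fin normrX.
  by rewrite mul1r mulN1r (le_trans (normrX_le_expR _ _)) ?ler_norm.
Qed.

(** Only the moments of order 0, 1 and 2 are evaluated below; the higher ones
    enter the constants of the moment inequalities. *)
Definition normal_moment n : R := fine (\int[N01]_x (x ^+ n)%:E).

Lemma integral_normal_moment n :
  (\int[N01]_x (x ^+ n)%:E = (normal_moment n)%:E)%E.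
Proof. by rewrite fineK// integrable_fin_num//; exact: integrable_normal_moment. Qed.

Lemma integral_normal_poly (c : nat -> R) (m : nat) :
  (\int[N01]_x (\sum_(l < m) c l * x ^+ l)%:E =
   (\sum_(l < m) c l * normal_moment l)%:E)%E.
Proof.
have E x : (\sum_(l < m) c l * x ^+ l)%:E = (\sum_(l < m) (c l)%:E * (x ^+ l)%:E)%E.
  by rewrite -sumEFin; apply: eq_bigr => l _; rewrite EFinM.
under eq_integral do rewrite E.
rewrite integral_sum//; last first.
  by move=> l; apply: integrableZl => //; exact: integrable_normal_moment.
rewrite -sumEFin; apply: eq_bigr => l _.
by rewrite integralZl ?integral_normal_moment//; exact: integrable_normal_moment.
Qed.

(** The remainder is a series whose terms are dominated one by one by those of
    the series of [|y| ^+ 3 * expR |y|], since [n! <= (n + 3)!]. *)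
Lemma expR_taylor3 (y : R) :
  `|expR y - (1 + y + y ^+ 2 / 2)| <= `|y| ^+ 3 * expR `|y|.
Proof.
pose u n := series (exp_coeff y) (n + 3)%N - (1 + y + y ^+ 2 / 2).
pose v n := `|y| ^+ 3 * series (exp_coeff `|y|) n.
have uv n : `|u n| <= v n.
  elim: n => [|n ih]; rewrite /u /v.
    rewrite /series /exp_coeff /= !big_nat_recr//= !big_geq// mulr0.
    by rewrite (_ : _ - _ = 0) ?normr0// !factS fact0; field.
  have -> : `|y| ^+ 3 * series (exp_coeff `|y|) n.+1 =
      v n + `|y| ^+ 3 * exp_coeff `|y| n.
    by rewrite /v /series /= big_nat_recr//= mulrDr.
  rewrite addSn {1}/series /= big_nat_recr//= addrAC.
  rewrite (le_trans (ler_normD _ _))// lerD//.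
  rewrite /exp_coeff /= normrM normrX normfV normr_nat [leRHS]mulrA -exprD addnC.
  apply: ler_wpM2l; first by rewrite exprn_ge0.
  rewrite lef_pV2 ?posrE ?ltr0n ?fact_gt0// ler_nat.
  by rewrite !factS; have := fact_gt0 n; nia.
have cu : `|u n| @[n --> \oo] --> `|expR y - (1 + y + y ^+ 2 / 2)|.
  apply: cvg_norm; apply: cvgB; last exact: cvg_cst.
  rewrite (cvg_shiftn 3%N (series (exp_coeff y))).
  exact: (is_cvg_series_exp_coeff y).
have cv : v n @[n --> \oo] --> `|y| ^+ 3 * expR `|y|.
  by apply: cvgMr; exact: (is_cvg_series_exp_coeff `|y|).
by apply: (ler_cvg_to cu cv); apply: nearW.
Qed.

Lemma normal_moment0 : normal_moment 0 = 1.
Proof.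
rewrite /normal_moment; under eq_integral do rewrite expr0.
by rewrite integral_cst// mul1e [X in fine X]probability_setT.
Qed.

(** Comparing the second-order expansions of both sides of the moment
    generating function identifies the first two moments. *)
Lemma normal_moment_expansion : exists2 C : R, 0 <= C & forall t : R, `|t| <= 1 ->
  `|t * normal_moment 1 + t ^+ 2 / 2 * (normal_moment 2 - 1)| <= C * `|t| ^+ 3.
Proof.
pose I := expR (2 ^+ 2 / 2) : R.
exists (12%:R * I + expR 1); first by rewrite addr_ge0 ?mulr_ge0 ?expR_ge0.
move=> t t1; have t0 : 0 <= `|t| by [].
pose p x := \sum_(l < 3) [:: 1; t; t ^+ 2 / 2]`_l * x ^+ l.
have pE x : p x = 1 + t * x + (t * x) ^+ 2 / 2.
  by rewrite /p !big_ord_recl big_ord0 /=; field.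
have ip : N01.-integrable setT (fun x => (p x)%:E).
  rewrite (_ : (fun _ => _) = fun x =>
      (\sum_(l < 3) ([:: 1; t; t ^+ 2 / 2]`_l)%:E * (x ^+ l)%:E)%E); last first.
    by apply/funext => x; rewrite -sumEFin; apply: eq_bigr => l _; rewrite EFinM.
  apply: integrable_sum => // l _; apply: integrableZl => //.
  exact: integrable_normal_moment.
have m0 := normal_moment0.
have iD : N01.-integrable setT (fun x => (expR (t * x))%:E - (p x)%:E)%E.
  by apply: integrableB => //; exact: integrable_expR.
have id : ((expR (t ^+ 2 / 2) - (1 + t * normal_moment 1 +
    t ^+ 2 / 2 * normal_moment 2))%:E =
    \int[N01]_x ((expR (t * x))%:E - (p x)%:E))%E.
  rewrite integralB//; last exact: integrable_expR.
  rewrite normal_mgf /p integral_normal_poly -EFinB; congr ((_ - _)%:E).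
  by rewrite !big_ord_recl big_ord0 /= m0; ring.
have bnd x : `|expR (t * x) - p x| <=
    (`|t| ^+ 3 * 6%:R) * (expR (2 * x) + expR (- 2 * x)).
  rewrite pE (le_trans (expR_taylor3 _))// normrM exprMn -[leLHS]mulrA -[leRHS]mulrA.
  apply: ler_wpM2l; first by rewrite exprn_ge0.
  have h := normrX_le_expR `|x| 3.
  have e1 : expR (`|t| * `|x|) <= expR `|x|.
    by rewrite ler_expR ler_piMl.
  have X3 : `|x| ^+ 3 <= 6%:R * expR `|x|.
    have := @expR_ge1Dxn R `|x| 2 (normr_ge0 _).
    rewrite (_ : (3`!)%N = 6)//; lra.
  apply: (@le_trans _ _ (6%:R * expR `|x| * expR `|x|)).
    by apply: ler_pM => //; rewrite ?exprn_ge0 ?expR_ge0.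
  rewrite -mulrA; apply: ler_wpM2l => //; rewrite -expRD.
  case: (leP 0 x) => x0.
    by rewrite (ger0_norm x0) (_ : x + x = 2 * x) ?lerDl ?expR_ge0//; ring.
  by rewrite (ltr0_norm x0) (_ : - x - x = - 2 * x) ?lerDr ?expR_ge0//; ring.
have h1 : `|expR (t ^+ 2 / 2) - (1 + t * normal_moment 1 +
    t ^+ 2 / 2 * normal_moment 2)| <= 12%:R * I * `|t| ^+ 3.
  rewrite -lee_fin -abse_EFin id.
  apply: le_trans (le_abse_integral _ _ _) _ => //.
    exact: (measurable_int _ iD).
  apply: (@le_trans _ _ (\int[N01]_x ((`|t| ^+ 3 * 6%:R)%:E *
      ((expR (2 * x))%:E + (expR (- 2 * x))%:E)%E))%E).
    apply: ge0_le_integral => //.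
    - by apply: measurableT_comp => //; exact: (measurable_int _ iD).
    - apply: (measurable_int N01); apply: integrableZl => //.
      by apply: integrableD => //; exact: integrable_expR.
    - by move=> x _; rewrite -EFinB abse_EFin -EFinD -EFinM lee_fin bnd.
  rewrite integralZl//; last by apply: integrableD => //; exact: integrable_expR.
  rewrite integralD//; [|exact: integrable_expR..].
  rewrite !normal_mgf -EFinD -EFinM lee_fin sqrrN -/I; lra.
have h2 : `|expR (t ^+ 2 / 2) - (1 + t ^+ 2 / 2)| <= expR 1 * `|t| ^+ 3.
  have tt : t ^+ 2 = `|t| ^+ 2 by rewrite real_normK ?num_real.
  have s0 : 0 <= t ^+ 2 / 2 by rewrite divr_ge0 ?sqr_ge0.
  have s1 : t ^+ 2 / 2 <= 2^-1.
    by rewrite tt ler_pdivrMr// mulVf// exprn_ile1.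
  have tay := expR_taylor3 (t ^+ 2 / 2).
  rewrite (ger0_norm s0) in tay.
  have e1 : expR (t ^+ 2 / 2) <= expR 1 by rewrite ler_expR; lra.
  have e2 : 1 <= expR 1 :> R by rewrite -expR0 ler_expR.
  have e3 : (t ^+ 2 / 2) ^+ 3 * expR (t ^+ 2 / 2) <= (t ^+ 2 / 2) ^+ 2 * expR 1 / 2.
    rewrite exprSr -[leRHS]mulrA -[leLHS]mulrA; apply: ler_wpM2l; first exact: sqr_ge0.
    by rewrite mulrC; apply: ler_pM; rewrite ?expR_ge0.
  have e4 : (t ^+ 2 / 2) ^+ 2 <= `|t| ^+ 3 / 4%:R.
    rewrite tt expr_div_n -exprM (_ : 2 ^+ 2 = 4%:R); last by ring.
    rewrite ler_pM2r ?invr_gt0//; exact: ler_wiXn2l.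
  have e5 : (t ^+ 2 / 2) ^+ 2 * expR 1 <= `|t| ^+ 3 / 4%:R * expR 1.
    by apply: ler_wpM2r => //; exact: expR_ge0.
  have e6 : (t ^+ 2 / 2) ^+ 2 <= (t ^+ 2 / 2) ^+ 2 * expR 1.
    by rewrite ler_peMr ?sqr_ge0.
  have e7 : 0 <= `|t| ^+ 3 * expR 1 by rewrite mulr_ge0 ?expR_ge0 ?exprn_ge0.
  rewrite ger0_norm; last by rewrite subr_ge0 expR_ge1Dx.
  have := ler_norm (expR (t ^+ 2 / 2) - (1 + t ^+ 2 / 2 + (t ^+ 2 / 2) ^+ 2 / 2)).
  lra.
have -> : t * normal_moment 1 + t ^+ 2 / 2 * (normal_moment 2 - 1) =
    (expR (t ^+ 2 / 2) - (1 + t ^+ 2 / 2)) - (expR (t ^+ 2 / 2) - (1 + t * normal_moment 1 +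
    t ^+ 2 / 2 * normal_moment 2)) by ring.
by rewrite (le_trans (ler_normB _ _))// mulrDl addrC lerD.
Qed.

Lemma normal_moment12 : normal_moment 1 = 0 /\ normal_moment 2 = 1.
Proof.
have [C C0 hC] := normal_moment_expansion.
(* The part odd in [t] gives the first moment and the part even in [t] the
   second one; each is a constant of size [O(t)]. *)
have small (K c : R) : 0 <= K -> (forall t, 0 < t <= 1 -> `|c| <= K * t) -> c = 0.
  move=> K0 h; apply/eqP; rewrite -normr_eq0 eq_le normr_ge0 andbT.
  apply/ler_addgt0Pl => e e0; rewrite addr0.
  have t0 : 0 < Num.min 1 (e / (K + 1)).
    by rewrite lt_min ltr01 divr_gt0// ltr_wpDl.
  apply: (le_trans (h (Num.min 1 (e / (K + 1))) _)).
    by rewrite t0 ge_min lexx.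
  apply: (@le_trans _ _ (K * (e / (K + 1)))).
    by apply: ler_wpM2l => //; rewrite ge_min lexx orbT.
  by rewrite mulrA ler_pdivrMr ?ltr_wpDl// mulrC ler_pM2l// lerDl.
have m2 : normal_moment 2 - 1 = 0.
  apply: (small (2 * C)); first by rewrite mulr_ge0.
  move=> t /andP[t0 t1].
  have := hC t; have := hC (- t).
  rewrite normrN (gtr0_norm t0) sqrrN => /(_ t1) h1 /(_ t1) h2.
  rewrite -(ler_pM2l (exprn_gt0 2 t0)) -[X in X * `|_|]gtr0_norm ?exprn_gt0//.
  rewrite -normrM (_ : _ * (_ - 1) = (t * normal_moment 1 + t ^+ 2 / 2 * (normal_moment 2 - 1))
    + (- t * normal_moment 1 + t ^+ 2 / 2 * (normal_moment 2 - 1))); last by field.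
  rewrite (le_trans (ler_normD _ _))// (le_trans (lerD h2 h1))//.
  by rewrite le_eqVlt; apply/orP; left; apply/eqP; ring.
split; last by apply/eqP; rewrite -subr_eq0 m2.
apply: (small C) => // t /andP[t0 t1].
have := hC t; rewrite (gtr0_norm t0) m2 mulr0 addr0 => /(_ t1).
rewrite normrM gtr0_norm// exprS mulrCA ler_pM2l// => h.
rewrite (le_trans h)//; apply: ler_wpM2l => //.
by rewrite expr2 ler_piMl// ltW.
Qed.

End GaussianMoments.

(** * Measurable functions of the past *)

Lemma measurable_sum_cond (R : realType) (d : measure_display)
    (T : measurableType d) (K : Type) (s : seq K) (Q : pred K) (F : K -> T -> R) :
  (forall k, Q k -> measurable_fun setT (F k)) ->
  measurable_fun setT (fun w => \sum_(k <- s | Q k) F k w).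
Proof.
move=> mF.
have -> : (fun w => \sum_(k <- s | Q k) F k w) =
    fun w => \sum_(k <- s) (if Q k then F k else fun=> 0) w.
  apply/funext => w; rewrite big_mkcond.
  by apply: eq_bigr => k _; case: ifP.
by apply: measurable_sum => k; case: ifP => // Qk; exact: mF.
Qed.

Section AdaptedAlgebra.
Context (R : realType) (d : measure_display) (T : measurableType d)
  (P : probability T R) (I : finType) (X : I -> {RV P >-> R}) (J : {set I}).
Implicit Types F G : T -> R.

Lemma adapted_cst (r : R) : adapted X J (fun=> r).
Proof. exact: measurable_cst. Qed.

Lemma adaptedD F G : adapted X J F -> adapted X J G -> adapted X J (fun w => F w + G w).
Proof. exact: measurable_funD. Qed.

Lemma adaptedB F G : adapted X J F -> adapted X J G -> adapted X J (fun w => F w - G w).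
Proof. exact: measurable_funB. Qed.

Lemma adaptedN F : adapted X J F -> adapted X J (fun w => - F w).
Proof. exact: measurable_funN. Qed.

Lemma adaptedM F G : adapted X J F -> adapted X J G -> adapted X J (fun w => F w * G w).
Proof. exact: measurable_funM. Qed.

Lemma adaptedXn F n : adapted X J F -> adapted X J (fun w => F w ^+ n).
Proof. exact: measurable_funX. Qed.

(** As a total function the inverse has value 0 at 0 and is continuous elsewhere. *)
Lemma measurable_invr : measurable_fun (setT : set R) (@GRing.inv R).
Proof.
rewrite -(setUv [set 0 : R]); apply/measurable_funU; [exact: measurable_set1|exact: measurableC|split].
  apply: (eq_measurable_fun (fun _ : R => (0 : R))); last exact: measurable_cst.
  by move=> x; rewrite inE => ->; rewrite invr0.
apply: open_continuous_measurable_fun => [|x].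
  by apply: closed_openC; exact/accessible_closed_set1/hausdorff_accessible/Rhausdorff.
by rewrite inE => /eqP x0; exact: inv_continuous.
Qed.

Lemma adaptedV F : adapted X J F -> adapted X J (fun w => (F w)^-1).
Proof. by move=> mF; exact: (measurableT_comp measurable_invr mF). Qed.

Lemma adapted_sum (K : Type) (s : seq K) (Q : pred K) (F : K -> T -> R) :
  (forall k, Q k -> adapted X J (F k)) ->
  adapted X J (fun w => \sum_(k <- s | Q k) F k w).
Proof. exact: measurable_sum_cond. Qed.

End AdaptedAlgebra.

(** * Means, and averaging over one fresh Gaussian entry *)

Section FreshGaussian.
Context (R : realType) (d : measure_display) (T : measurableType d)
  (P : probability T R) (I : finType) (X : I -> {RV P >-> R}).
Hypothesis indep : mutually_independent X.
Implicit Types F G M a b : T -> R.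

(** Extended real values make the mean of nonnegative variables monotone and
    additive with no integrability conditions, so that all the moment bounds
    below are proved and chained before finiteness is known. *)
Definition mean F : \bar R := (\int[P]_w (F w)%:E)%E.

Lemma le_mean F G : measurable_fun setT F -> measurable_fun setT G ->
  (forall w, 0 <= F w) -> (forall w, F w <= G w) -> (mean F <= mean G)%E.
Proof.
move=> mF mG F0 FG; apply: ge0_le_integral => //.
- by move=> w _; rewrite lee_fin.
- exact/measurable_EFinP.
- exact/measurable_EFinP.
- by move=> w _; rewrite lee_fin.
Qed.

Lemma meanD F G : measurable_fun setT F -> measurable_fun setT G ->
  (forall w, 0 <= F w) -> (forall w, 0 <= G w) ->
  mean (fun w => F w + G w) = (mean F + mean G)%E.
Proof.
move=> mF mG F0 G0; rewrite /mean -ge0_integralD//.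
- by move=> w _; rewrite lee_fin.
- exact/measurable_EFinP.
- by move=> w _; rewrite lee_fin.
- exact/measurable_EFinP.
Qed.

Lemma meanZ (k : R) F : 0 <= k -> measurable_fun setT F -> (forall w, 0 <= F w) ->
  mean (fun w => k * F w) = (k%:E * mean F)%E.
Proof.
move=> k0 mF F0; rewrite /mean -ge0_integralZl//.
- exact/measurable_EFinP.
- by move=> w _; rewrite lee_fin.
Qed.

Lemma mean_cst (k : R) : mean (fun=> k) = k%:E.
Proof. by rewrite /mean integral_cst// [X in (_ * X)%E]probability_setT mule1. Qed.

Lemma mean_sum (K : Type) (s : seq K) (Q : pred K) (F : K -> T -> R) :
  (forall k, Q k -> measurable_fun setT (F k)) -> (forall k w, 0 <= F k w) ->
  mean (fun w => \sum_(k <- s | Q k) F k w) = (\sum_(k <- s | Q k) mean (F k))%E.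
Proof.
move=> mF F0; pose F' k := if Q k then F k else fun=> 0.
have F'0 k w : 0 <= F' k w by rewrite /F'; case: ifP.
transitivity (\int[P]_w (\sum_(k <- s) (F' k w)%:E))%E.
  apply: eq_integral => w _; rewrite sumEFin big_mkcond; congr (_%:E).
  by apply: eq_bigr => k _; rewrite /F'; case: ifP.
rewrite ge0_integral_sum//.
- rewrite [RHS]big_mkcond; apply: eq_bigr => k _; rewrite /F'.
  by case: ifPn => // _; rewrite integral0.
- by move=> k; apply/measurable_EFinP; rewrite /F'; case: ifPn => [/mF|].
- by move=> k w _; rewrite lee_fin.
Qed.

Variables (J : {set I}) (i : I).
Hypothesis iJ : i \notin J.
Hypothesis gauss : forall A : set R, measurable A ->
  distribution P (X i) A = normal_prob 0 1 A.

(** The polynomial is nonnegative as a function of the fresh variable at every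
    sample point, which is what Tonelli's theorem asks for. *)
Lemma mean_fresh_poly (m : nat) (c : nat -> T -> R) :
  (forall l, adapted X J (c l)) ->
  (forall w z, 0 <= \sum_(l < m) c l w * z ^+ l) ->
  mean (fun w => \sum_(l < m) c l w * X i w ^+ l) =
  mean (fun w => \sum_(l < m) c l w * normal_moment R l).
Proof.
move=> mc c0; rewrite /mean.
pose f (z : g_sigma_algebraType (rectangles X J) * R) : \bar R :=
  (\sum_(l < m) c l z.1 * z.2 ^+ l)%:E.
have mf : measurable_fun setT f.
  apply/measurable_EFinP; apply: measurable_sum => l; apply: measurable_funM.
    exact: (measurableT_comp (mc l) measurable_fst).
  by apply: measurable_funX; exact: measurable_snd.
rewrite (@integral_fresh _ _ _ _ _ X indep J i f)//; last first.
  by move=> z; rewrite lee_fin.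
apply: eq_integral => w _; rewrite /f /=.
rewrite -(integral_normal_poly (fun l => c l w)).
(* The normal law lives on [measurableTypeR R], the random variable on [R]
   with its default structure; the two have the same measurable sets. *)
have mX : measurable_fun (setT : set T) (X i : T -> measurableTypeR R).
  exact: (measurable_funP (X i)).
pose X' : {RV P >-> measurableTypeR R} :=
  HB.pack (X i : T -> measurableTypeR R) (isMeasurableFun.Build _ _ _ _ _ mX).
have mpoly : measurable_fun (setT : set R)
    (fun z => (\sum_(l < m) c l w * z ^+ l)%:E).
  apply/measurable_EFinP; apply: measurable_sum => l.
  by apply: measurable_funM => //; exact: exprn_measurable.
rewrite ge0_integral_distribution//; last by move=> z; rewrite lee_fin.
transitivity (\int[distribution P X']_z (\sum_(l < m) c l w * z ^+ l)%:E)%E.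
  by rewrite ge0_integral_distribution// => z; rewrite lee_fin.
by apply: eq_measure_integral => A mA _; exact: gauss.
Qed.

End FreshGaussian.

(** * Moment inequalities for one Gaussian entry *)

(** Adaptedness of an expression built from ring operations, by recursion on it.
    The functions are passed explicitly because unification does not find them
    under the binder. *)
Ltac solve_adapted :=
  lazymatch goal with
  | |- adapted _ _ (fun w => @GRing.add _ (@?F w) (@?G w)) =>
      refine (@adaptedD _ _ _ _ _ _ _ F G _ _); solve_adapted
  | |- adapted _ _ (fun w => @GRing.opp _ (@?F w)) =>
      refine (@adaptedN _ _ _ _ _ _ _ F _); solve_adapted
  | |- adapted _ _ (fun w => @GRing.mul _ (@?F w) (@?G w)) =>
      refine (@adaptedM _ _ _ _ _ _ _ F G _ _); solve_adapted
  | |- adapted _ _ (fun w => @GRing.exp _ (@?F w) ?n) =>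
      refine (@adaptedXn _ _ _ _ _ _ _ F n _); solve_adapted
  | |- adapted _ _ (fun w => @GRing.inv _ (@?F w)) =>
      refine (@adaptedV _ _ _ _ _ _ _ F _); solve_adapted
  | |- _ => first
      [ assumption | exact: adapted_cst | by apply: adaptedX; rewrite ?inE
      | idtac ]
  end.

Section OneStep.
Context (R : realType) (d : measure_display) (T : measurableType d)
  (P : probability T R) (I : finType) (X : I -> {RV P >-> R}).
Hypothesis indep : mutually_independent X.
Variables (J : {set I}) (i : I).
Hypothesis iJ : i \notin J.
Hypothesis gauss : forall A : set R, measurable A ->
  distribution P (X i) A = normal_prob 0 1 A.
Implicit Types M a b h y : T -> R.
Local Notation mom := (normal_moment R).
Local Notation mean := (mean P).

Lemma adapted_setT F : adapted X J F -> adapted X [set: I] F.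
Proof. by apply: adapted_sub; exact: finset.subsetT. Qed.

(** The polynomial is a majorant of [F] and not [F] itself: a suitable choice of
    it suppresses the moments of odd order. *)
Lemma mean_fresh_le (m : nat) (c : nat -> T -> R) (F G : T -> R) :
  (forall l, adapted X J (c l)) ->
  (forall w z, 0 <= \sum_(l < m) c l w * z ^+ l) ->
  adapted X [set: I] F -> (forall w, 0 <= F w) ->
  (forall w, F w <= \sum_(l < m) c l w * X i w ^+ l) ->
  adapted X J G ->
  (forall w, \sum_(l < m) c l w * mom l <= G w) ->
  (mean F <= mean G)%E.
Proof.
move=> mc c0 mF F0 Fc mG cG.
apply: (@le_trans _ _ (mean (fun w => \sum_(l < m) c l w * X i w ^+ l)%R)).
  apply: le_mean => //; first exact: adapted_measurable mF.
  apply: (@adapted_measurable _ _ _ _ _ X [set: I]).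
  apply: adapted_sum => l _; apply: adaptedM; first exact: adapted_setT.
  by solve_adapted.
have E := mean_fresh_poly indep iJ gauss mc c0; rewrite E.
(* [le_mean] compares nonnegative variables; here the smaller one is, at each
   sample point, the normal integral of a nonnegative polynomial. *)
apply: le_mean => //.
- apply: (@adapted_measurable _ _ _ _ _ X J).
  by apply: adapted_sum => l _; apply: adaptedM => //; exact: adapted_cst.
- exact: adapted_measurable mG.
- move=> w; rewrite -lee_fin -(integral_normal_poly (fun l => c l w)).
  by apply: integral_ge0 => z _; rewrite lee_fin.
Qed.

Definition sq_step_const : R := 2 * (1 + `|mom 4|).

Lemma sq_step_const_ge0 : 0 <= sq_step_const.
Proof. by rewrite mulr_ge0// addr_ge0. Qed.

(** A martingale increment contributes its variance. Adding the square of
    [a (z^2 - 1) - b z] doubles this variance and cancels the product of the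
    two terms, whose mean involves the third moment. *)
Lemma mean_sq_step M a b :
  adapted X J M -> adapted X J a -> adapted X J b ->
  (mean (fun w => (M w + (a w * (X i w ^+ 2 - 1) + b w * X i w)) ^+ 2)%R <=
   mean (fun w => M w ^+ 2 + sq_step_const * (a w ^+ 2 + b w ^+ 2))%R)%E.
Proof.
move=> aM aa ab.
have [M' a' b'] := And3 (adapted_setT aM) (adapted_setT aa) (adapted_setT ab).
pose c := nth (fun=> 0) [:: fun w => M w ^+ 2 - 2 * (M w * a w) + 2 * a w ^+ 2;
  fun w => 2 * (M w * b w);
  fun w => 2 * (M w * a w) - 4%:R * a w ^+ 2 + 2 * b w ^+ 2;
  fun=> 0; fun w => 2 * a w ^+ 2].
have cE w z : \sum_(l < 5) c l w * z ^+ l =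
    (M w + (a w * (z ^+ 2 - 1) + b w * z)) ^+ 2 +
    (a w * (z ^+ 2 - 1) - b w * z) ^+ 2.
  by rewrite !big_ord_recl big_ord0 /c /=; ring.
apply: (@mean_fresh_le 5 c).
- by move=> [|[|[|[|[|l]]]]]; rewrite /c /= ?nth_nil; solve_adapted.
- by move=> w z; rewrite cE addr_ge0 ?sqr_ge0.
- by solve_adapted.
- by move=> w; exact: sqr_ge0.
- by move=> w; rewrite cE lerDl sqr_ge0.
- by solve_adapted.
move=> w; rewrite !big_ord_recl big_ord0 /c /= /sq_step_const.
rewrite normal_moment0 (normal_moment12 R).1 (normal_moment12 R).2.
have := ler_norm (mom 4); have := sqr_ge0 (a w); have := sqr_ge0 (b w).
have : 0 <= `|mom 4| by []; nra.
Qed.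

Definition pow4_step_const : R := 128%:R * ((mom 4 - 1) ^+ 2 + 1) +
  24%:R * (`|mom 8 - 4%:R * mom 6 + 6%:R * mom 4 - 3%:R| + `|mom 4|).

Lemma pow4_step_const_ge0 : 0 <= pow4_step_const.
Proof. by rewrite addr_ge0// mulr_ge0// addr_ge0// sqr_ge0. Qed.

(** The increment has mean zero, so the term of degree 3 in [M] disappears, and
    the one of degree 2 is split by [2 u v <= p^-1 u^2 + p v^2]. Over [p] steps
    the factors [1 + p^-1] multiply to at most [e], whereas the fourth powers
    of the increments accumulate with weight [p]: for [p] increments of order 1
    the total is of order [p^2], as for a sum of independent terms. *)
Lemma mean_pow4_step M a b (p : R) : 1 <= p ->
  adapted X J M -> adapted X J a -> adapted X J b ->
  (mean (fun w => (M w + (a w * (X i w ^+ 2 - 1) + b w * X i w)) ^+ 4)%R <=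
   mean (fun w => (1 + p^-1) * M w ^+ 4 +
                  pow4_step_const * p * (a w ^+ 4 + b w ^+ 4))%R)%E.
Proof.
move=> p1 aM aa ab.
have [M' a' b'] := And3 (adapted_setT aM) (adapted_setT aa) (adapted_setT ab).
pose c := nth (fun=> 0) [::
  fun w => M w ^+ 4 - 4%:R * M w ^+ 3 * a w + 16%:R * M w ^+ 2 * a w ^+ 2 + 24%:R * a w ^+ 4;
  fun w => 4%:R * M w ^+ 3 * b w;
  fun w => 4%:R * M w ^+ 3 * a w + 16%:R * M w ^+ 2 * (b w ^+ 2 - 2 * a w ^+ 2) - 96%:R * a w ^+ 4;
  fun=> 0;
  fun w => 16%:R * M w ^+ 2 * a w ^+ 2 + 24%:R * (6%:R * a w ^+ 4 + b w ^+ 4);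
  fun=> 0;
  fun w => - (96%:R * a w ^+ 4);
  fun=> 0;
  fun w => 24%:R * a w ^+ 4].
have cE w z : \sum_(l < 9) c l w * z ^+ l =
    M w ^+ 4 + 4%:R * M w ^+ 3 * (a w * (z ^+ 2 - 1) + b w * z) +
    16%:R * M w ^+ 2 * ((a w * (z ^+ 2 - 1)) ^+ 2 + (b w * z) ^+ 2) +
    24%:R * ((a w * (z ^+ 2 - 1)) ^+ 4 + (b w * z) ^+ 4).
  by rewrite !big_ord_recl big_ord0 /c /=; ring.
have key (m u v : R) : (m + (u + v)) ^+ 4 <= m ^+ 4 + 4%:R * m ^+ 3 * (u + v) +
    16%:R * m ^+ 2 * (u ^+ 2 + v ^+ 2) + 24%:R * (u ^+ 4 + v ^+ 4).
  (* Young's inequality for the cubic term in [s]: the gap is a perfect square. *)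
  have h1 (s : R) : (m + s) ^+ 4 <= m ^+ 4 + 4%:R * m ^+ 3 * s +
      8%:R * (m * s) ^+ 2 + 3%:R * s ^+ 4.
    rewrite -subr_ge0 (_ : _ - _ = 2 * (m * s - s ^+ 2) ^+ 2); last by ring.
    by rewrite mulr_ge0 ?sqr_ge0.
  have h2 : m ^+ 2 * (u + v) ^+ 2 <= 2 * (m ^+ 2 * (u ^+ 2 + v ^+ 2)).
    rewrite -subr_ge0 (_ : _ - _ = (m * (u - v)) ^+ 2) ?sqr_ge0//; ring.
  have h3 : (u + v) ^+ 4 <= 8%:R * (u ^+ 4 + v ^+ 4).
    rewrite -subr_ge0 (_ : _ - _ = 4%:R * (u ^+ 2 - v ^+ 2) ^+ 2 +
      (u - v) ^+ 2 * (2 * (u + v) ^+ 2 + (u - v) ^+ 2)); last by ring.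
    apply: addr_ge0; apply: mulr_ge0; rewrite ?sqr_ge0//.
    by apply: addr_ge0; rewrite ?sqr_ge0// mulr_ge0 ?sqr_ge0.
  have := h1 (u + v); rewrite exprMn; lra.
apply: (@mean_fresh_le 9 c).
- by move=> [|[|[|[|[|[|[|[|[|l]]]]]]]]]; rewrite /c /= ?nth_nil; solve_adapted.
- by move=> w z; rewrite cE (le_trans _ (key _ _ _))// (exprM _ 2 2) sqr_ge0.
- by solve_adapted.
- by move=> w; rewrite (exprM _ 2 2) sqr_ge0.
- by move=> w; rewrite cE key.
- by solve_adapted.
move=> w; rewrite !big_ord_recl big_ord0 /c /= /pow4_step_const.
rewrite normal_moment0 (normal_moment12 R).1 (normal_moment12 R).2.
set Mw := M w; set A := a w; set B := b w.
set k1 := mom 4 - 1; set k2 := mom 8 - _ + _ - _.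
have p0 : 0 < p by lra.
have e1 : 16%:R * (Mw ^+ 2 * (k1 * A ^+ 2 + B ^+ 2)) <=
    p^-1 * Mw ^+ 4 + 128%:R * p * (k1 ^+ 2 * A ^+ 4 + B ^+ 4).
  have q : 0 <= p^-1 * (Mw ^+ 2 - 8%:R * p * (k1 * A ^+ 2 + B ^+ 2)) ^+ 2.
    by rewrite mulr_ge0 ?sqr_ge0 ?invr_ge0 ?ltW.
  have q2 : 0 <= p * (k1 * A ^+ 2 - B ^+ 2) ^+ 2.
    by rewrite mulr_ge0 ?sqr_ge0 ?ltW.
  move: q; rewrite (_ : p^-1 * _ = p^-1 * Mw ^+ 4 - 16%:R * (Mw ^+ 2 * (k1 * A ^+ 2 + B ^+ 2))
    + 64%:R * p * (k1 * A ^+ 2 + B ^+ 2) ^+ 2); last by field; rewrite gt_eqF.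
  have : p * (k1 * A ^+ 2 + B ^+ 2) ^+ 2 = 2 * (p * (k1 ^+ 2 * A ^+ 4 + B ^+ 4)) -
    p * (k1 * A ^+ 2 - B ^+ 2) ^+ 2 by ring.
  lra.
have A4 : 0 <= A ^+ 4 by rewrite (exprM A 2 2) sqr_ge0.
have B4 : 0 <= B ^+ 4 by rewrite (exprM B 2 2) sqr_ge0.
have e2 : k2 * A ^+ 4 <= p * (`|k2| * A ^+ 4).
  rewrite (@le_trans _ _ (`|k2| * A ^+ 4)) ?ler_wpM2r ?ler_norm//.
  by rewrite ler_peMl// mulr_ge0.
have e3 : mom 4 * B ^+ 4 <= p * (`|mom 4| * B ^+ 4).
  rewrite (@le_trans _ _ (`|mom 4| * B ^+ 4)) ?ler_wpM2r ?ler_norm//.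
  by rewrite ler_peMl// mulr_ge0.
have pp (v : R) : 0 <= v -> 0 <= p * v by move=> v0; rewrite mulr_ge0// ltW.
have f1 := pp _ A4.
have f2 := pp _ (mulr_ge0 (normr_ge0 k2) B4).
have f3 := pp _ (mulr_ge0 (normr_ge0 (mom 4)) A4).
have f4 := pp _ (mulr_ge0 (sqr_ge0 k1) B4).
set L := (X in X <= _); set U := (X in _ <= X).
have -> : L = Mw ^+ 4 + 16%:R * (Mw ^+ 2 * (k1 * A ^+ 2 + B ^+ 2)) +
  24%:R * (k2 * A ^+ 4 + mom 4 * B ^+ 4) by rewrite /L /k1 /k2 /=; ring.
have -> : U = Mw ^+ 4 + p^-1 * Mw ^+ 4 +
  128%:R * p * (k1 ^+ 2 * A ^+ 4 + B ^+ 4) + 128%:R * (p * (k1 ^+ 2 * B ^+ 4))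
  + 128%:R * (p * A ^+ 4) + 24%:R * (p * (`|k2| * A ^+ 4) + p * (`|mom 4| * B ^+ 4)
   + p * (`|k2| * B ^+ 4) + p * (`|mom 4| * A ^+ 4)) by rewrite /U; ring.
lra.
Qed.

Definition cross_coeff : R := 6%:R + 2 * `|mom 3|.
Definition budget_coeff : R := cross_coeff + `|mom 4|.

Lemma cross_coeff_ge0 : 0 <= cross_coeff.
Proof. by rewrite addr_ge0// mulr_ge0. Qed.

Lemma budget_coeff_ge0 : 0 <= budget_coeff.
Proof. by rewrite addr_ge0// cross_coeff_ge0. Qed.

(** A supermartingale that dominates [y ^+ 4]: its mean does not grow when the
    linear form [y] receives a fresh term with coefficient [h] while the variance
    [r] still to be spent drops by [h ^+ 2]. It starts from [budget_coeff * r ^+ 2]. *)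
Definition linear_potential (y r : R) : R :=
  y ^+ 4 + cross_coeff * (y ^+ 2 * r) + budget_coeff * r ^+ 2.

Lemma mean_potential_step y h (r : T -> R) :
  adapted X J y -> adapted X J h -> adapted X J r ->
  (forall w, 0 <= r w - h w ^+ 2) ->
  (mean (fun w => linear_potential (y w + h w * X i w) (r w - h w ^+ 2))%R <=
   mean (fun w => linear_potential (y w) (r w))%R)%E.
Proof.
move=> ay ah ar r0.
have [y' h' r'] := And3 (adapted_setT ay) (adapted_setT ah) (adapted_setT ar).
have A0 : 6%:R <= cross_coeff by rewrite lerDl mulr_ge0.
have B0 : cross_coeff <= budget_coeff by rewrite lerDl.
pose c := nth (fun=> 0) [::
  fun w => y w ^+ 4 + cross_coeff * (y w ^+ 2 * (r w - h w ^+ 2)) +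
           budget_coeff * (r w - h w ^+ 2) ^+ 2;
  fun w => 4%:R * y w ^+ 3 * h w + cross_coeff * (2 * (y w * h w) * (r w - h w ^+ 2));
  fun w => 6%:R * y w ^+ 2 * h w ^+ 2 + cross_coeff * (h w ^+ 2 * (r w - h w ^+ 2));
  fun w => 4%:R * y w * h w ^+ 3;
  fun w => h w ^+ 4].
have cE w z : \sum_(l < 5) c l w * z ^+ l =
    linear_potential (y w + h w * z) (r w - h w ^+ 2).
  by rewrite !big_ord_recl big_ord0 /c /= /linear_potential; ring.
have pot0 (u v : R) : 0 <= v -> 0 <= linear_potential u v.
  move=> v0; rewrite /linear_potential (exprM u 2 2).
  have [A1 B1] := (cross_coeff_ge0, budget_coeff_ge0).
  apply: addr_ge0; last exact: (mulr_ge0 B1 (sqr_ge0 _)).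
  exact: (addr_ge0 (sqr_ge0 _) (mulr_ge0 A1 (mulr_ge0 (sqr_ge0 _) v0))).
apply: (@mean_fresh_le 5 c).
- by move=> [|[|[|[|[|l]]]]]; rewrite /c /= ?nth_nil; solve_adapted.
- by move=> w z; rewrite cE pot0.
- by rewrite /linear_potential; solve_adapted.
- by move=> w; exact: pot0.
- by move=> w; rewrite cE.
- by rewrite /linear_potential; solve_adapted.
move=> w; rewrite !big_ord_recl big_ord0 /c /= /linear_potential.
rewrite normal_moment0 (normal_moment12 R).1 (normal_moment12 R).2.
move: (r0 w) => r0w; set Y := y w; set H := h w; set V := r w in r0w *.
set s := V - H ^+ 2 in r0w *.
have -> : V = s + H ^+ 2 by rewrite /s; ring.
have h2 : 0 <= H ^+ 2 := sqr_ge0 _.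
have e1 : 4%:R * (Y * H ^+ 3) * mom 3 <= 2 * `|mom 3| * (Y ^+ 2 * H ^+ 2 + H ^+ 4).
  have t1 : 4%:R * (Y * H ^+ 3) * mom 3 <= `|4%:R * (Y * H ^+ 3)| * `|mom 3|.
    by rewrite -normrM ler_norm.
  have t2 : `|4%:R * (Y * H ^+ 3)| <= 2 * (Y ^+ 2 * H ^+ 2 + H ^+ 4).
    have := sqr_ge0 (Y * H - H ^+ 2); have := sqr_ge0 (Y * H + H ^+ 2).
    by rewrite ler_norml !sqrrD !sqrrN => ? ?; apply/andP; split; lra.
  have t3 : `|4%:R * (Y * H ^+ 3)| * `|mom 3| <= 2 * (Y ^+ 2 * H ^+ 2 + H ^+ 4) * `|mom 3|.
    by rewrite ler_wpM2r.
  lra.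
have h4 : 0 <= H ^+ 4 by rewrite (_ : H ^+ 4 = (H ^+ 2) ^+ 2) ?sqr_ge0//; ring.
have e2 : mom 4 * H ^+ 4 <= `|mom 4| * H ^+ 4 by rewrite ler_wpM2r ?ler_norm.
have e3 : 0 <= (2 * budget_coeff - cross_coeff) * (s * H ^+ 2).
  by apply: mulr_ge0; [lra|exact: mulr_ge0].
rewrite /bump /=; move: e3; rewrite /budget_coeff /cross_coeff; lra.
Qed.

End OneStep.

(** * Variance of a centred quadratic form in one row *)

Section QuadraticDeviation.
Context (R : realType).

Lemma sum_ord_ltS (V : nmodType) p (F : 'I_p -> V) K (hK : (K < p)%N) :
  \sum_(k < p | (k < K.+1)%N) F k = \sum_(k < p | (k < K)%N) F k + F (Ordinal hK).
Proof.
rewrite (bigD1 (Ordinal hK)) /=; last exact: ltnSn.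
rewrite addrC; congr (_ + _); apply: eq_bigl => k.
by rewrite ltnS -val_eqE /= ltn_neqAle andbC.
Qed.

Definition qdev p (H : 'M[R]_p) (x : 'cV[R]_p) : R := quad_form H x - \tr H.

Lemma quad_formE p (H : 'M[R]_p) (x : 'cV[R]_p) :
  quad_form H x = \sum_k \sum_l H k l * x k ord0 * x l ord0.
Proof.
rewrite /quad_form mxE exchange_big /=; apply: eq_bigr => l _.
rewrite mxE mulr_suml; apply: eq_bigr => k _; rewrite mxE; ring.
Qed.

(** Revealing the coordinates of [x] one at a time writes the centred
    quadratic form as a sum of martingale differences. *)
Lemma qdevE p (H : 'M[R]_p) (x : 'cV[R]_p) :
  qdev H x = \sum_k (H k k * (x k ord0 ^+ 2 - 1) +
    (\sum_(l < p | (l < k)%N) (H k l + H l k) * x l ord0) * x k ord0).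
Proof.
rewrite /qdev quad_formE /mxtrace.
have split (k : 'I_p) : \sum_l H k l * x k ord0 * x l ord0 =
    H k k * x k ord0 ^+ 2 + \sum_(l < p | (l < k)%N) H k l * x k ord0 * x l ord0 +
    \sum_(l < p | (k < l)%N) H k l * x k ord0 * x l ord0.
  rewrite (bigD1 k)//= (bigID (fun l : 'I_p => (l < k)%N)) /= addrA expr2 mulrA.
  congr (_ + _ + _); apply: eq_bigl => l.
    by rewrite -val_eqE /=; case: ltngtP.
  by rewrite -val_eqE /=; case: ltngtP.
under eq_bigr do rewrite split.
rewrite !big_split /= [X in _ + X - _](exchange_big_dep xpredT)//= -[_ + _ + \sum__ _]addrA -big_split /= addrAC.
rewrite -sumrB; congr (_ + _); first by apply: eq_bigr => k _; ring.
apply: eq_bigr => k _; rewrite mulr_suml -big_split /=; apply: eq_bigr => l _.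
ring.
Qed.

End QuadraticDeviation.

Section Rows.
Context (R : realType) (d : measure_display) (T : measurableType d)
  (P : probability T R) (I : finType) (X : I -> {RV P >-> R}).
Hypothesis indep : mutually_independent X.
Variables (n p : nat) (idx : 'I_n -> 'I_p -> I).
Hypothesis idx_inj : forall r k r' k', idx r k = idx r' k' -> r = r' /\ k = k'.
Hypothesis gauss : forall r k (A : set R), measurable A ->
  distribution P (X (idx r k)) A = normal_prob 0 1 A.
Local Notation mean := (mean P).

(** Rows are read one after the other, each one entry by entry; the past of entry
    [k] of row [r] consists of earlier rows and earlier entries of row [r]. *)
Definition before (r k : nat) : {set I} :=
  [set i | [exists r' : 'I_n, [exists k' : 'I_p, (i == idx r' k') &&
    ((r' < r)%N || (r' == r :> nat) && (k' < k)%N)]]].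

Definition row_vec (r : 'I_n) (w : T) : 'cV[R]_p := \col_k X (idx r k) w.

Lemma mem_before (r' : 'I_n) (k' : 'I_p) r k :
  (idx r' k' \in before r k) = ((r' < r)%N || (r' == r :> nat) && (k' < k)%N).
Proof.
rewrite inE; apply/existsP/idP => [[r1 /existsP[k1 /andP[/eqP /idx_inj[-> ->]]]]//|h].
by exists r'; apply/existsP; exists k'; rewrite eqxx.
Qed.

Lemma fresh_before (r : 'I_n) (k : 'I_p) : idx r k \notin before r k.
Proof. by rewrite mem_before !ltnn andbF. Qed.

Lemma before_sub r k r' k' : (r < r')%N || (r == r' :> nat) && (k <= k')%N ->
  before r k \subset before r' k'.
Proof.
move=> h; apply/fintype.subsetP => i; rewrite !inE => /existsP[r1 /existsP[k1 /andP[e h1]]].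
apply/existsP; exists r1; apply/existsP; exists k1; rewrite e /=.
case/orP: h => [h|/andP[/eqP <- h]].
  by case/orP: h1 => [/ltn_trans-> //|/andP[/eqP -> _]]; rewrite h.
by case/orP: h1 => [->//|/andP[-> h1]]; rewrite (leq_trans h1 h) orbT.
Qed.

Lemma before_grow (r : nat) k F : adapted X (before r 0) F -> adapted X (before r k) F.
Proof. by apply: adapted_sub; apply: before_sub; rewrite eqxx orbT. Qed.

Local Notation x r k := (X (idx r k)).

(** The coefficients [a k] and [b k] may depend on the earlier entries of the
    row, so that the terms are martingale differences: their second moments
    add up. *)
Lemma row_sq (r : 'I_n) (M : T -> R) (a b : 'I_p -> T -> R) K : (K <= p)%N ->
  adapted X (before r 0) M ->
  (forall k : 'I_p, adapted X (before r k) (a k)) ->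
  (forall k : 'I_p, adapted X (before r k) (b k)) ->
  (mean (fun w => (M w + \sum_(k < p | (k < K)%N)
       (a k w * (x r k w ^+ 2 - 1) + b k w * x r k w)) ^+ 2)%R <=
   mean (fun w => M w ^+ 2 + sq_step_const R *
       \sum_(k < p | (k < K)%N) (a k w ^+ 2 + b k w ^+ 2))%R)%E.
Proof.
move=> Kp aM aa ab.
have c0 := sq_step_const_ge0 R.
elim: K Kp => [|K ih] Kp.
  rewrite le_eqVlt; apply/orP; left; apply/eqP; congr mean; apply/funext => w.
  by rewrite !big_pred0// mulr0 !addr0.
set k0 := Ordinal Kp.
pose M' w := M w + \sum_(k < p | (k < K)%N) (a k w * (x r k w ^+ 2 - 1) + b k w * x r k w).
have sub0 (k : 'I_p) : (k < K)%N -> before r k \subset before r K.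
  by move=> kK; apply: before_sub; rewrite eqxx (ltnW kK) orbT.
have aM' : adapted X (before r k0) M'.
  apply: adaptedD; first exact: before_grow.
  apply: adapted_sum => k kK.
  have ak := adapted_sub (sub0 k kK) (aa k); have bk := adapted_sub (sub0 k kK) (ab k).
  have xk : adapted X (before r k0) (x r k).
    by apply: adaptedX; rewrite mem_before eqxx /= kK orbT.
  by solve_adapted.
have mF F : (exists J, adapted X J F) -> measurable_fun setT F.
  by case=> J; exact: adapted_measurable.
have mM' : measurable_fun setT M' by apply: mF; eexists; exact: aM'.
have mM : measurable_fun setT M by apply: mF; eexists; exact: aM.
have ma k : measurable_fun setT (a k) by apply: mF; eexists; exact: aa.
have mb k : measurable_fun setT (b k) by apply: mF; eexists; exact: ab.
have mab k : measurable_fun setT (fun w => a k w ^+ 2 + b k w ^+ 2).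
  by apply: measurable_funD; exact: measurable_funX.
have ms : measurable_fun setT (fun w => \sum_(k < p | (k < K)%N) (a k w ^+ 2 + b k w ^+ 2)).
  by apply: measurable_sum_cond => k _.
have ab0 k w : 0 <= a k w ^+ 2 + b k w ^+ 2 by rewrite addr_ge0 ?sqr_ge0.
apply: (@le_trans _ _ (mean (fun w => M' w ^+ 2 +
    sq_step_const R * (a k0 w ^+ 2 + b k0 w ^+ 2))%R)).
  have := @mean_sq_step _ _ _ _ _ X indep (before r k0) (idx r k0) (fresh_before r k0)
    (@gauss r k0) M' (a k0) (b k0) aM' (aa k0) (ab k0).
  move/(le_trans _); apply; rewrite le_eqVlt; apply/orP; left; apply/eqP.
  congr mean; apply/funext => w.
  by rewrite /M' (sum_ord_ltS _ Kp) -/k0 addrA.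
rewrite meanD; last 4 first.
- exact: measurable_funX.
- exact: measurable_funM.
- by move=> w; exact: sqr_ge0.
- by move=> w; rewrite mulr_ge0.
apply: (le_trans (leeD (ih (ltnW Kp)) (lexx _))).
rewrite -meanD.
- rewrite le_eqVlt; apply/orP; left; apply/eqP; congr mean; apply/funext => w.
  by rewrite [in RHS](sum_ord_ltS _ Kp) -/k0 [in RHS]mulrDr addrA.
- by apply: measurable_funD; [exact: measurable_funX|exact: measurable_funM].
- exact: measurable_funM.
- by move=> w; rewrite addr_ge0 ?sqr_ge0// mulr_ge0// sumr_ge0.
- by move=> w; rewrite mulr_ge0.
Qed.

Definition adapted_mx (J : {set I}) m1 m2 (A : T -> 'M[R]_(m1, m2)) :=
  forall i j, adapted X J (fun w => A w i j).

Definition quad_const : R := sq_step_const R * (1 + 2 * sq_step_const R).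

Lemma quad_const_ge0 : 0 <= quad_const.
Proof.
have L0 := sq_step_const_ge0 R.
by apply: mulr_ge0 => //; apply: addr_ge0 => //; exact: mulr_ge0.
Qed.

Definition frob2 m1 m2 (A : 'M[R]_(m1, m2)) : R := \sum_i \sum_j A i j ^+ 2.

(** Given the previous rows, the centred quadratic form in a new row has mean zero
    and variance at most a multiple of the squared Frobenius norm. This follows
    from two uses of [row_sq]: for the form itself, whose coefficients [b k] are
    linear in the entries, and then for each [b k]. *)
Lemma mean_sq_qdev (r : 'I_n) (M : T -> R) (H : T -> 'M[R]_p) :
  adapted X (before r 0) M -> adapted_mx (before r 0) H ->
  (mean (fun w => (M w + qdev (H w) (row_vec r w)) ^+ 2)%R <=
   mean (fun w => M w ^+ 2 + quad_const * frob2 (H w))%R)%E.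
Proof.
move=> aM aH.
have c0 := sq_step_const_ge0 R.
have aHk (k : nat) i j := before_grow (k := k) (aH i j).
pose h (k l : 'I_p) w := H w k l + H w l k.
pose b (k : 'I_p) w := \sum_(l < p | (l < k)%N) h k l w * x r l w.
have ah (K : nat) k l : adapted X (before r K) (h k l).
  by apply: adaptedD; exact: aHk.
have ab (k : 'I_p) : adapted X (before r k) (b k).
  apply: adapted_sum => l lk; apply: adaptedM; first exact: ah.
  by apply: adaptedX; rewrite mem_before eqxx lk orbT.
have mF F : (exists J, adapted X J F) -> measurable_fun setT F.
  by case=> J; exact: adapted_measurable.
have mH i j : measurable_fun setT (fun w => H w i j) by apply: mF; eexists; exact: aH.
have mM : measurable_fun setT M by apply: mF; eexists; exact: aM.
have mb k : measurable_fun setT (b k) by apply: mF; eexists; exact: ab.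
have mh k l : measurable_fun setT (h k l) by apply: mF; eexists; exact: (ah 0%N).
have msum (Q : pred 'I_p) (F : 'I_p -> T -> R) : (forall k, measurable_fun setT (F k)) ->
    measurable_fun setT (fun w => \sum_(l < p | Q l) F l w).
  by move=> mF'; apply: measurable_sum_cond => k _.
have step1 := @row_sq r M (fun k w => H w k k) b p (leqnn p) aM
  (fun k => aHk k k k) ab.
have a0 J : adapted X J (fun=> 0) by exact: adapted_cst.
have mb2 (k : 'I_p) : (mean (fun w => b k w ^+ 2)%R <=
    mean (fun w => sq_step_const R * \sum_(l < p | (l < k)%N) h k l w ^+ 2)%R)%E.
  have := @row_sq r (fun=> 0) (fun _ _ => 0) (h k) k (ltnW (ltn_ord k)) (a0 _)
    (fun k => a0 _) (fun l => ah l k l).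
  move/(le_trans _) => /(_ (mean (fun w => b k w ^+ 2)%R)) le1.
  apply: le_trans (le1 _) _; last first.
  - rewrite le_eqVlt; apply/orP; left; apply/eqP; congr mean; apply/funext => w.
    rewrite /= expr0n /= add0r; congr (_ * _); apply: eq_bigr => l _.
    by rewrite add0r.
  - rewrite le_eqVlt; apply/orP; left; apply/eqP; congr mean; apply/funext => w.
    by rewrite /= add0r; congr (_ ^+ 2); apply: eq_bigr => l _; rewrite mul0r add0r.
have full (F : 'I_p -> R) : \sum_(k < p | (k < p)%N) F k = \sum_k F k.
  by apply: eq_bigl => k; rewrite ltn_ord.
apply: (@le_trans _ _ (mean (fun w => M w ^+ 2 + sq_step_const R *
   \sum_k (H w k k ^+ 2 + b k w ^+ 2))%R)).
  apply: le_trans (le_trans _ step1) _; rewrite le_eqVlt; apply/orP; left; apply/eqP.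
    by congr mean; apply/funext => w; rewrite qdevE full; congr ((_ + _) ^+ 2);
       apply: eq_bigr => k _; rewrite !mxE; congr (_ + _ * _); apply: eq_bigr => l _; rewrite mxE.
  by congr mean; apply/funext => w; rewrite full.
have mk k : measurable_fun setT (fun w => H w k k ^+ 2) by exact: measurable_funX.
have mbk k : measurable_fun setT (fun w => b k w ^+ 2) by exact: measurable_funX.
have mhh (k : 'I_p) : measurable_fun setT (fun w => sq_step_const R * \sum_(l < p | (l < k)%N) h k l w ^+ 2).
  by apply: measurable_funM => //; apply: msum => l; exact: measurable_funX.
have hh0 (k : 'I_p) w : 0 <= sq_step_const R * \sum_(l < p | (l < k)%N) h k l w ^+ 2.
  by rewrite mulr_ge0// sumr_ge0// => l _; exact: sqr_ge0.
apply: (@le_trans _ _ (mean (fun w => M w ^+ 2 + sq_step_const R *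
   \sum_k (H w k k ^+ 2 + sq_step_const R * \sum_(l < p | (l < k)%N) h k l w ^+ 2))%R)).
  have dist (B : 'I_p -> T -> R) : (forall k, measurable_fun setT (B k)) ->
      (forall k w, 0 <= B k w) ->
      mean (fun w => M w ^+ 2 + sq_step_const R * \sum_k (H w k k ^+ 2 + B k w))%R =
      (mean (fun w => M w ^+ 2)%R + (sq_step_const R)%:E *
        \sum_k (mean (fun w => H w k k ^+ 2)%R + mean (B k)))%E.
    move=> mB B0; rewrite meanD.
    - rewrite meanZ//.
      + rewrite mean_sum.
        * congr (_ + _ * _)%E; apply: eq_bigr => k _; rewrite meanD//.
          by move=> w; exact: sqr_ge0.
        * by move=> k _; exact: measurable_funD.
        * by move=> k w; rewrite addr_ge0 ?sqr_ge0.
      + by apply: msum => k; exact: measurable_funD.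
      + by move=> w; rewrite sumr_ge0// => k _; rewrite addr_ge0 ?sqr_ge0.
    - exact: measurable_funX.
    - by apply: measurable_funM => //; apply: msum => k; exact: measurable_funD.
    - by move=> w; exact: sqr_ge0.
    - by move=> w; rewrite mulr_ge0// sumr_ge0// => k _; rewrite addr_ge0 ?sqr_ge0.
  rewrite !dist//; last by move=> k w; exact: sqr_ge0.
  apply: leeD => //; apply: lee_wpmul2l; first by rewrite lee_fin.
  by apply: lee_sum => k _; apply: leeD.
apply: le_mean.
- apply: measurable_funD; first exact: measurable_funX.
  by apply: measurable_funM => //; apply: msum => k; exact: measurable_funD.
- apply: measurable_funD; first exact: measurable_funX.
  apply: measurable_funM => //; apply: measurable_sum => k.
  by apply: measurable_sum => l; exact: measurable_funX.
- move=> w; rewrite addr_ge0 ?sqr_ge0// mulr_ge0// sumr_ge0// => k _.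
  by rewrite addr_ge0 ?sqr_ge0.
move=> w; rewrite lerD2l /quad_const -mulrA; apply: ler_wpM2l => //.
have F0 : 0 <= frob2 (H w).
  by apply: sumr_ge0 => i _; apply: sumr_ge0 => j _; exact: sqr_ge0.
rewrite big_split /= mulrDl mul1r lerD//.
  apply: ler_sum => k _; rewrite (bigD1 k)//= lerDl sumr_ge0// => l _.
  exact: sqr_ge0.
rewrite -mulr_sumr -mulrA mulrCA; apply: ler_wpM2l => //.
have hH : \sum_(k < p) \sum_(l < p | (l < k)%N) h k l w ^+ 2 <=
    \sum_(k < p) \sum_(l < p | (l < k)%N) 2 * (H w k l ^+ 2 + H w l k ^+ 2).
  apply: ler_sum => k _; apply: ler_sum => l _; rewrite /h.
  by have := sqr_ge0 (H w k l - H w l k); lra.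
apply: (le_trans hH); under eq_bigr do rewrite -mulr_sumr.
rewrite -mulr_sumr; apply: ler_wpM2l => //.
under eq_bigr do rewrite big_split /=.
rewrite big_split /= [X in _ + X](exchange_big_dep xpredT)//= -big_split /=.
apply: ler_sum => k _.
rewrite [leRHS](bigID (fun l : 'I_p => (l < k)%N)) /= lerD2l.
rewrite [leRHS](bigID (fun l : 'I_p => (k < l)%N)) /=.
rewrite -[leLHS]addr0 lerD//; last by apply: sumr_ge0 => l _; exact: sqr_ge0.
rewrite le_eqVlt; apply/orP; left; apply/eqP; apply: eq_bigl => l.
by case: ltngtP.
Qed.

End Rows.

(** * Fourth moment of a centred quadratic form in one row *)

Section FourthMoments.
Context (R : realType) (d : measure_display) (T : measurableType d)
  (P : probability T R) (I : finType) (X : I -> {RV P >-> R}).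
Hypothesis indep : mutually_independent X.
Variables (n p : nat) (idx : 'I_n -> 'I_p -> I).
Hypothesis idx_inj : forall r k r' k', idx r k = idx r' k' -> r = r' /\ k = k'.
Hypothesis gauss : forall r k (A : set R), measurable A ->
  distribution P (X (idx r k)) A = normal_prob 0 1 A.
Local Notation mean := (mean P).
Local Notation before := (before idx).
Local Notation x r k := (X (idx r k)).

(** The potential starts from budget 1, so it starts from [budget_coeff]; it does
    not grow in mean and dominates the fourth power. *)
Lemma mean_pow4_linear (r : 'I_n) (h : 'I_p -> T -> R) K : (K <= p)%N ->
  (forall l, adapted X (before r 0) (h l)) ->
  (forall w, \sum_l h l w ^+ 2 <= 1) ->
  (mean (fun w => (\sum_(l < p | (l < K)%N) h l w * x r l w) ^+ 4)%R <=
   (budget_coeff R)%:E)%E.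
Proof.
move=> Kp ah h1.
pose y K w := \sum_(l < p | (l < K)%N) h l w * x r l w.
pose s K w : R := 1 - \sum_(l < p | (l < K)%N) h l w ^+ 2.
have s0 K' w : 0 <= s K' w.
  rewrite subr_ge0 (le_trans _ (h1 w))// [leRHS](bigID (fun l : 'I_p => (l < K')%N)) /=.
  by rewrite lerDl sumr_ge0// => l _; exact: sqr_ge0.
have ay (K' : nat) : (K' <= p)%N -> adapted X (before r K') (y K').
  move=> _; apply: adapted_sum => l lK; apply: adaptedM; first exact: before_grow.
  by apply: adaptedX; rewrite (mem_before idx_inj) eqxx lK orbT.
have as_ (K' : nat) : adapted X (before r K') (s K').
  apply: adaptedB; first exact: adapted_cst.
  by apply: adapted_sum => l lK; apply: adaptedXn; exact: before_grow.
have pot K' : (K' <= p)%N ->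
    (mean (fun w => linear_potential (y K' w) (s K' w))%R <= (budget_coeff R)%:E)%E.
  elim: K' => [_|K' ih Kp'].
    rewrite -(mean_cst P) le_eqVlt; apply/orP; left; apply/eqP.
    congr mean; apply/funext => w; rewrite /y /s !big_pred0// subr0.
    by rewrite /linear_potential; ring.
  apply: le_trans (ih (ltnW Kp')); set k0 := Ordinal Kp'.
  have E w : s K' w - h k0 w ^+ 2 = s K'.+1 w.
    by rewrite /s (sum_ord_ltS _ Kp') -/k0 opprD addrA.
  have r0 w : 0 <= s K' w - h k0 w ^+ 2 by rewrite E.
  have := @mean_potential_step _ _ _ _ _ X indep (before r k0) (idx r k0)
    (fresh_before idx_inj r k0) (@gauss r k0) (y K') (h k0) (s K')
    (ay _ (ltnW Kp')) (before_grow (ah k0)) (as_ _) r0.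
  apply: le_trans.
  rewrite le_eqVlt; apply/orP; left; apply/eqP; congr mean; apply/funext => w.
  by rewrite E /y (sum_ord_ltS _ Kp').
apply: le_trans (pot K Kp); apply: le_mean.
- apply: measurable_funX; exact: (adapted_measurable (ay _ Kp)).
- have y' := ay _ Kp; have s' := as_ K.
  by apply: (@adapted_measurable _ _ _ _ _ X (before r K)); rewrite /linear_potential; solve_adapted.
- by move=> w; rewrite (exprM _ 2 2) sqr_ge0.
move=> w; rewrite /linear_potential -/(y K w) -addrA lerDl.
have [A0 B0] := (cross_coeff_ge0 R, budget_coeff_ge0 R).
exact: (addr_ge0 (mulr_ge0 A0 (mulr_ge0 (sqr_ge0 _) (s0 _ _))) (mulr_ge0 B0 (sqr_ge0 _))).
Qed.

Definition pow4_const : R := pow4_step_const R * (1 + 16%:R * budget_coeff R) * expR 1.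

Lemma pow4_const_ge0 : 0 <= pow4_const.
Proof.
have [L0 B0] := (pow4_step_const_ge0 R, budget_coeff_ge0 R).
apply: mulr_ge0; last exact: expR_ge0.
by apply: mulr_ge0 => //; apply: addr_ge0 => //; exact: mulr_ge0.
Qed.

(** For a symmetric contraction the centred quadratic form is of the order of the
    square root of [p], with four moments. Two moments would not control the
    order of [p] rows simultaneously at the scale [r * p]; four do. *)
Lemma mean_pow4_qdev (r : 'I_n) (Q : T -> 'M[R]_p) : (0 < p)%N ->
  adapted_mx X (before r 0) Q -> (forall w, Defs.symmetric (Q w)) ->
  (forall w k, \sum_l Q w k l ^+ 2 <= 1) ->
  (mean (fun w => qdev (Q w) (row_vec X idx r w) ^+ 4)%R <=
   (pow4_const * p%:R ^+ 2)%:E)%E.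
Proof.
move=> p0 aQ sQ Q1.
have p1 : (1 : R) <= p%:R by rewrite ler1n.
have pp : (0 : R) < p%:R by rewrite ltr0n.
have [L0 B0] := (pow4_step_const_ge0 R, budget_coeff_ge0 R).
pose G := pow4_step_const R * (1 + 16%:R * budget_coeff R).
have G0 : 0 <= G by rewrite mulr_ge0// addr_ge0// mulr_ge0.
pose y (k : 'I_p) w := \sum_(l < p | (l < k)%N) Q w k l * x r l w.
pose M K w := \sum_(k < p | (k < K)%N)
  (Q w k k * (x r k w ^+ 2 - 1) + 2 * y k w * x r k w).
have ay (k : 'I_p) : adapted X (before r k) (y k).
  apply: adapted_sum => l lk; apply: adaptedM; first by apply: before_grow; exact: aQ.
  by apply: adaptedX; rewrite (mem_before idx_inj) eqxx lk orbT.
have aM K : adapted X (before r K) (M K).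
  apply: adapted_sum => k kK.
  have sub : before r k \subset before r K by apply: before_sub; rewrite eqxx (ltnW kK) orbT.
  have yk := adapted_sub sub (ay k).
  have qk : adapted X (before r K) (fun w => Q w k k) by apply: before_grow; exact: aQ.
  have xk : adapted X (before r K) (x r k).
    by apply: adaptedX; rewrite (mem_before idx_inj) eqxx kK orbT.
  by solve_adapted.
have four0 (v : R) : 0 <= v ^+ 4 by rewrite (exprM _ 2 2) sqr_ge0.
have main K : (K <= p)%N -> (mean (fun w => M K w ^+ 4)%R <=
    (G * p%:R * K%:R * (1 + p%:R^-1) ^+ K)%:E)%E.
  elim: K => [_|K ih Kp].
    rewrite (_ : (fun w => _) = fun=> 0); last first.
      by apply/funext => w; rewrite /M big_pred0// expr0n.
    by rewrite mean_cst mulr0 mul0r.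
  set k0 := Ordinal Kp.
  have ab : adapted X (before r k0) (fun w => 2 * y k0 w).
    by apply: adaptedM; [exact: adapted_cst|exact: ay].
  have aq : adapted X (before r k0) (fun w => Q w k0 k0).
    by apply: before_grow; exact: aQ.
  have := @mean_pow4_step _ _ _ _ _ X indep (before r k0) (idx r k0)
    (fresh_before idx_inj r k0) (@gauss r k0) (M K) _ _ _ p1 (aM K) aq ab.
  rewrite (_ : (fun w => _) = fun w => M K.+1 w ^+ 4); last first.
    by apply/funext => w; rewrite /M (sum_ord_ltS _ Kp).
  move/le_trans; apply.
  have mM := adapted_measurable (aM K); have my := adapted_measurable (ay k0).
  apply: (@le_trans _ _ (mean (fun w => (1 + p%:R^-1) * M K w ^+ 4 +
     (pow4_step_const R * p%:R * 16%:R * y k0 w ^+ 4 + pow4_step_const R * p%:R))%R)).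
    apply: le_mean.
    - have := adapted_measurable aq => mq.
      by apply: measurable_funD; apply: measurable_funM => //;
        [|apply: measurable_funD]; apply: measurable_funX => //; exact: measurable_funM.
    - apply: measurable_funD; first by apply: measurable_funM => //; exact: measurable_funX.
      by apply: measurable_funD => //; apply: measurable_funM => //; exact: measurable_funX.
    - move=> w; apply: addr_ge0; first by rewrite mulr_ge0// addr_ge0// invr_ge0.
      by rewrite mulr_ge0 ?addr_ge0// mulr_ge0.
    move=> w; rewrite lerD2l exprMn.
    have q1 : Q w k0 k0 ^+ 4 <= 1.
      rewrite (exprM _ 2 2) exprn_ile1 ?sqr_ge0// (le_trans _ (Q1 w k0))//.
      by rewrite (bigD1 k0)//= lerDl sumr_ge0// => l _; exact: sqr_ge0.
    have Lp : 0 <= pow4_step_const R * p%:R by rewrite mulr_ge0.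
    have := ler_wpM2l Lp q1; have -> : (2 : R) ^+ 4 = 16%:R by ring.
    lra.
  have Lp16 : 0 <= pow4_step_const R * p%:R * 16%:R.
    by rewrite mulr_ge0 ?mulr_ge0.
  have Lp : 0 <= pow4_step_const R * p%:R by rewrite mulr_ge0.
  rewrite meanD; last 4 first.
  - by apply: measurable_funM => //; exact: measurable_funX.
  - by apply: measurable_funD => //; apply: measurable_funM => //; exact: measurable_funX.
  - by move=> w; rewrite mulr_ge0// addr_ge0// invr_ge0.
  - by move=> w; exact: (addr_ge0 (mulr_ge0 Lp16 (four0 _)) Lp).
  rewrite meanD; last 4 first.
  - by apply: measurable_funM => //; exact: measurable_funX.
  - exact: measurable_cst.
  - by move=> w; exact: (mulr_ge0 Lp16 (four0 _)).
  - by [].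
  have mM4 : measurable_fun setT (fun w => M K w ^+ 4) by exact: measurable_funX.
  have my4 : measurable_fun setT (fun w => y k0 w ^+ 4) by exact: measurable_funX.
  have q0 : 0 <= 1 + (p%:R : R)^-1 by rewrite addr_ge0// invr_ge0.
  rewrite mean_cst (meanZ _ q0 mM4)// (meanZ _ Lp16 my4)//.
  have b1 : (mean (fun w => y k0 w ^+ 4)%R <= (budget_coeff R)%:E)%E.
    exact: (@mean_pow4_linear r (fun l w => Q w k0 l) k0 (ltnW (ltn_ord k0))
      (fun l => aQ k0 l) (fun w => Q1 w k0)).
  apply: (@le_trans _ _ ((1 + p%:R^-1)%:E * (G * p%:R * K%:R * (1 + p%:R^-1) ^+ K)%:E +
     ((pow4_step_const R * p%:R * 16%:R)%:E * (budget_coeff R)%:E + (pow4_step_const R * p%:R)%:E))%E).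
    apply: leeD; first by apply: lee_wpmul2l; [rewrite lee_fin addr_ge0// invr_ge0|exact: ih (ltnW Kp)].
    by apply: leeD => //; apply: lee_wpmul2l => //; rewrite lee_fin.
  rewrite -!EFinM -!EFinD lee_fin exprS -natr1.
  set q := (1 + p%:R^-1) ^+ K.
  have q1 : 1 <= (1 + p%:R^-1) * q.
    by rewrite -exprS exprn_ege1// lerDl invr_ge0.
  have Gp : 0 <= G * p%:R by rewrite mulr_ge0.
  have := ler_wpM2l Gp q1; rewrite /G; lra.
have full w : qdev (Q w) (row_vec X idx r w) = M p w.
  rewrite qdevE /M; under [in RHS]eq_bigl do rewrite ltn_ord.
  apply: eq_bigr => k _; rewrite !mxE; congr (_ + _ * _).
  rewrite /y mulr_sumr; apply: eq_bigr => l _; rewrite mxE.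
  by have /matrixP/(_ k l) := sQ w; rewrite mxE => ->; ring.
rewrite (_ : (fun w => _) = fun w => M p w ^+ 4); last by apply/funext => w; rewrite full.
apply: (le_trans (main p (leqnn p))); rewrite lee_fin /pow4_const -/G.
set q := (1 + p%:R^-1) ^+ p.
have -> : G * p%:R * p%:R * q = G * p%:R ^+ 2 * q by ring.
rewrite [leRHS]mulrAC; apply: ler_wpM2l.
  by rewrite mulr_ge0// sqr_ge0.
apply: (@le_trans _ _ (expR (p%:R^-1) ^+ p)).
  by apply: lerXn2r; rewrite ?nnegrE ?expR_ge0 ?addr_ge0 ?invr_ge0// expR_ge1Dx.
by rewrite -expRM_natl mulfV// gt_eqF.
Qed.

End FourthMoments.

(** * Projections and Gram matrices, row by row *)

Section RowRecursion.
Context (R : realType) (p : nat) (x : nat -> 'cV[R]_p).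

Definition dot (u v : 'cV[R]_p) : R := (u^T *m v) ord0 ord0.

Lemma dotE u v : u^T *m v = (dot u v)%:M.
Proof. exact: mx11_scalar. Qed.

Lemma dotC u v : dot u v = dot v u.
Proof. by rewrite /dot -[in RHS](trmxK u) -trmx_mul [in RHS]mxE. Qed.

Lemma dotxx u : dot u u = sq_norm u.
Proof. exact: trmx_mul_sq_norm. Qed.

Lemma sq_norm_ge0 (u : 'cV[R]_p) : 0 <= sq_norm u.
Proof. by apply: sumr_ge0 => i _; exact: sqr_ge0. Qed.

Lemma quad_form_dot (A : 'M[R]_p) (u : 'cV[R]_p) : quad_form A u = dot u (A *m u).
Proof. by rewrite /quad_form /dot mulmxA. Qed.

Lemma quad_formDl (A B : 'M[R]_p) u : quad_form (A + B) u = quad_form A u + quad_form B u.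
Proof. by rewrite /quad_form mulmxDr mulmxDl mxE. Qed.

Lemma quad_formZl a (A : 'M[R]_p) u : quad_form (a *: A) u = a * quad_form A u.
Proof. by rewrite /quad_form -scalemxAr -scalemxAl mxE. Qed.

Lemma quad_form_outer (u v : 'cV[R]_p) : quad_form (u *m u^T) v = dot u v ^+ 2.
Proof.
rewrite /quad_form mulmxA -mulmxA [u^T *m v]dotE.
rewrite [v^T *m u]dotE mul_scalar_mx !mxE mulr1n dotC.
by rewrite expr2.
Qed.

Lemma trace_outer (u v : 'cV[R]_p) : \tr (u *m v^T) = dot v u.
Proof. by rewrite mxtrace_mulC dotE mxtrace_scalar. Qed.

(** Orthogonal projection onto the complement of the span of the first [j] rows,
    by Gram-Schmidt. Below, [gram_inv j] is the Moore-Penrose inverse of the Gram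
    matrix [gram j]. Rational updates make all of them visibly measurable
    functions of the first [j] rows. *)
Fixpoint resid (j : nat) : 'M[R]_p :=
  if j is i.+1 then
    let q := resid i *m x i in
    resid i - (dot (x i) q)^-1 *: (q *m q^T)
  else 1%:M.

Definition resid_row (j : nat) : 'cV[R]_p := resid j *m x j.
Definition dist2 (j : nat) : R := dot (x j) (resid_row j).

Fixpoint gram_inv (j : nat) : 'M[R]_p :=
  if j is i.+1 then
    let A := 1%:M - (dist2 i)^-1 *: (resid_row i *m (x i)^T) in
    A *m gram_inv i *m A^T +
      (dist2 i ^+ 2)^-1 *: (resid_row i *m (resid_row i)^T)
  else 0.

Fixpoint gram (j : nat) : 'M[R]_p :=
  if j is i.+1 then gram i + x i *m (x i)^T else 0.

Lemma residS j : resid j.+1 =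
  resid j - (dist2 j)^-1 *: (resid_row j *m (resid_row j)^T).
Proof. by []. Qed.

Lemma resid_sym j : (resid j)^T = resid j.
Proof.
elim: j => [|j ih]; first by rewrite trmx1.
by rewrite residS linearB linearZ /= trmx_mul trmxK ih.
Qed.

Lemma resid_idem j : resid j *m resid j = resid j /\
  dist2 j = sq_norm (resid_row j).
Proof.
have dE i : resid i *m resid i = resid i -> dist2 i = sq_norm (resid_row i).
  move=> id; rewrite -dotxx /dist2 /dot /resid_row trmx_mul resid_sym.
  by rewrite -[in RHS]mulmxA [resid i *m (resid i *m _)]mulmxA id.
elim: j => [|j [id dj]]; first by rewrite mulmx1; split => //; apply: dE; rewrite mulmx1.
suff h : resid j.+1 *m resid j.+1 = resid j.+1 by split=> //; exact: dE.
(* A row in the span of the preceding ones leaves the projection unchanged. *)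
have [d0|d0] := eqVneq (dist2 j) 0.
  by rewrite residS d0 invr0 scale0r subr0.
have Qq : resid j *m resid_row j = resid_row j by rewrite mulmxA id.
have qQ : (resid_row j)^T *m resid j = (resid_row j)^T.
  by rewrite -{1}resid_sym -trmx_mul Qq.
have qq : (resid_row j)^T *m resid_row j = (dist2 j)%:M.
  by rewrite dotE dotxx -dj.
have Q'q : resid j.+1 *m resid_row j = 0.
  rewrite residS mulmxBl Qq -scalemxAl -mulmxA qq mul_mx_scalar scalerA.
  by rewrite mulVf// scale1r subrr.
rewrite {2}residS mulmxBr -scalemxAr mulmxA Q'q mul0mx scaler0 subr0.
by rewrite residS mulmxBl id -scalemxAl -mulmxA qQ.
Qed.

Lemma resid_proj j : resid j *m resid j = resid j.
Proof. exact: (resid_idem j).1. Qed.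

Lemma dist2E j : dist2 j = sq_norm (resid_row j).
Proof. exact: (resid_idem j).2. Qed.

Lemma dist2_quad j : dist2 j = quad_form (resid j) (x j).
Proof. by rewrite quad_form_dot. Qed.

Lemma resid_resid_row j : resid j *m resid_row j = resid_row j.
Proof. by rewrite mulmxA resid_proj. Qed.

(** By idempotence the sum of squares of a row is the diagonal entry, and a real
    number at least equal to its square is at most 1. *)
Lemma sum_resid_row_sq j k : \sum_l resid j k l ^+ 2 <= 1.
Proof.
have E : \sum_l resid j k l ^+ 2 = resid j k k.
  rewrite -[in RHS](resid_proj j) [in RHS]mxE; apply: eq_bigr => l _.
  by have /matrixP/(_ k l) := resid_sym j; rewrite mxE expr2 => ->.
have : resid j k k ^+ 2 <= resid j k k.
  by rewrite -{2}E (bigD1 k)//= lerDl sumr_ge0// => l _; exact: sqr_ge0.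
rewrite E; nra.
Qed.

Lemma mxtrace_residS j : dist2 j != 0 -> \tr (resid j.+1) = \tr (resid j) - 1.
Proof.
move=> d0; rewrite residS raddfB /= mxtraceZ trace_outer dotxx -dist2E.
by rewrite mulVf.
Qed.

Lemma gram_sym j : (gram j)^T = gram j.
Proof.
elim: j => [|j ih]; first by rewrite trmx0.
by rewrite /= linearD /= trmx_mul trmxK ih.
Qed.

Lemma gram_inv_sym j : (gram_inv j)^T = gram_inv j.
Proof.
elim: j => [|j ih]; first by rewrite trmx0.
rewrite [gram_inv _]/=; set A := 1%:M - _.
by rewrite linearD linearZ /= !trmx_mul !trmxK ih mulmxA.
Qed.

Lemma gram_inv_psd j (u : 'cV[R]_p) : 0 <= quad_form (gram_inv j) u.
Proof.
elim: j u => [|j ih] u; first by rewrite /quad_form mulmx0 mul0mx mxE.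
rewrite [gram_inv _]/= quad_formDl quad_formZl quad_form_outer addr_ge0//.
  set A := 1%:M - _; have := ih (A^T *m u).
  by rewrite /quad_form trmx_mul trmxK !mulmxA.
by rewrite mulr_ge0 ?sqr_ge0// invr_ge0 sqr_ge0.
Qed.

(** The residual of a new row is orthogonal to all earlier rows, so each update
    preserves what was known of them; the hypothesis makes the divisions by
    [dist2] exact. *)
Lemma recursion_invariants j : (forall i, (i < j)%N -> dist2 i != 0) ->
  [/\ resid j *m gram j = 0, resid j *m gram_inv j = 0 &
      gram j *m gram_inv j = 1%:M - resid j].
Proof.
elim: j => [_|j ih dj]; first by rewrite !mulmx0 subrr.
have [|QS QB SB] := ih; first by move=> i ij; apply: dj; exact: ltnW.
have d0 : dist2 j != 0 by exact: dj.
set q := resid_row j; set Q := resid j in QS QB SB *.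
have Qq : Q *m q = q by exact: resid_resid_row.
have xq : (x j)^T *m q = (dist2 j)%:M by exact: dotE.
have qx : q^T *m x j = (dist2 j)%:M by rewrite dotE dotC.
have qq : q^T *m q = (dist2 j)%:M by rewrite dotE dotxx -dist2E.
have qS : q^T *m gram j = 0 by rewrite trmx_mul resid_sym -mulmxA QS mulmx0.
have qB : q^T *m gram_inv j = 0 by rewrite trmx_mul resid_sym -mulmxA QB mulmx0.
have SQ : gram j *m Q = 0.
  by rewrite -[LHS]trmxK trmx_mul resid_sym gram_sym QS trmx0.
have Sq : gram j *m q = 0 by rewrite /q mulmxA SQ mul0mx.
have Q'q : resid j.+1 *m q = 0.
  rewrite residS mulmxBl Qq -scalemxAl -mulmxA qq mul_mx_scalar scalerA.
  by rewrite mulVf// scale1r subrr.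
have Q'x : resid j.+1 *m x j = 0.
  rewrite residS mulmxBl -/q -scalemxAl -mulmxA qx mul_mx_scalar scalerA.
  by rewrite mulVf// scale1r subrr.
set A := 1%:M - (dist2 j)^-1 *: (q *m (x j)^T).
have BE : gram_inv j.+1 = A *m gram_inv j *m A^T + (dist2 j ^+ 2)^-1 *: (q *m q^T) by [].
have Q'A : resid j.+1 *m A = resid j.+1.
  by rewrite /A mulmxBr mulmx1 -scalemxAr mulmxA Q'q mul0mx scaler0 subr0.
have SA : gram j *m A = gram j.
  by rewrite /A mulmxBr mulmx1 -scalemxAr mulmxA Sq mul0mx scaler0 subr0.
have xA : (x j)^T *m A = 0.
  rewrite /A mulmxBr mulmx1 -scalemxAr mulmxA xq mul_scalar_mx scalerA.
  by rewrite mulVf// scale1r subrr.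
have Q'S : resid j.+1 *m gram j = 0.
  by rewrite residS mulmxBl QS -scalemxAl -mulmxA qS mulmx0 scaler0 subr0.
have Q'B : resid j.+1 *m gram_inv j = 0.
  by rewrite residS mulmxBl QB -scalemxAl -mulmxA qB mulmx0 scaler0 subr0.
split.
- by rewrite /= mulmxDr -/resid Q'S mulmxA Q'x mul0mx addr0.
- rewrite BE mulmxDr !mulmxA Q'A Q'B mul0mx -scalemxAr mulmxA Q'q mul0mx.
  by rewrite scaler0 addr0.
have xB' : (x j)^T *m gram_inv j.+1 = (dist2 j)^-1 *: q^T.
  rewrite BE mulmxDr !mulmxA xA !mul0mx add0r -scalemxAr mulmxA xq.
  rewrite mul_scalar_mx scalerA; congr (_ *: _).
  by rewrite expr2 invfM -mulrA mulVf// mulr1.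
have SB' : gram j *m gram_inv j.+1 = (1%:M - Q) *m A^T.
  rewrite BE mulmxDr !mulmxA SA SB -scalemxAr mulmxA Sq mul0mx scaler0 addr0.
  by [].
rewrite [gram j.+1]/= mulmxDl SB' -mulmxA xB' -scalemxAr.
have -> : A^T = 1%:M - (dist2 j)^-1 *: (x j *m q^T).
  by rewrite /A linearB linearZ /= trmx1 trmx_mul trmxK.
rewrite mulmxBr mulmx1 -scalemxAr mulmxBl mul1mx !mulmxA -/q residS -/q -/Q.
rewrite scalerBr !opprB -[LHS]addrA subrK -addrA.
by congr (_ + _); rewrite addrC.
Qed.

End RowRecursion.

(** * The three multiplicative recursions *)

Section Directions.
Context (R : realType) (p : nat).
Implicit Types (u v : 'cV[R]_p) (A B : 'M[R]_p).

Definition rank1 u : 'M[R]_p := (sq_norm u)^-1 *: (u *m u^T).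

Lemma dotDl u v w : dot (u + v) w = dot u w + dot v w.
Proof. by rewrite /dot [(_ + _)^T]linearD mulmxDl mxE. Qed.

Lemma dotZl (c : R) u v : dot (c *: u) v = c * dot u v.
Proof. by rewrite /dot linearZ /= -scalemxAl mxE. Qed.

Lemma sq_normBZ (a : R) u v :
  sq_norm (u - a *: v) = sq_norm u - 2 * a * dot u v + a ^+ 2 * sq_norm v.
Proof.
rewrite -!dotxx -scaleNr dotDl dotZl !(dotC _ (_ + _)) !dotDl !dotZl (dotC v u).
ring.
Qed.

Lemma outer_mul u v w : u *m v^T *m w = dot v w *: u.
Proof. by rewrite -mulmxA dotE mul_mx_scalar. Qed.

(** The left-hand side is the update rule of [gram_inv], with [c] the inverse
    squared distance of the new row [y] and [q] its residual. *)
Lemma rank1_update_mul B (q y v : 'cV[R]_p) (c e : R) : dot q v = 0 ->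
  ((1%:M - c *: (q *m y^T)) *m B *m (1%:M - c *: (q *m y^T))^T +
     e *: (q *m q^T)) *m v = B *m v - (c * dot y (B *m v)) *: q.
Proof.
move=> qv.
have -> : (1%:M - c *: (q *m y^T))^T = 1%:M - c *: (y *m q^T).
  by rewrite [LHS]linearB linearZ /= trmx1 trmx_mul trmxK.
rewrite mulmxDl -scalemxAl outer_mul qv scale0r scaler0 addr0.
rewrite -mulmxA [(_ - c *: (y *m _)) *m v]mulmxBl mul1mx -scalemxAl outer_mul qv.
rewrite scale0r scaler0 subr0.
by rewrite -mulmxA mulmxBl mul1mx -scalemxAl outer_mul scalerA.
Qed.

Lemma trace_outer_conj u v A :
  \tr (u *m v^T *m A *m (v *m u^T)) = quad_form A v * dot u u.
Proof.
rewrite mulmxA mxtrace_mulC !mulmxA dotE -!mulmxA mul_scalar_mx mxtraceZ mulrC.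
by rewrite mulmxA [_ *m v]mx11_scalar mxtrace_scalar.
Qed.

Lemma mxtrace_rank1 u : u != 0 -> \tr (rank1 u) = 1.
Proof.
move=> u0; rewrite mxtraceZ trace_outer dotxx mulVf//.
by rewrite sq_norm_eq0.
Qed.

Lemma rank1_0 : rank1 0 = 0.
Proof. by rewrite /rank1 mul0mx scaler0. Qed.

Lemma quad_form_rank1 u v : quad_form (rank1 u) v = dot u v ^+ 2 / sq_norm u.
Proof. by rewrite quad_formZl quad_form_outer mulrC. Qed.

Lemma frob2Z (a : R) A : frob2 (a *: A) = a ^+ 2 * frob2 A.
Proof.
rewrite /frob2 mulr_sumr; apply: eq_bigr => i _; rewrite mulr_sumr.
by apply: eq_bigr => j _; rewrite mxE exprMn.
Qed.

Lemma frob2_outer u : frob2 (u *m u^T) = sq_norm u ^+ 2.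
Proof.
rewrite /frob2 /sq_norm expr2 mulr_suml; apply: eq_bigr => i _.
rewrite mulr_sumr; apply: eq_bigr => j _.
by rewrite mxE big_ord1 !mxE exprMn.
Qed.

Lemma frob2_rank1_le1 u : frob2 (rank1 u) <= 1.
Proof.
have [->|u0] := eqVneq u 0.
  rewrite rank1_0 /frob2 big1// => i _; rewrite big1// => j _.
  by rewrite mxE expr0n.
by rewrite frob2Z frob2_outer exprVn mulVf// expf_neq0// sq_norm_eq0.
Qed.

Lemma one_qdev_rank1_ge0 u v : 0 <= 1 + qdev (rank1 u) v.
Proof.
have [->|u0] := eqVneq u 0.
  by rewrite rank1_0 /qdev /quad_form mulmx0 mul0mx mxE mxtrace0 subr0 addr0.
rewrite /qdev mxtrace_rank1// addrCA subrr addr0 quad_form_rank1.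
by rewrite divr_ge0 ?sqr_ge0// sq_norm_ge0.
Qed.

Lemma qdev_rank1 u v : sq_norm u * (1 + qdev (rank1 u) v) = dot u v ^+ 2.
Proof.
have [->|u0] := eqVneq u 0.
  have -> : sq_norm (0 : 'cV[R]_p) = 0 by apply/eqP; rewrite sq_norm_eq0.
  by rewrite mul0r /dot trmx0 mul0mx mxE expr0n.
rewrite /qdev mxtrace_rank1// addrCA subrr addr0 quad_form_rank1.
by rewrite mulrC divfK// sq_norm_eq0.
Qed.

Lemma quad_form_delta B (k l : 'I_p) (a b : R) : B^T = B ->
  quad_form B (a *: delta_mx k (ord0 : 'I_1) + b *: delta_mx l ord0) =
  a ^+ 2 * B k k + 2 * (a * b) * B k l + b ^+ 2 * B l l.
Proof.
move=> sB; have sBE i j : B i j = B j i by rewrite -[in LHS]sB mxE.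
have E i j : ((delta_mx i (ord0 : 'I_1))^T *m B *m delta_mx j (ord0 : 'I_1)) ord0 ord0 = B i j.
  transitivity ((row i B *m delta_mx j (ord0 : 'I_1)) ord0 ord0).
    by rewrite rowE trmx_delta.
  by rewrite -colE !mxE.
have F i j : dot (delta_mx i ord0) (B *m delta_mx j ord0) = B i j.
  by rewrite -[RHS]E /dot mulmxA.
rewrite quad_form_dot mulmxDr -!scalemxAr dotDl !dotZl !(dotC _ (_ + _)) !dotDl !dotZl.
rewrite !(dotC (B *m _)) !F (sBE l k); ring.
Qed.

(** The quadratic form is nonnegative on the plane of two basis vectors, so its
    discriminant there is nonpositive. *)
Lemma psd_entry_sq B (k l : 'I_p) : B^T = B -> (forall u, 0 <= quad_form B u) ->
  B k l ^+ 2 <= B k k * B l l.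
Proof.
move=> sB pB; have q a b := pB (a *: delta_mx k ord0 + b *: delta_mx l ord0).
have {}q a b : 0 <= a ^+ 2 * B k k + 2 * (a * b) * B k l + b ^+ 2 * B l l.
  by rewrite -quad_form_delta.
have kk0 : 0 <= B k k by have := q 1 0; lra.
have [k0|k0] := eqVneq (B k k) 0.
  have h (t : R) : 0 <= B l l + 2 * t * B k l by have := q t 1; rewrite k0; lra.
  have [->|kl] := eqVneq (B k l) 0; first by rewrite expr0n k0 mul0r.
  have := h (- (B l l + 1) / (2 * B k l)).
  rewrite (_ : 2 * _ * _ = - (B l l + 1)); first by lra.
  by field.
have := q (B k l) (- B k k); rewrite -(pmulr_rge0 _ (_ : 0 < B k k)); last first.
  by rewrite lt_def k0.
have kp : 0 < B k k by rewrite lt_def k0.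
move=> _; have := q (B k l) (- B k k).
rewrite (_ : _ + _ = B k k * (B k k * B l l - B k l ^+ 2)); last by ring.
by rewrite pmulr_rge0// subr_ge0.
Qed.

Lemma psd_trace_ge0 B : B^T = B -> (forall u, 0 <= quad_form B u) -> 0 <= \tr B.
Proof.
move=> sB pB; apply: sumr_ge0 => k _; have := pB (delta_mx k ord0).
have := quad_form_delta k k 1 0 sB; rewrite scale1r scale0r addr0 => ->; lra.
Qed.

Lemma frob2_psd B : B^T = B -> (forall u, 0 <= quad_form B u) ->
  frob2 B <= (\tr B) ^+ 2.
Proof.
move=> sB pB; rewrite /frob2 expr2 mulr_suml; apply: ler_sum => k _.
by rewrite mulr_sumr; apply: ler_sum => l _; exact: psd_entry_sq.
Qed.

End Directions.

Section Functionals.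
Context (R : realType) (p : nat) (x : nat -> 'cV[R]_p).
Local Notation resid := (resid x).
Local Notation gram_inv := (gram_inv x).
Local Notation gram := (gram x).
Local Notation dist2 := (dist2 x).
Local Notation resid_row := (resid_row x).

Lemma gram_mp j (c : R) : c != 0 -> (forall i, (i < j)%N -> dist2 i != 0) ->
  is_mp_inverse (c *: gram j) (c^-1 *: gram_inv j).
Proof.
move=> c0 /recursion_invariants[QS QB SB].
have BS : gram_inv j *m gram j = 1%:M - resid j.
  by rewrite -[LHS]trmxK trmx_mul gram_inv_sym gram_sym SB linearB /= trmx1 resid_sym.
have SBc : (c *: gram j) *m (c^-1 *: gram_inv j) = 1%:M - resid j.
  by rewrite -scalemxAl -scalemxAr scalerA mulfV// scale1r.
have BSc : (c^-1 *: gram_inv j) *m (c *: gram j) = 1%:M - resid j.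
  by rewrite -scalemxAl -scalemxAr scalerA mulVf// scale1r.
split; rewrite ?SBc ?BSc.
- by rewrite mulmxBl mul1mx -scalemxAr QS scaler0 subr0.
- by rewrite mulmxBl mul1mx -scalemxAr QB scaler0 subr0.
- by rewrite linearB /= trmx1 resid_sym.
- by rewrite linearB /= trmx1 resid_sym.
Qed.

(** A new row [x j] at squared distance [d] from the span adds
    [(1 + x^T B x) / d] to the trace of [B = gram_inv j]. Taking [1 + \tr B]
    instead of the trace makes the update multiplicative: the factor is
    [1 + (1 + D) / d], with [D] the centred quadratic form for [trace_dir j]. *)
Definition trace_dir j : 'M[R]_p := (1 + \tr (gram_inv j))^-1 *: gram_inv j.

Lemma trace_gram_inv_ge0 j : 0 <= \tr (gram_inv j).
Proof. by apply: psd_trace_ge0; [exact: gram_inv_sym|exact: gram_inv_psd]. Qed.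

Lemma one_trace_gt0 j : 0 < 1 + \tr (gram_inv j).
Proof. by rewrite ltr_pwDl// trace_gram_inv_ge0. Qed.

Lemma frob2_trace_dir_le1 j : frob2 (trace_dir j) <= 1.
Proof.
rewrite frob2Z exprVn mulrC ler_pdivrMr ?exprn_gt0 ?one_trace_gt0// mul1r.
apply: (le_trans (frob2_psd (gram_inv_sym _ _) (gram_inv_psd _ _))).
have t0 := trace_gram_inv_ge0 j.
by rewrite lerXn2r ?nnegrE// ?lerDr// addr_ge0.
Qed.

Lemma one_qdev_trace_dir j v : 1 + qdev (trace_dir j) v =
  (1 + quad_form (gram_inv j) v) / (1 + \tr (gram_inv j)).
Proof.
rewrite /qdev mxtraceZ quad_formZl; field.
by rewrite gt_eqF// one_trace_gt0.
Qed.

Lemma one_qdev_trace_dir_ge0 j v : 0 <= 1 + qdev (trace_dir j) v.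
Proof.
rewrite one_qdev_trace_dir divr_ge0 ?(ltW (one_trace_gt0 _))//.
by rewrite addr_ge0// gram_inv_psd.
Qed.

Lemma one_trace_step j : (forall i, (i < j.+1)%N -> dist2 i != 0) ->
  1 + \tr (gram_inv j.+1) =
  (1 + \tr (gram_inv j)) * (1 + (1 + qdev (trace_dir j) (x j)) / dist2 j).
Proof.
move=> dj; have d0 := dj j (ltnSn j).
have [|QS QB SB] := @recursion_invariants _ _ x j.
  by move=> i ij; apply: dj; exact: ltnW.
have t0 := one_trace_gt0 j.
rewrite one_qdev_trace_dir.
set q := resid_row j; set B := gram_inv j.
have sB : B^T = B by exact: gram_inv_sym.
have BQ : B *m resid j = 0 by rewrite -[LHS]trmxK trmx_mul resid_sym sB QB trmx0.
have Bq : B *m q = 0 by rewrite mulmxA BQ mul0mx.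
have tr1 : \tr (gram_inv j.+1) = \tr B + (quad_form B (x j) + 1) / dist2 j.
  rewrite [gram_inv _]/= -/q -/B mxtraceD mxtraceZ trace_outer dotxx -dist2E.
  have AT : (1%:M - (dist2 j)^-1 *: (q *m (x j)^T))^T =
      1%:M - (dist2 j)^-1 *: (x j *m q^T).
    by rewrite linearB linearZ /= trmx1 trmx_mul trmxK.
  rewrite AT mulmxBl mul1mx mulmxBr mulmx1 mulmxBl -!scalemxAr -!scalemxAl.
  rewrite !raddfB /= !mxtraceZ.
  have t1 : \tr (q *m (x j)^T *m B) = 0.
    by rewrite -mulmxA mxtrace_mulC -mulmxA Bq mulmx0 mxtrace0.
  have t2 : \tr (B *m (x j *m q^T)) = 0.
    rewrite mxtrace_mulC -mulmxA -[q^T *m B]trmxK trmx_mul trmxK sB Bq trmx0.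
    by rewrite mulmx0 mxtrace0.
  have t3 : \tr (q *m (x j)^T *m B *m (x j *m q^T)) = quad_form B (x j) * dist2 j.
    by rewrite trace_outer_conj dotxx -dist2E.
  rewrite t1 t2 t3; by field.
rewrite tr1 -/B; field; rewrite d0 /=.
by rewrite gt_eqF.
Qed.

Lemma quad_resid_norm j b : quad_form (resid j) b = sq_norm (resid j *m b).
Proof.
by rewrite -trmx_mul_sq_norm trmx_mul resid_sym mulmxA -(mulmxA b^T) resid_proj.
Qed.

(** The new row removes from the residual of [b] its component along the residual
    of that row. *)
Lemma bias_step j b : sq_norm (resid j.+1 *m b) =
  sq_norm (resid j *m b) *
  (1 - (1 + qdev (rank1 (resid j *m b)) (x j)) / dist2 j).
Proof.
rewrite mulrBr mulr1 mulrA qdev_rank1 -!quad_resid_norm residS.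
rewrite quad_formDl -scaleNr quad_formZl quad_form_outer.
have -> : dot (resid_row j) b = dot (resid j *m b) (x j).
  by rewrite [RHS]dotC /dot trmx_mul resid_sym mulmxA.
by rewrite mulNr mulrC.
Qed.

(** The minimum-norm interpolant of the responses of the first [m] rows to [b] when
    the responses of the rows from [m] on to [j] are zero. *)
Definition transfer_fit m j (b : 'cV[R]_p) : 'cV[R]_p := gram_inv j *m (gram m *m b).

Lemma resid_gram_le m j : (forall i, (i < j)%N -> dist2 i != 0) -> (m <= j)%N ->
  resid j *m gram m = 0.
Proof.
elim: j => [|j ih] dj.
  by rewrite leqn0 => /eqP ->; rewrite mulmx0.
rewrite leq_eqVlt => /orP[/eqP ->|mj].
  by have [] := recursion_invariants dj.
have QS : resid j *m gram m = 0.
  by apply: ih => // i ij; apply: dj; exact: ltnW.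
rewrite residS mulmxBl QS -scalemxAl -mulmxA [_^T *m gram m](_ : _ = 0).
  by rewrite mulmx0 scaler0 subr0.
by rewrite trmx_mul resid_sym -mulmxA QS mulmx0.
Qed.

(** The first fit is the orthogonal projection of [b] onto the span of the rows. *)
Lemma transfer_fit_start m b : (forall i, (i < m)%N -> dist2 i != 0) ->
  sq_norm (transfer_fit m m b) = sq_norm b - sq_norm (resid m *m b).
Proof.
move=> dm; have [_ _ SB] := recursion_invariants dm.
rewrite /transfer_fit mulmxA.
have -> : gram_inv m *m gram m = 1%:M - resid m.
  by rewrite -[LHS]trmxK trmx_mul gram_inv_sym gram_sym SB linearB /= trmx1 resid_sym.
rewrite mulmxBl mul1mx -[X in _ - X]scale1r sq_normBZ -quad_form_dot.
by rewrite quad_resid_norm; ring.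
Qed.

(** To satisfy the new constraint the interpolant moves along the residual of the
    new row, which is orthogonal to it: the squared norms add up. *)
Lemma transfer_step m j b : (m <= j)%N -> (forall i, (i < j.+1)%N -> dist2 i != 0) ->
  sq_norm (transfer_fit m j.+1 b) = sq_norm (transfer_fit m j b) *
  (1 + (1 + qdev (rank1 (transfer_fit m j b)) (x j)) / dist2 j).
Proof.
move=> mj dj1; have d0 := dj1 j (ltnSn j).
have dj i : (i < j)%N -> dist2 i != 0 by move=> ij; apply: dj1; exact: ltnW.
have [QS QB SB] := recursion_invariants dj.
rewrite mulrDr mulr1 mulrA qdev_rank1.
set t := transfer_fit m j b; set q := resid_row j; set B := gram_inv j.
have sB : B^T = B by exact: gram_inv_sym.
have BQ : B *m resid j = 0 by rewrite -[LHS]trmxK trmx_mul resid_sym sB QB trmx0.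
have qS : q^T *m gram m = 0.
  by rewrite trmx_mul resid_sym -mulmxA (resid_gram_le dj mj) mulmx0.
have tq : dot t q = 0.
  rewrite /dot /t /transfer_fit -/B trmx_mul sB -mulmxA [B *m q]mulmxA BQ mul0mx.
  by rewrite mulmx0 mxE.
have -> : transfer_fit m j.+1 b = t - ((dist2 j)^-1 * dot t (x j)) *: q.
  rewrite /transfer_fit [gram_inv _]/= rank1_update_mul; first by rewrite (dotC (x j)).
  by rewrite /dot mulmxA qS mul0mx mxE.
by rewrite sq_normBZ tq -dist2E exprMn; field.
Qed.

End Functionals.

(** * Stability of multiplicative recursions *)

Section ProductStability.
Context (R : realType).

Lemma prod_recursion (s f : nat -> R) i0 i1 : (i0 <= i1)%N ->
  (forall j, (i0 <= j < i1)%N -> s j.+1 = s j * f j) ->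
  s i1 = s i0 * \prod_(i0 <= j < i1) f j.
Proof.
move=> i01; rewrite -(subnKC i01); elim: (i1 - i0)%N => [|k ih] h.
  by rewrite addn0 big_geq// mulr1.
rewrite addnS big_nat_recr ?leq_addr//= mulrA -ih; last first.
  by move=> j /andP[h1 h2]; apply: h; rewrite h1 addnS ltnW.
by rewrite h// leq_addr addnS ltnSn.
Qed.

Lemma expR_le_one_plus (y : R) : - 2^-1 <= y -> expR (y - 2 * y ^+ 2) <= 1 + y.
Proof.
move=> y2; have y1 : 0 < 1 + y by lra.
apply: (@le_trans _ _ (expR (y / (1 + y)))).
  rewrite ler_expR ler_pdivlMr//.
  have : 0 <= y ^+ 2 * (1 + 2 * y) by rewrite mulr_ge0 ?sqr_ge0//; lra.
  rewrite (_ : (y - _) * _ = y - y ^+ 2 * (1 + 2 * y)); [lra|ring].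
have := expR_ge1Dx (- (y / (1 + y))); rewrite expRN => h.
rewrite -lef_pV2 ?posrE ?expR_gt0//; apply: le_trans h.
by rewrite le_eqVlt; apply/orP; left; apply/eqP; field; rewrite gt_eqF.
Qed.

(** Since [y - 2 y^2 <= ln (1 + y) <= y] for [y >= - 1 / 2], what matters is the
    signed sum and the sum of squares of the perturbations, and not the sum of
    their absolute values. *)
Lemma prod_near1 (eta : nat -> R) i0 i1 (e e2 : R) : e <= 2^-1 ->
  (forall j, (i0 <= j < i1)%N -> - 2^-1 <= eta j) ->
  `|\sum_(i0 <= j < i1) eta j| <= e ->
  \sum_(i0 <= j < i1) eta j ^+ 2 <= e2 ->
  `|\prod_(i0 <= j < i1) (1 + eta j) - 1| <= 2 * e + 2 * e2.
Proof.
move=> eh etah; rewrite ler_norml => /andP[s1 s2] q2.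
have e0 : 0 <= e by lra.
have e20 : 0 <= e2 by apply: le_trans q2; rewrite sumr_ge0// => j _; exact: sqr_ge0.
have up : \prod_(i0 <= j < i1) (1 + eta j) <= expR (\sum_(i0 <= j < i1) eta j).
  rewrite expR_sum big_nat [leRHS]big_nat; apply: ler_prod => j /etah h.
  by rewrite expR_ge1Dx andbT; lra.
have lo : expR (\sum_(i0 <= j < i1) (eta j - 2 * eta j ^+ 2)) <=
    \prod_(i0 <= j < i1) (1 + eta j).
  rewrite expR_sum big_nat [leRHS]big_nat; apply: ler_prod => j /etah h.
  by rewrite expR_ge0 expR_le_one_plus.
have up2 : expR (\sum_(i0 <= j < i1) eta j) <= 1 + 2 * e.
  apply: (@le_trans _ _ (expR e)); first by rewrite ler_expR.
  have := expR_ge1Dx (- e); rewrite expRN => h.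
  have e1 : 0 < 1 - e by lra.
  rewrite -(invrK (expR e)); apply: (@le_trans _ _ (1 - e)^-1).
    by rewrite lef_pV2 ?posrE ?invr_gt0 ?expR_gt0.
  rewrite -[X in X <= _]mul1r ler_pdivrMr//; nra.
have lo2 : 1 - e - 2 * e2 <= expR (\sum_(i0 <= j < i1) (eta j - 2 * eta j ^+ 2)).
  apply: le_trans (expR_ge1Dx _); rewrite sumrB -mulr_sumr; lra.
by rewrite ler_norml; apply/andP; split; lra.
Qed.

(** The error [D j] is of the same order as the term 1 it perturbs, hence each
    factor has a relative error of order [1 / p] and the sum of absolute errors is
    not small. The signed sum is, by hypothesis, and so is the sum of squares.
    Replacing [d j] by [L j] costs a relative error [r] on increments whose total
    is bounded. The weights [(L j + eps)^-1] of the sum come from dividing the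
    perturbed factor by [1 + eps / L j]. *)
Lemma perturbed_product (p : nat) (kappa r eps : R) (i0 i1 : nat) (s D d : nat -> R) :
  let L j := p%:R - j%:R : R in
  let rho := \prod_(i0 <= j < i1) (1 + eps / L j) in
  0 < kappa <= 2^-1 -> eps = 1 \/ eps = -1 -> (i0 <= i1)%N ->
  kappa * p%:R <= L i1 -> r <= kappa ^+ 2 / 512%:R -> p%:R^-1 <= r -> 0 < p%:R :> R ->
  (forall j, (i0 <= j < i1)%N -> `|d j - L j| <= r * p%:R) ->
  `|\sum_(i0 <= j < i1) (L j + eps)^-1 * D j| <= r ->
  \sum_(i0 <= j < i1) D j ^+ 2 <= r * p%:R ^+ 2 ->
  (forall j, (i0 <= j < i1)%N -> 0 <= 1 + D j) ->
  0 <= s i0 ->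
  (forall j, (i0 <= j < i1)%N -> s j.+1 = s j * (1 + eps * (1 + D j) / d j)) ->
  `|s i1 - s i0 * rho| <= 150%:R / kappa ^+ 2 * r * (s i0 * rho).
Proof.
set P := p%:R : R => L rho0_ kappa01 eps1 i01 i1p r_small p_large p_gt0 hd hsum hsq D1 s0 hs.
have [k0 k1] := andP kappa01.
have r0 : 0 < r by apply: lt_le_trans p_large; rewrite invr_gt0.
have kk : 0 < kappa ^+ 2 by rewrite exprn_gt0.
have kk1 : kappa ^+ 2 <= kappa / 2 by rewrite expr2; nra.
have rk : r <= kappa / 1024%:R by lra.
have pr : 1 <= r * P by rewrite -ler_pdivrMr// mul1r.
have kP2 : 1024%:R <= kappa * P.
  have : 1024%:R * (r * P) <= kappa * P by rewrite mulrA ler_pM2r//; lra.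
  lra.
have Lk j : (i0 <= j < i1)%N -> kappa * P <= L j.
  move=> /andP[_ ji]; apply: (le_trans i1p); rewrite lerD2l lerN2 ler_nat.
  exact: ltnW.
have rP : r * P <= kappa * P / 1024%:R by rewrite [leRHS]mulrAC ler_pM2r//; lra.
have ebd : -1 <= eps <= 1 by clear -eps1; case: eps1 => ->; apply/andP; split; lra.
have Lp j : (i0 <= j < i1)%N -> 0 < L j.
  by move=> /Lk h; apply: lt_le_trans h; rewrite mulr_gt0.
have Le j : (i0 <= j < i1)%N -> kappa * P / 2 <= L j + eps.
  by move=> /Lk h; clear -h ebd kP2; case/andP: ebd; lra.
have Lep j : (i0 <= j < i1)%N -> 0 < L j + eps.
  by move=> /Le h; apply: lt_le_trans h; rewrite divr_gt0 ?mulr_gt0.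
have dk j : (i0 <= j < i1)%N -> kappa * P / 2 <= d j.
  by move=> h; have := hd _ h; rewrite ler_norml => /andP[]; have := Lk j h; clear -rP kP2; lra.
have dp j : (i0 <= j < i1)%N -> 0 < d j.
  by move=> /dk h; apply: lt_le_trans h; rewrite divr_gt0 ?mulr_gt0.
pose w j := (L j + eps)^-1.
pose t j := (L j - d j) / d j.
have w_pos j : (i0 <= j < i1)%N -> 0 <= w j <= 2 / (kappa * P).
  move=> h; rewrite invr_ge0 ltW ?Lep//= -[leRHS]invf_div lef_pV2 ?posrE ?Lep//.
    exact: Le.
  by rewrite divr_gt0 ?mulr_gt0.
have tb j : (i0 <= j < i1)%N -> `|t j| <= 2 * r / kappa.
  move=> h; rewrite normrM normfV (gtr0_norm (dp j h)) ler_pdivrMr ?dp//.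
  rewrite distrC (le_trans (hd _ h))//.
  apply: (@le_trans _ _ (2 * r / kappa * (kappa * P / 2))).
    by rewrite le_eqVlt; apply/orP; left; apply/eqP; field; rewrite gt_eqF.
  by apply: ler_wpM2l; [rewrite divr_ge0 ?mulr_ge0// ltW|exact: dk].
pose eta j := eps * (w j * (D j + (1 + D j) * t j)).
have etaE j : (i0 <= j < i1)%N ->
    1 + eps * (1 + D j) / d j = (1 + eps / L j) * (1 + eta j).
  move=> h; rewrite /eta /w /t; field.
  by rewrite !gt_eqF ?dp ?Lp ?Lep.
have sumw : \sum_(i0 <= j < i1) w j <= 2 / kappa.
  apply: (@le_trans _ _ (\sum_(i0 <= j < i1) 2 / (kappa * P))).
    by rewrite big_nat [leRHS]big_nat; apply: ler_sum => j /w_pos/andP[].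
  rewrite sumr_const_nat -[_ *+ (i1 - i0)]mulr_natr.
  have -> : 2 / (kappa * P) * (i1 - i0)%:R = 2 / kappa * ((i1 - i0)%:R / P).
    by field; rewrite !gt_eqF.
  apply: ler_piMr; first by rewrite divr_ge0 // ltW.
  rewrite ler_pdivrMr// mul1r natrB//.
  have : (0 : R) <= i0%:R by []; have : 0 <= L i1 by apply: le_trans i1p; rewrite ltW// mulr_gt0.
  rewrite /L -/P; clear; lra.
have sumg : \sum_(i0 <= j < i1) w j * (1 + D j) <= 3%:R / kappa.
  under eq_bigr do rewrite mulrDr mulr1.
  rewrite big_split /=; have : \sum_(i0 <= j < i1) w j * D j <= r.
    by apply: le_trans hsum; exact: ler_norm.
  have : r <= kappa^-1.
    apply: (@le_trans _ _ 1); first by clear -rk k1; lra.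
    by rewrite -[leLHS]invr1 lef_pV2 ?posrE//; clear -k1; lra.
  lra.
have eabs : `|eps| = 1 by case: eps1 => ->; rewrite ?normrN normr1.
have B1 : `|\sum_(i0 <= j < i1) eta j| <= 7%:R / kappa ^+ 2 * r.
  rewrite /eta -mulr_sumr normrM eabs mul1r.
  under eq_bigr do rewrite mulrDr.
  rewrite big_split /=; apply: (le_trans (ler_normD _ _)).
  apply: (@le_trans _ _ (r + 2 * r / kappa * (3%:R / kappa))).
    apply: lerD => //.
    apply: (@le_trans _ _ (\sum_(i0 <= j < i1) 2 * r / kappa * (w j * (1 + D j)))).
      rewrite (le_trans (ler_norm_sum _ _ _))// big_nat [leRHS]big_nat.
      apply: ler_sum => j h; have /andP[w0 _] := w_pos j h.
      rewrite mulrA normrM ger0_norm ?mulr_ge0 ?D1//.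
      by rewrite [leRHS]mulrC ler_wpM2l ?tb ?mulr_ge0 ?D1.
    rewrite -mulr_sumr ler_wpM2l// divr_ge0 ?mulr_ge0// ltW//.
  have -> : r + 2 * r / kappa * (3%:R / kappa) = (kappa ^+ 2 + 6%:R) / kappa ^+ 2 * r.
    by field; rewrite gt_eqF.
  by rewrite ler_pM2r// ler_pM2r ?invr_gt0//; clear -k0 k1; nra.
have B2 : \sum_(i0 <= j < i1) eta j ^+ 2 <= 64%:R / kappa ^+ 2 * r.
  have each j : (i0 <= j < i1)%N ->
      eta j ^+ 2 <= 4%:R / (kappa * P) ^+ 2 * (8%:R * D j ^+ 2 + 8%:R * r ^+ 2 / kappa ^+ 2).
    move=> h; rewrite /eta !exprMn -(real_normK (num_real eps)) eabs expr1n mul1r.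
    have /andP[w0 w1] := w_pos j h; have := tb j h => tj.
    have t1 : `|t j| <= 1.
      apply: (le_trans tj); rewrite ler_pdivrMr//; clear -rk k0; lra.
    apply: ler_pM; rewrite ?sqr_ge0//.
      rewrite (_ : 4%:R / _ = (2 / (kappa * P)) ^+ 2); last by rewrite expr_div_n; congr (_ / _); ring.
      by apply: lerXn2r; rewrite ?nnegrE//; exact: le_trans w1.
    have t2 : t j ^+ 2 <= 4%:R * r ^+ 2 / kappa ^+ 2.
      rewrite -(real_normK (num_real (t j))) (_ : _ / _ = (2 * r / kappa) ^+ 2); last first.
        by rewrite expr_div_n exprMn; congr (_ * _ / _); ring.
      by apply: lerXn2r; rewrite ?nnegrE// divr_ge0 ?mulr_ge0 ?ltW.
    have t3 : (1 + t j) ^+ 2 <= 4%:R.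
      move: t1; rewrite ler_norml => /andP[u1 u2]; clear -u1 u2; nra.
    have t4 : (D j * (1 + t j)) ^+ 2 <= 4%:R * D j ^+ 2.
      by rewrite exprMn mulrC; apply: ler_wpM2r => //; exact: sqr_ge0.
    rewrite (_ : D j + (1 + D j) * t j = D j * (1 + t j) + t j); last by ring.
    have := sqr_ge0 (D j * (1 + t j) - t j).
    clear -t2 t4; lra.
  apply: (@le_trans _ _ (\sum_(i0 <= j < i1) 4%:R / (kappa * P) ^+ 2 *
      (8%:R * D j ^+ 2 + 8%:R * r ^+ 2 / kappa ^+ 2))).
    by rewrite big_nat [leRHS]big_nat; apply: ler_sum => j; exact: each.
  rewrite -mulr_sumr big_split /= -mulr_sumr sumr_const_nat -[_ *+ (i1 - i0)]mulr_natl.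
  have c1 : (i1 - i0)%:R * (8%:R * r ^+ 2 / kappa ^+ 2) <= 8%:R * r * P ^+ 2.
    have iP : (i1 - i0)%:R <= P.
      rewrite natrB//; have : (0 : R) <= i0%:R by [].
      have : 0 <= L i1 by apply: le_trans i1p; rewrite ltW// mulr_gt0.
      rewrite /L -/P; clear; lra.
    have rr : 8%:R * r ^+ 2 / kappa ^+ 2 <= r.
      rewrite ler_pdivrMr// expr2; clear -r0 r_small kk; nra.
    apply: (@le_trans _ _ (P * r)).
      apply: ler_pM => //; apply: divr_ge0; last exact: ltW.
      by rewrite mulr_ge0// sqr_ge0.
    rewrite expr2; have : 0 <= r * P by rewrite mulr_ge0// ltW.
    have P1 : 1 <= P by clear -pr rk k1 p_gt0; nra.
    clear -P1; nra.
  rewrite exprMn; apply: (@le_trans _ _ (4%:R / (kappa ^+ 2 * P ^+ 2) * (16%:R * r * P ^+ 2))).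
    apply: ler_wpM2l; last by clear -c1 hsq; lra.
    by rewrite divr_ge0// mulr_ge0 ?sqr_ge0.
  by rewrite le_eqVlt; apply/orP; left; apply/eqP; field; rewrite !gt_eqF.
have eb1 : 7%:R / kappa ^+ 2 * r <= 2^-1.
  rewrite mulrAC ler_pdivrMr//; clear -r_small kk; lra.
have eb2 : 64%:R / kappa ^+ 2 * r <= 4%:R^-1.
  rewrite mulrAC ler_pdivrMr//; clear -r_small kk; lra.
(* This is what the constant 512 is for: 64 / 512 is less than the square of 1/2. *)
have eta_ge j : (i0 <= j < i1)%N -> - 2^-1 <= eta j.
  move=> h; have : eta j ^+ 2 <= 4%:R^-1.
    apply: le_trans eb2; apply: le_trans B2.
    rewrite (big_cat_nat (n := j)) ?(andP h).1//=; last by rewrite ltnW// (andP h).2.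
    rewrite [X in _ <= _ + X]big_ltn ?(andP h).2// addrCA lerDl addr_ge0//;
      by apply: sumr_ge0 => i _; exact: sqr_ge0.
  by move=> h2; rewrite leNgt; apply/negP => h3; clear -h2 h3; nra.
have main := prod_near1 eb1 eta_ge B1 B2.
have rho0 : 0 <= \prod_(i0 <= j < i1) (1 + eps / L j).
  rewrite big_nat; apply: prodr_ge0 => j h.
  rewrite (_ : 1 + _ = (L j + eps) / L j); last by field; rewrite gt_eqF ?Lp.
  by rewrite divr_ge0// ltW ?Lp ?Lep.
have -> : s i1 = s i0 * \prod_(i0 <= j < i1) (1 + eps / L j) *
    \prod_(i0 <= j < i1) (1 + eta j).
  rewrite (prod_recursion i01 hs) -mulrA -big_split /=; congr (_ * _).
  by rewrite big_nat [RHS]big_nat; apply: eq_bigr => j; exact: etaE.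
set rho := \prod_(_ <= _ < _) (1 + eps / _) in rho0 *.
rewrite -[X in _ - X]mulr1 -mulrBr normrM ger0_norm ?mulr_ge0// mulrC.
apply: ler_wpM2r; first exact: mulr_ge0.
have q0 : 0 <= r / kappa ^+ 2 by rewrite divr_ge0 ?ltW.
by clear -main q0; apply: (le_trans main); lra.
Qed.

Lemma prod_shrink (p i0 i1 : nat) : (i0 <= i1)%N -> (i1 < p)%N ->
  \prod_(i0 <= j < i1) (1 + -1 / (p%:R - j%:R)) = (p%:R - i1%:R) / (p%:R - i0%:R) :> R.
Proof.
move=> i01 i1p; have pos j : (j < p)%N -> p%:R - j%:R != 0 :> R.
  by move=> jp; rewrite subr_eq0 eqr_nat gtn_eqF.
have := @prod_recursion (fun j => p%:R - j%:R) (fun j => 1 + -1 / (p%:R - j%:R)) _ _ i01.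
move=> ->; first by rewrite mulrAC mulfV ?mul1r// pos// (leq_ltn_trans i01).
move=> j /andP[_ ji]; rewrite -natr1; field; rewrite pos//.
exact: ltn_trans i1p.
Qed.

Lemma prod_grow (p i0 i1 : nat) : (i0 <= i1)%N -> (i1 <= p)%N ->
  \prod_(i0 <= j < i1) (1 + 1 / (p%:R - j%:R)) =
  (p%:R - i0%:R + 1) / (p%:R - i1%:R + 1) :> R.
Proof.
move=> i01 i1p; have pos j : (j <= p)%N -> 0 < p%:R - j%:R + 1 :> R.
  by move=> jp; rewrite ltr_wpDl// subr_ge0 ler_nat.
have := @prod_recursion (fun j => (p%:R - j%:R + 1)^-1) (fun j => 1 + 1 / (p%:R - j%:R)) _ _ i01.
move=> ->; first by rewrite mulrA mulfV ?mul1r// gt_eqF// pos// (leq_trans i01).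
move=> j /andP[_ ji]; have jp := leq_trans ji i1p.
have p1 : p%:R - j%:R != 0 :> R by rewrite subr_eq0 eqr_nat gtn_eqF.
have := pos _ (ltnW jp); have := pos _ jp; rewrite -natr1 => h1 h2.
field; rewrite p1 /= gt_eqF//= ; lra.
Qed.

End ProductStability.

(** * Martingale bounds along the rows *)

Section AdaptedMatrices.
Context (R : realType) (d : measure_display) (T : measurableType d)
  (P : probability T R) (I : finType) (X : I -> {RV P >-> R}) (J : {set I}).
Local Notation adapted_mx := (adapted_mx X J).

Lemma adapted_mx_cst m n (A : 'M[R]_(m, n)) : adapted_mx (fun=> A).
Proof. by move=> i j; exact: adapted_cst. Qed.

Lemma adapted_mxD m n (A B : T -> 'M[R]_(m, n)) :
  adapted_mx A -> adapted_mx B -> adapted_mx (fun w => A w + B w).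
Proof.
move=> aA aB i j; under [X in adapted _ _ X]eq_fun do rewrite mxE.
by apply: adaptedD.
Qed.

Lemma adapted_mxN m n (A : T -> 'M[R]_(m, n)) :
  adapted_mx A -> adapted_mx (fun w => - A w).
Proof.
move=> aA i j; under [X in adapted _ _ X]eq_fun do rewrite mxE.
by apply: adaptedN.
Qed.

Lemma adapted_mxZ m n (a : T -> R) (A : T -> 'M[R]_(m, n)) :
  adapted X J a -> adapted_mx A -> adapted_mx (fun w => a w *: A w).
Proof.
move=> aa aA i j; under [X in adapted _ _ X]eq_fun do rewrite mxE.
by apply: adaptedM.
Qed.

Lemma adapted_mxT m n (A : T -> 'M[R]_(m, n)) :
  adapted_mx A -> adapted_mx (fun w => (A w)^T).
Proof.
move=> aA i j; under [X in adapted _ _ X]eq_fun do rewrite mxE.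
exact: aA.
Qed.

Lemma adapted_mulmx m n q (A : T -> 'M[R]_(m, n)) (B : T -> 'M[R]_(n, q)) :
  adapted_mx A -> adapted_mx B -> adapted_mx (fun w => A w *m B w).
Proof.
move=> aA aB i j; under [X in adapted _ _ X]eq_fun do rewrite mxE.
by apply: adapted_sum => k _; apply: adaptedM.
Qed.

Lemma adapted_mxtrace n (A : T -> 'M[R]_n) :
  adapted_mx A -> adapted X J (fun w => \tr (A w)).
Proof. by move=> aA; apply: adapted_sum => k _; exact: aA. Qed.

Lemma adapted_dot n (u v : T -> 'cV[R]_n) :
  adapted_mx u -> adapted_mx v -> adapted X J (fun w => dot (u w) (v w)).
Proof. by move=> au av; apply: adapted_mulmx => //; exact: adapted_mxT. Qed.

Lemma adapted_sq_norm n (u : T -> 'cV[R]_n) :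
  adapted_mx u -> adapted X J (fun w => sq_norm (u w)).
Proof. by move=> au; apply: adapted_sum => k _; apply: adaptedXn. Qed.

Lemma adapted_rank1 n (u : T -> 'cV[R]_n) :
  adapted_mx u -> adapted_mx (fun w => rank1 (u w)).
Proof.
move=> au; apply: adapted_mxZ; first by apply: adaptedV; exact: adapted_sq_norm.
by apply: adapted_mulmx => //; exact: adapted_mxT.
Qed.

Lemma adapted_qdev n (A : T -> 'M[R]_n) (u : T -> 'cV[R]_n) :
  adapted_mx A -> adapted_mx u -> adapted X J (fun w => qdev (A w) (u w)).
Proof.
move=> aA au; apply: adaptedB; last exact: adapted_mxtrace.
by apply: adapted_mulmx => //; apply: adapted_mulmx => //; exact: adapted_mxT.
Qed.

End AdaptedMatrices.

Section RowProcess.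
Context (R : realType) (d : measure_display) (T : measurableType d)
  (P : probability T R) (I : finType) (X : I -> {RV P >-> R}).
Hypothesis indep : mutually_independent X.
Variables (n p : nat) (idx : 'I_n -> 'I_p -> I).
Hypothesis idx_inj : forall r k r' k', idx r k = idx r' k' -> r = r' /\ k = k'.
Hypothesis gauss : forall r k (A : set R), measurable A ->
  distribution P (X (idx r k)) A = normal_prob 0 1 A.
Local Notation mean := (mean P).
Local Notation before := (before idx).

(** Extended by zero beyond [n], so that the deterministic recursions, which are
    indexed by [nat], apply to the sample. *)
Definition rows (w : T) (j : nat) : 'cV[R]_p :=
  if insub j is Some r then row_vec X idx r w else 0.

Lemma rowsE w (r : 'I_n) : rows w r = row_vec X idx r w.
Proof. by rewrite /rows valK. Qed.

Definition past_mx j m1 m2 (A : T -> 'M[R]_(m1, m2)) := adapted_mx X (before j 0) A.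

Lemma past_mxW i j m1 m2 (A : T -> 'M[R]_(m1, m2)) : (i <= j)%N ->
  past_mx i A -> past_mx j A.
Proof.
move=> ij aA k l; apply: adapted_sub (aA k l); apply: before_sub.
by move: ij; rewrite leq_eqVlt => /orP[/eqP ->|->//]; rewrite eqxx orbT.
Qed.

Lemma rows_past i j : (i < j)%N -> past_mx j (fun w => rows w i).
Proof.
move=> ij; have [ni|ni] := ltnP i n; last first.
  rewrite (_ : (fun w => _) = fun=> 0); first exact: adapted_mx_cst.
  by apply/funext => w; rewrite /rows insubN// -leqNgt.
rewrite (_ : (fun w => _) = fun w => row_vec X idx (Ordinal ni) w); last first.
  by apply/funext => w; rewrite -rowsE.
move=> k l; rewrite (_ : (fun w => _) = (fun w => X (idx (Ordinal ni) k) w)).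
  by apply: adaptedX; rewrite (mem_before idx_inj) ij.
by apply/funext => w; rewrite mxE.
Qed.

Lemma resid_past j : past_mx j (fun w => resid (rows w) j).
Proof.
elim: j => [|j ih]; first exact: adapted_mx_cst.
have ih' := past_mxW (leqnSn j) ih; have xj := rows_past (ltnSn j).
have q : past_mx j.+1 (fun w => resid (rows w) j *m rows w j) by exact: adapted_mulmx.
apply: adapted_mxD => //; apply: adapted_mxN; apply: adapted_mxZ.
  by apply: adaptedV; exact: adapted_dot.
by apply: adapted_mulmx => //; exact: adapted_mxT.
Qed.

Lemma gram_past j : past_mx j (fun w => gram (rows w) j).
Proof.
elim: j => [|j ih]; first exact: adapted_mx_cst.
have ih' := past_mxW (leqnSn j) ih; have xj := rows_past (ltnSn j).
by apply: adapted_mxD => //; apply: adapted_mulmx => //; exact: adapted_mxT.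
Qed.

Lemma gram_inv_past j : past_mx j (fun w => gram_inv (rows w) j).
Proof.
elim: j => [|j ih]; first exact: adapted_mx_cst.
have ih' := past_mxW (leqnSn j) ih; have xj := rows_past (ltnSn j).
have rj := past_mxW (leqnSn j) (@resid_past j).
have q : past_mx j.+1 (fun w => resid (rows w) j *m rows w j).
  exact: adapted_mulmx.
have dd : adapted X (before j.+1 0) (fun w => dist2 (rows w) j) by exact: adapted_dot.
have aA : past_mx j.+1 (fun w => 1%:M - (dist2 (rows w) j)^-1 *:
    (resid_row (rows w) j *m (rows w j)^T)).
  apply: adapted_mxD; first exact: adapted_mx_cst.
  apply: adapted_mxN; apply: adapted_mxZ; first exact: adaptedV.
  by apply: adapted_mulmx => //; exact: adapted_mxT.
apply: adapted_mxD.
  apply: adapted_mulmx; last exact: adapted_mxT.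
  exact: adapted_mulmx.
apply: adapted_mxZ; first by apply: adaptedV; exact: adaptedXn.
by apply: adapted_mulmx => //; exact: adapted_mxT.
Qed.

Lemma trace_dir_past j : past_mx j (fun w => trace_dir (rows w) j).
Proof.
apply: adapted_mxZ; last exact: gram_inv_past.
apply: adaptedV; apply: adaptedD; first exact: adapted_cst.
by apply: adapted_mxtrace; exact: gram_inv_past.
Qed.

Lemma bias_dir_past b j : past_mx j (fun w => rank1 (resid (rows w) j *m b)).
Proof.
apply: adapted_rank1; apply: adapted_mulmx; first exact: resid_past.
exact: adapted_mx_cst.
Qed.

Lemma transfer_dir_past m b j : (m <= j)%N ->
  past_mx j (fun w => rank1 (transfer_fit (rows w) m j b)).
Proof.
move=> mj; apply: adapted_rank1; apply: adapted_mulmx; first exact: gram_inv_past.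
apply: adapted_mulmx; last exact: adapted_mx_cst.
exact: past_mxW mj (@gram_past m).
Qed.

Section OneDirection.
Variables (H : nat -> T -> 'M[R]_p) (i0 i1 : nat).
Hypothesis pastH : forall j, (i0 <= j < i1)%N -> past_mx j (H j).
Hypothesis frobH : forall j w, frob2 (H j w) <= 1.
Hypothesis i1n : (i1 <= n)%N.

Definition deviation j w : R := qdev (H j w) (rows w j).

Lemma qdevZ a (A : 'M[R]_p) u : qdev (a *: A) u = a * qdev A u.
Proof. by rewrite /qdev quad_formZl mxtraceZ mulrBr. Qed.

Lemma deviation_past j : (i0 <= j < i1)%N -> adapted X (before j.+1 0) (deviation j).
Proof.
move=> h; apply: adapted_qdev; last exact: rows_past.
exact: past_mxW (leqnSn j) (pastH h).
Qed.

(** The deviations are martingale differences, so the second moment of their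
    weighted sum is at most the sum of the individual bounds. *)
Lemma mean_sq_deviations (c : nat -> R) :
  (mean (fun w => (\sum_(i0 <= j < i1) c j * deviation j w) ^+ 2)%R <=
   (quad_const R * \sum_(i0 <= j < i1) c j ^+ 2)%:E)%E.
Proof.
have [i01|/ltnW i10] := leqP i0 i1; last first.
  rewrite [X in (_ * X)%:E]big_geq// mulr0.
  rewrite (_ : (fun w => _) = fun=> 0) ?mean_cst//.
  by apply/funext => w; rewrite big_geq// expr0n.
have main k : (i0 + k <= i1)%N ->
    adapted X (before (i0 + k) 0) (fun w => \sum_(i0 <= j < i0 + k) c j * deviation j w) /\
    (mean (fun w => (\sum_(i0 <= j < i0 + k) c j * deviation j w) ^+ 2)%R <=
     (quad_const R * \sum_(i0 <= j < i0 + k) c j ^+ 2)%:E)%E.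
  elim: k => [_|k ih].
    rewrite addn0 (_ : (fun w => \sum_(i0 <= j < i0) _) = fun=> 0); last first.
      by apply/funext => w; rewrite big_geq.
    split; first exact: adapted_cst.
    rewrite (_ : (fun w => _) = fun=> 0) ?mean_cst ?big_geq// ?mulr0//.
    by apply/funext => w; rewrite big_geq// expr0n.
  rewrite addnS => ki; have [aM ihm] := ih (ltnW ki).
  have kin : (i0 <= i0 + k < i1)%N by rewrite leq_addr.
  have kn : (i0 + k < n)%N by exact: leq_trans i1n.
  have SE w : \sum_(i0 <= j < (i0 + k).+1) c j * deviation j w =
      \sum_(i0 <= j < i0 + k) c j * deviation j w + qdev (c (i0 + k)%N *: H (i0 + k)%N w)
        (row_vec X idx (Ordinal kn) w).
    by rewrite big_nat_recr ?leq_addr//= qdevZ -rowsE.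
  split.
    rewrite (_ : (fun w => _) = fun w => \sum_(i0 <= j < i0 + k) c j * deviation j w +
        c (i0 + k)%N * deviation (i0 + k) w).
      apply: adaptedD; last first.
        by apply: adaptedM; [exact: adapted_cst|exact: deviation_past].
      by apply: adapted_sub aM; apply: before_sub; rewrite ltnSn.
    by apply/funext => w; rewrite big_nat_recr ?leq_addr.
  rewrite (_ : (fun w => (\sum_(i0 <= j < (i0 + k).+1) _) ^+ 2) = fun w =>
    (\sum_(i0 <= j < i0 + k) c j * deviation j w + qdev (c (i0 + k)%N *: H (i0 + k)%N w)
        (row_vec X idx (Ordinal kn) w)) ^+ 2); last by apply/funext => w; rewrite SE.
  have aH : adapted_mx X (before (Ordinal kn) 0) (fun w => c (i0 + k)%N *: H (i0 + k)%N w).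
    by apply: adapted_mxZ; [exact: adapted_cst|exact: pastH].
  have step := @mean_sq_qdev _ _ _ _ _ _ indep _ _ _ idx_inj gauss (Ordinal kn)
    (fun w => \sum_(i0 <= j < i0 + k) c j * deviation j w)
    (fun w => c (i0 + k)%N *: H (i0 + k)%N w) aM aH.
  apply: (le_trans step).
  have mM := adapted_measurable aM.
  apply: (@le_trans _ _ (mean (fun w => (\sum_(i0 <= j < i0 + k) c j * deviation j w) ^+ 2 +
    quad_const R * c (i0 + k)%N ^+ 2)%R)).
    apply: le_mean.
    - apply: measurable_funD; first exact: measurable_funX.
      apply: measurable_funM => //; apply: measurable_sum => a; apply: measurable_sum => b.
      by apply: measurable_funX; exact: (adapted_measurable (aH a b)).
    - by apply: measurable_funD => //; exact: measurable_funX.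
    - move=> w; rewrite addr_ge0 ?sqr_ge0// mulr_ge0 ?(quad_const_ge0 R)//.
      by apply: sumr_ge0 => a _; apply: sumr_ge0 => b _; exact: sqr_ge0.
    - move=> w; rewrite lerD2l; apply: ler_wpM2l; first exact: quad_const_ge0.
      by rewrite frob2Z ler_piMr ?sqr_ge0.
  have q0 : 0 <= quad_const R * c (i0 + k)%N ^+ 2 by rewrite mulr_ge0 ?(quad_const_ge0 R) ?sqr_ge0.
  rewrite meanD//; last 2 first.
  - exact: measurable_funX.
  - by move=> w; exact: sqr_ge0.
  rewrite mean_cst big_nat_recr ?leq_addr//= mulrDr EFinD.
  exact: leeD.
by have [] := main (i1 - i0)%N; rewrite subnKC.
Qed.

(** The two quantities that [perturbed_product] asks to be small, in units of
    their allowed sizes. *)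
Definition process_excess (r eps : R) w : R :=
  (\sum_(i0 <= j < i1) (p%:R - j%:R + eps)^-1 * deviation j w) ^+ 2 / r ^+ 2 +
  (\sum_(i0 <= j < i1) deviation j w ^+ 2) / (r * p%:R ^+ 2).

Lemma deviation_measurable j : (i0 <= j < i1)%N -> measurable_fun setT (deviation j).
Proof. by move=> h; exact: (adapted_measurable (deviation_past h)). Qed.

Lemma sum_deviation_measurable (f : nat -> R -> R) :
  (forall j, measurable_fun setT (f j)) ->
  measurable_fun setT (fun w => \sum_(i0 <= j < i1) f j (deviation j w)).
Proof.
move=> mf; rewrite (_ : (fun w => _) = (fun w => \sum_(i0 <= j < i1 | (i0 <= j < i1)%N)
    f j (deviation j w))); last by apply/funext => w; rewrite big_nat.
apply: measurable_sum_cond => j h.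
exact: (measurableT_comp (mf j) (deviation_measurable h)).
Qed.

Lemma process_excess_measurable r eps : measurable_fun setT (process_excess r eps).
Proof.
apply: measurable_funD; apply: measurable_funM => //.
  apply: measurable_funX.
  by apply: (@sum_deviation_measurable (fun j v => (p%:R - j%:R + eps)^-1 * v)) => j;
    exact: measurable_funM.
by apply: (@sum_deviation_measurable (fun j v => v ^+ 2)) => j; exact: exprn_measurable.
Qed.

Lemma process_excess_ge0 r eps w : 0 <= r -> 0 <= process_excess r eps w.
Proof.
move=> r0; rewrite addr_ge0// divr_ge0 ?sqr_ge0//.
  by apply: sumr_ge0 => j _; exact: sqr_ge0.
by rewrite mulr_ge0// sqr_ge0.
Qed.

(** The weights are of order [1 / p], so the weighted sum has second moment of
    order [1 / p], that is [1 / (p * r ^+ 2)] in units of [r ^+ 2]; the sum of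
    squares is of order [p], that is [1 / (p * r)] in its unit. *)
Lemma mean_process_excess (kappa r eps : R) :
  0 < kappa <= 2^-1 -> 0 < r <= 1 -> (i0 <= i1)%N -> (0 < p)%N ->
  (forall j, (i0 <= j < i1)%N -> kappa * p%:R / 2 <= p%:R - j%:R + eps) ->
  (i1 <= p)%N ->
  (mean (process_excess r eps) <=
   (quad_const R * 5%:R / kappa ^+ 2 * (p%:R * r ^+ 4)^-1)%:E)%E.
Proof.
move=> /andP[k0 k1] /andP[r0 r1] i01 p0 hL i1p.
have P0 : (0 : R) < p%:R by rewrite ltr0n.
have q0 := quad_const_ge0 R.
have r20 : 0 < r ^+ 2 by rewrite exprn_gt0.
have rp0 : 0 < r * p%:R ^+ 2 by rewrite mulr_gt0 ?exprn_gt0.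
rewrite meanD; last 4 first.
- apply: measurable_funM => //; apply: measurable_funX.
  by apply: (@sum_deviation_measurable (fun j v => (p%:R - j%:R + eps)^-1 * v)) => j;
    exact: measurable_funM.
- apply: measurable_funM => //.
  by apply: (@sum_deviation_measurable (fun j v => v ^+ 2)) => j; exact: exprn_measurable.
- by move=> w; rewrite divr_ge0 ?sqr_ge0.
- move=> w; apply: divr_ge0; last exact: ltW.
  by apply: sumr_ge0 => j _; exact: sqr_ge0.
have mZ (c : R) (F : T -> R) : 0 < c -> measurable_fun setT F -> (forall w, 0 <= F w) ->
    mean (fun w => F w / c)%R = (c^-1%:E * mean F)%E.
  move=> c0 mF F0; rewrite -meanZ ?invr_ge0 ?ltW//.
  by congr mean; apply/funext => w; rewrite mulrC.
have e1 : (mean (fun w => (\sum_(i0 <= j < i1) (p%:R - j%:R + eps)^-1 * deviation j w) ^+ 2 / r ^+ 2)%R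
    <= (quad_const R * 4%:R / kappa ^+ 2 * (p%:R * r ^+ 4)^-1)%:E)%E.
  rewrite mZ//; last 2 first.
  - apply: measurable_funX.
    by apply: (@sum_deviation_measurable (fun j v => (p%:R - j%:R + eps)^-1 * v)) => j;
      exact: measurable_funM.
  - by move=> w; exact: sqr_ge0.
  apply: (@le_trans _ _ ((r ^+ 2)^-1%:E * (quad_const R *
      \sum_(i0 <= j < i1) ((p%:R - j%:R + eps)^-1) ^+ 2)%:E)%E).
    by apply: lee_wpmul2l; [rewrite lee_fin invr_ge0 ltW|exact: mean_sq_deviations].
  rewrite -EFinM lee_fin.
  have s1 : \sum_(i0 <= j < i1) ((p%:R - j%:R + eps)^-1) ^+ 2 <= 4%:R / kappa ^+ 2 / p%:R.
    apply: (@le_trans _ _ (\sum_(i0 <= j < i1) 4%:R / kappa ^+ 2 / p%:R ^+ 2)).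
      rewrite big_nat [leRHS]big_nat; apply: ler_sum => j h.
      have pos : 0 < kappa * p%:R / 2 by rewrite divr_gt0 ?mulr_gt0.
      have h2 := hL j h; have pos2 := lt_le_trans pos h2.
      rewrite (_ : _ / _ / _ = ((kappa * p%:R / 2)^-1) ^+ 2); last by field; rewrite !gt_eqF.
      apply: lerXn2r; rewrite ?nnegrE ?invr_ge0 ?(ltW pos) ?(ltW pos2)//.
      by rewrite lef_pV2 ?posrE.
    rewrite sumr_const_nat -[_ *+ (i1 - i0)]mulr_natr.
    have -> : 4%:R / kappa ^+ 2 / p%:R = 4%:R / kappa ^+ 2 / p%:R ^+ 2 * p%:R.
      by field; rewrite !gt_eqF.
    apply: ler_wpM2l; first by rewrite !divr_ge0 ?sqr_ge0.
    by rewrite ler_nat (leq_trans _ i1p)// leq_subr.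
  apply: (@le_trans _ _ ((r ^+ 2)^-1 * (quad_const R * (4%:R / kappa ^+ 2 / p%:R)))).
    by apply: ler_wpM2l; [rewrite invr_ge0 ltW|exact: ler_wpM2l].
  have -> : (r ^+ 2)^-1 * (quad_const R * (4%:R / kappa ^+ 2 / p%:R)) =
      quad_const R * 4%:R / kappa ^+ 2 / p%:R * (r ^+ 2)^-1 by field; rewrite !gt_eqF.
  have -> : quad_const R * 4%:R / kappa ^+ 2 * (p%:R * r ^+ 4)^-1 =
      quad_const R * 4%:R / kappa ^+ 2 / p%:R * (r ^+ 4)^-1 by field; rewrite !gt_eqF.
  apply: ler_wpM2l.
    apply: divr_ge0; last exact: ltW.
    by apply: divr_ge0; [exact: mulr_ge0|exact: sqr_ge0].
  by rewrite lef_pV2 ?posrE ?exprn_gt0//; exact: (ler_wiXn2l (ltW r0) r1).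
have e2 : (mean (fun w => (\sum_(i0 <= j < i1) deviation j w ^+ 2) / (r * p%:R ^+ 2))%R <=
    (quad_const R / kappa ^+ 2 * (p%:R * r ^+ 4)^-1)%:E)%E.
  rewrite mZ//; last 2 first.
  - by apply: (@sum_deviation_measurable (fun j v => v ^+ 2)) => j; exact: exprn_measurable.
  - by move=> w; rewrite sumr_ge0// => j _; exact: sqr_ge0.
  have m1 j : (i0 <= j < i1)%N -> (mean (fun w => deviation j w ^+ 2)%R <= (quad_const R)%:E)%E.
    move=> h.
    (* A single deviation is a weighted sum with one nonzero weight. *)
    have := mean_sq_deviations (fun i => (i == j)%:R).
    have pick (F : nat -> R) : \sum_(i0 <= i < i1) (i == j)%:R * F i = F j.
      rewrite (bigD1_seq j) ?mem_index_iota ?iota_uniq//= eqxx mul1r.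
      by rewrite big1 ?addr0// => i /negbTE ->; rewrite mul0r.
    have -> : \sum_(i0 <= i < i1) ((i == j)%:R : R) ^+ 2 = 1.
      rewrite -[RHS](pick (fun=> 1)); apply: eq_bigr => i _.
      by case: (i == j); rewrite ?expr1n ?expr0n ?mul1r ?mul0r.
    rewrite mulr1; apply: le_trans; rewrite le_eqVlt; apply/orP; left; apply/eqP.
    by congr mean; apply/funext => w; rewrite pick.
  have s1 : (mean (fun w => \sum_(i0 <= j < i1) deviation j w ^+ 2)%R <=
      (quad_const R * p%:R)%:E)%E.
    rewrite (_ : (fun w => _) = fun w => \sum_(i0 <= j < i1 | (i0 <= j < i1)%N) deviation j w ^+ 2);
      last by apply/funext => w; rewrite big_nat.
    rewrite mean_sum; last 2 first.
    - by move=> j h; apply: measurable_funX; exact: deviation_measurable.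
    - by move=> j w; exact: sqr_ge0.
    apply: (@le_trans _ _ (\sum_(i0 <= j < i1 | (i0 <= j < i1)%N) (quad_const R)%:E)%E).
      by apply: lee_sum => j; exact: m1.
    rewrite -big_nat sumEFin lee_fin sumr_const_nat -[_ *+ (i1 - i0)]mulr_natr.
    by apply: ler_wpM2l => //; rewrite ler_nat (leq_trans _ i1p)// leq_subr.
  apply: (@le_trans _ _ ((r * p%:R ^+ 2)^-1%:E * (quad_const R * p%:R)%:E)%E).
    by apply: lee_wpmul2l => //; rewrite lee_fin invr_ge0 ltW.
  rewrite -EFinM lee_fin.
  have -> : (r * p%:R ^+ 2)^-1 * (quad_const R * p%:R) = quad_const R * (p%:R * r)^-1.
    by field; rewrite !gt_eqF.
  apply: ler_pM => //; first by rewrite invr_ge0 mulr_ge0// ltW.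
    rewrite ler_peMr// invf_ge1 ?exprn_gt0// exprn_ile1 ?ltW//; lra.
  rewrite lef_pV2 ?posrE ?mulr_gt0 ?exprn_gt0// ler_pM2l//.
  by rewrite -[leRHS]expr1; exact: (ler_wiXn2l (ltW r0) r1).
apply: (le_trans (leeD e1 e2)); rewrite -EFinD lee_fin le_eqVlt.
by apply/orP; left; apply/eqP; field; rewrite !gt_eqF.
Qed.

End OneDirection.
End RowProcess.

(** * Fluctuations and their probability *)

Section ProbabilisticBound.
Context (R : realType) (d : measure_display) (T : measurableType d)
  (P : probability T R).

(** Markov's inequality at level 1, from [1 <= 1_(U <= 1) + U]. *)
Lemma markov_le1 (U : T -> R) (e : R) : measurable_fun setT U ->
  (forall w, 0 <= U w) -> (mean P U <= e%:E)%E ->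
  measurable [set w | U w <= 1] /\ ((1 - e)%:E <= P [set w | (U w <= 1)%R])%E.
Proof.
move=> mU U0 Ue; set F := [set w | U w <= 1].
have mF : measurable F.
  rewrite -[X in measurable X]setTI (_ : F = U @^-1` `]-oo, 1]); first exact: mU.
  by apply/seteqP; split => w /=; rewrite in_itv.
split=> //.
have mI : measurable_fun setT (\1_F : T -> R) by exact: measurable_indic.
have : (mean P (fun=> 1)%R <= mean P (fun w => \1_F w + U w)%R)%E.
  apply: le_mean => //; first exact: measurable_funD.
  move=> w; rewrite indicE; case: (boolP (w \in F)) => [_|]; first by rewrite lerDl.
  by rewrite notin_setE /F /= => /negP; rewrite -ltNge add0r => /ltW.
rewrite mean_cst meanD// => h.
have PF : mean P (\1_F : T -> R) = P F by rewrite /mean integral_indic// setIT.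
rewrite EFinB leeBlDr//; apply: (le_trans h); rewrite PF; exact: leeD.
Qed.

Context (I : finType) (X : I -> {RV P >-> R}).
Hypothesis indep : mutually_independent X.
Variables (n1 n p : nat) (idx : 'I_n -> 'I_p -> I).
Hypothesis idx_inj : forall r k r' k', idx r k = idx r' k' -> r = r' /\ k = k'.
Hypothesis gauss : forall r k (A : set R), measurable A ->
  distribution P (X (idx r k)) A = normal_prob 0 1 A.
Variables (b bd : 'cV[R]_p).
Local Notation rows := (rows X idx).

(** A sum of fourth powers, to bound all the rows at once; the numerator has mean
    at most a multiple of [n * p ^+ 2]. *)
Definition dist_excess (r : R) (w : T) : R :=
  (\sum_(i < n) qdev (resid (rows w) i) (rows w i) ^+ 4) / (r * p%:R) ^+ 4.

Lemma resid_qdev_measurable (i : 'I_n) :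
  measurable_fun setT (fun w => qdev (resid (rows w) i) (rows w i)).
Proof.
apply: (@adapted_measurable _ _ _ _ _ X (before idx i.+1 0)); apply: adapted_qdev.
  exact: (past_mxW (leqnSn i) (@resid_past _ _ _ _ _ X _ _ _ idx_inj i)).
exact: rows_past.
Qed.

Lemma mean_dist_excess (r : R) : (0 < p)%N -> (n <= p)%N -> 0 < r ->
  (mean P (dist_excess r) <= (pow4_const R * (p%:R * r ^+ 4)^-1)%:E)%E.
Proof.
move=> p0 np r0; have P0 : (0 : R) < p%:R by rewrite ltr0n.
have rp : 0 < (r * p%:R) ^+ 4 by rewrite exprn_gt0// mulr_gt0.
have four0 (v : R) : 0 <= v ^+ 4 by rewrite (exprM _ 2 2) sqr_ge0.
rewrite (_ : dist_excess r = fun w => ((r * p%:R) ^+ 4)^-1 *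
    \sum_(i < n) qdev (resid (rows w) i) (rows w i) ^+ 4); last first.
  by apply/funext => w; rewrite mulrC.
have m4 (i : 'I_n) : measurable_fun setT (fun w => qdev (resid (rows w) i) (rows w i) ^+ 4).
  by apply: measurable_funX; exact: resid_qdev_measurable.
rewrite meanZ ?invr_ge0 ?(ltW rp)//; last 2 first.
- by apply: measurable_sum => i.
- by move=> w; rewrite sumr_ge0.
rewrite mean_sum//.
apply: (@le_trans _ _ (((r * p%:R) ^+ 4)^-1%:E *
    \sum_(i < n) (pow4_const R * p%:R ^+ 2)%:E)%E).
  apply: lee_wpmul2l; first by rewrite lee_fin invr_ge0 ltW.
  apply: lee_sum => i _; under [X in mean _ X]eq_fun do rewrite rowsE.
  apply: (mean_pow4_qdev indep idx_inj gauss p0).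
  - exact: resid_past.
  - by move=> w; exact: resid_sym.
  - by move=> w k; exact: sum_resid_row_sq.
rewrite sumEFin -EFinM lee_fin sumr_const card_ord -[_ *+ n]mulr_natr.
have -> : ((r * p%:R) ^+ 4)^-1 * (pow4_const R * p%:R ^+ 2 * n%:R) =
    pow4_const R * (p%:R * r ^+ 4)^-1 * (n%:R / p%:R) by field; rewrite !gt_eqF.
rewrite ler_piMr//; last by rewrite ler_pdivrMr// mul1r ler_nat.
by rewrite mulr_ge0 ?pow4_const_ge0// invr_ge0 mulr_ge0 ?exprn_ge0// ltW.
Qed.

Local Notation excess H i0 i1 := (process_excess X idx H i0 i1).

Definition total_excess (r : R) (w : T) : R :=
  dist_excess r w +
  (excess (fun j w => trace_dir (rows w) j) 0 n r 1 w +
   (excess (fun j w => rank1 (resid (rows w) j *m b)) 0 n r (-1) w +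
    (excess (fun j w => rank1 (resid (rows w) j *m bd)) 0 n1 r (-1) w +
     excess (fun j w => rank1 (transfer_fit (rows w) n1 j bd)) n1 n r 1 w))).

(** A single application of Markov's inequality handles all the fluctuations,
    since the mean of their sum is of order [1 / (p * r ^+ 4)]. *)
Lemma total_excess_event (kappa r : R) :
  0 < kappa <= 2^-1 -> 0 < r <= 1 -> (0 < p)%N -> (n1 <= n)%N ->
  kappa * p%:R <= p%:R - n%:R -> 2 <= kappa * p%:R ->
  measurable [set w | total_excess r w <= 1] /\
  ((1 - (pow4_const R + 20%:R * quad_const R / kappa ^+ 2) * (p%:R * r ^+ 4)^-1)%:E <=
   P [set w | (total_excess r w <= 1)%R])%E.
Proof.
move=> kk rr p0 n1n kn kp2; have [r0 r1] := andP rr; have [k0 k1] := andP kk.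
have P0 : (0 : R) < p%:R by rewrite ltr0n.
have np : (n <= p)%N.
  by rewrite -(ler_nat R) -subr_ge0 (le_trans _ kn)// mulr_ge0// ltW.
have hL (eps : R) i0 i1 : eps = 1 \/ eps = -1 -> (i1 <= n)%N ->
    forall j, (i0 <= j < i1)%N -> kappa * p%:R / 2 <= p%:R - j%:R + eps.
  move=> heps i1n j /andP[_ ji].
  have : (j%:R : R) <= n%:R by rewrite ler_nat ltnW// (leq_trans ji).
  by case: heps => ->; lra.
have p1 := @trace_dir_past _ _ _ _ _ X n p idx idx_inj.
have p2 c := @bias_dir_past _ _ _ _ _ X n p idx idx_inj c.
have p3 := @transfer_dir_past _ _ _ _ _ X n p idx idx_inj n1 bd.
have e0 := mean_dist_excess p0 np r0.
have e1 := mean_process_excess indep idx_inj gauss (fun j (_ : (0 <= j < n)%N) => p1 j)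
  (fun j w => frob2_trace_dir_le1 _ _) (leqnn n) kk rr (leq0n n) p0
  (hL 1 0%N n (or_introl erefl) (leqnn n)) np.
have e2 := mean_process_excess indep idx_inj gauss (fun j (_ : (0 <= j < n)%N) => p2 b j)
  (fun j w => frob2_rank1_le1 _) (leqnn n) kk rr (leq0n n) p0
  (hL (-1) 0%N n (or_intror erefl) (leqnn n)) np.
have e3 := mean_process_excess indep idx_inj gauss (fun j (_ : (0 <= j < n1)%N) => p2 bd j)
  (fun j w => frob2_rank1_le1 _) n1n kk rr (leq0n n1) p0
  (hL (-1) 0%N n1 (or_intror erefl) n1n) (leq_trans n1n np).
have e4 := mean_process_excess indep idx_inj gauss
  (fun j (h : (n1 <= j < n)%N) => p3 j (andP h).1)
  (fun j w => frob2_rank1_le1 _) (leqnn n) kk rr n1n p0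
  (hL 1 n1 n (or_introl erefl) (leqnn n)) np.
have m0 : measurable_fun setT (dist_excess r).
  apply: measurable_funM => //; apply: measurable_sum => i.
  by apply: measurable_funX; exact: resid_qdev_measurable.
have m1 := process_excess_measurable idx_inj (fun j (_ : (0 <= j < n)%N) => p1 j) r 1.
have m2 := process_excess_measurable idx_inj (fun j (_ : (0 <= j < n)%N) => p2 b j) r (-1).
have m3 := process_excess_measurable idx_inj (fun j (_ : (0 <= j < n1)%N) => p2 bd j) r (-1).
have m4 := process_excess_measurable idx_inj
  (fun j (h : (n1 <= j < n)%N) => p3 j (andP h).1) r 1.
have r0' := ltW r0.
have g0 w : 0 <= dist_excess r w.
  apply: divr_ge0; last by rewrite exprn_ge0// mulr_ge0.
  by apply: sumr_ge0 => i _; rewrite (exprM _ 2 2) sqr_ge0.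
have g H i0 i1 eps w : 0 <= excess H i0 i1 r eps w by exact: process_excess_ge0.
(* The partial sums of [total_excess], from the right, for the additivity of the mean. *)
have m34 := measurable_funD m3 m4; have m234 := measurable_funD m2 m34.
have m1234 := measurable_funD m1 m234.
have g34 w := addr_ge0 (g (fun j w => rank1 (resid (rows w) j *m bd)) 0%N n1 (-1) w)
  (g (fun j w => rank1 (transfer_fit (rows w) n1 j bd)) n1 n 1 w).
have g234 w := addr_ge0 (g (fun j w => rank1 (resid (rows w) j *m b)) 0%N n (-1) w) (g34 w).
have g1234 w := addr_ge0 (g (fun j w => trace_dir (rows w) j) 0%N n 1 w) (g234 w).
apply: markov_le1.
- exact: measurable_funD m0 m1234.
- by move=> w; exact: (addr_ge0 (g0 w) (g1234 w)).
do 4 (rewrite meanD//).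
apply: (le_trans (leeD e0 (leeD e1 (leeD e2 (leeD e3 e4))))).
rewrite -!EFinD lee_fin le_eqVlt; apply/orP; left; apply/eqP; field.
by rewrite !gt_eqF.
Qed.

Lemma process_excess_le1 H i0 i1 (r eps : R) w : 0 < r -> (0 < p)%N ->
  excess H i0 i1 r eps w <= 1 ->
  `|\sum_(i0 <= j < i1) (p%:R - j%:R + eps)^-1 * deviation X idx H j w| <= r /\
  \sum_(i0 <= j < i1) deviation X idx H j w ^+ 2 <= r * p%:R ^+ 2.
Proof.
move=> r0 p0; have P0 : (0 : R) < p%:R by rewrite ltr0n.
rewrite /process_excess; set s := \sum_(_ <= _ < _) _ * _; set q := \sum_(_ <= _ < _) _ => h.
have q0 : 0 <= q by apply: sumr_ge0 => j _; exact: sqr_ge0.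
have r2 : 0 < r ^+ 2 by rewrite exprn_gt0.
have rp : 0 < r * p%:R ^+ 2 by rewrite mulr_gt0// exprn_gt0.
have h1 : 0 <= s ^+ 2 / r ^+ 2 by rewrite divr_ge0 ?sqr_ge0.
have h2 : 0 <= q / (r * p%:R ^+ 2) by rewrite divr_ge0// ltW.
split.
  have : s ^+ 2 / r ^+ 2 <= 1 by lra.
  rewrite ler_pdivrMr// mul1r -(real_normK (num_real s)) => h3.
  by rewrite -(ler_pXn2r (n := 2))// nnegrE// ltW.
have : q / (r * p%:R ^+ 2) <= 1 by lra.
by rewrite ler_pdivrMr// mul1r.
Qed.

Lemma dist_excess_le1 (r : R) w : 0 < r -> (0 < p)%N -> dist_excess r w <= 1 ->
  forall j, (j < n)%N -> `|qdev (resid (rows w) j) (rows w j)| <= r * p%:R.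
Proof.
move=> r0 p0; have P0 : (0 : R) < p%:R by rewrite ltr0n.
have rp : 0 < r * p%:R by rewrite mulr_gt0.
have four0 (v : R) : 0 <= v ^+ 4 by rewrite (exprM _ 2 2) sqr_ge0.
rewrite /dist_excess ler_pdivrMr ?exprn_gt0// mul1r => h j jn.
rewrite -(ler_pXn2r (n := 4)) ?nnegrE ?(ltW rp)//.
have -> : `|qdev (resid (rows w) j) (rows w j)| ^+ 4 = qdev (resid (rows w) j) (rows w j) ^+ 4.
  by rewrite (exprM _ 2 2) real_normK ?num_real// -exprM.
apply: le_trans h; rewrite (bigD1 (Ordinal jn))//= lerDl.
by apply: sumr_ge0.
Qed.

End ProbabilisticBound.

(** * Deterministic limits when fluctuations are small *)

Section GoodRows.
Context (R : realType).

Definition small_fluctuations p (x : nat -> 'cV[R]_p) (H : nat -> 'M[R]_p)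
    (i0 i1 : nat) (r eps : R) : Prop :=
  `|\sum_(i0 <= j < i1) (p%:R - j%:R + eps)^-1 * qdev (H j) (x j)| <= r /\
  \sum_(i0 <= j < i1) qdev (H j) (x j) ^+ 2 <= r * p%:R ^+ 2.

(** The trace of [resid j] is [p - j] as long as the first [j] rows are independent,
    and the distances concentrate around this trace: independence and
    concentration are proved together by induction on [j]. *)
Lemma good_distances (p n : nat) (x : nat -> 'cV[R]_p) (kappa r : R) :
  0 < kappa <= 2^-1 -> (0 < p)%N -> kappa * p%:R <= p%:R - n%:R ->
  r <= kappa ^+ 2 / 512%:R ->
  (forall j, (j < n)%N -> `|qdev (resid x j) (x j)| <= r * p%:R) ->
  forall j, (j < n)%N -> dist2 x j != 0 /\
    `|dist2 x j - (p%:R - j%:R)| <= r * p%:R.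
Proof.
move=> /andP[k0 k1] p0 kn rk hq.
have P0 : (0 : R) < p%:R by rewrite ltr0n.
have tr k : (forall i, (i < k)%N -> dist2 x i != 0) -> \tr (resid x k) = p%:R - k%:R.
  elim: k => [_|k ih dk]; first by rewrite subr0 mxtrace1.
  rewrite mxtrace_residS ?dk// ih ?natr1; last by move=> i ik; apply: dk; exact: ltnW.
  by rewrite -natr1 opprD addrA.
have dE j : \tr (resid x j) = p%:R - j%:R -> dist2 x j - (p%:R - j%:R) = qdev (resid x j) (x j).
  by move=> t; rewrite dist2_quad /qdev t.
have nz j : (j < n)%N -> dist2 x j != 0.
  elim/ltn_ind: j => j ih jn.
  have t : \tr (resid x j) = p%:R - j%:R.
    by apply: tr => i ij; apply: ih => //; exact: ltn_trans jn.
  have := hq j jn; rewrite -(dE j t) ler_norml => /andP[h _].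
  have jn' : (j%:R : R) <= n%:R by rewrite ler_nat ltnW.
  have rp : r * p%:R < kappa * p%:R by rewrite ltr_pM2r//; nra.
  by rewrite gt_eqF//; lra.
move=> j jn; split; first exact: nz.
rewrite dE; first exact: hq.
by apply: tr => i ij; apply: nz; exact: ltn_trans jn.
Qed.

(** Of the constant, 300 is the error of the product, whose limit
    [(p + 1) / (p - n + 1)] is at most [2 / kappa], and 1 pays for replacing this
    limit minus 1 by [n / (p - n)]. *)
Lemma trace_gram_inv_limit (p n : nat) (x : nat -> 'cV[R]_p) (kappa r : R) :
  0 < kappa <= 2^-1 -> (0 < p)%N -> kappa * p%:R <= p%:R - n%:R ->
  r <= kappa ^+ 2 / 512%:R -> p%:R^-1 <= r ->
  (forall j, (j < n)%N -> `|qdev (resid x j) (x j)| <= r * p%:R) ->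
  small_fluctuations x (trace_dir x) 0 n r 1 ->
  `|\tr (gram_inv x n) - n%:R / (p%:R - n%:R)| <= 451%:R / kappa ^+ 3 * r.
Proof.
move=> kk p0 kn rk pr hq [f1 f2]; have [k0 k1] := andP kk.
have P0 : (0 : R) < p%:R by rewrite ltr0n.
have gd := good_distances kk p0 kn rk hq.
have r0 : 0 < r by apply: lt_le_trans pr; rewrite invr_gt0.
have kP : 0 < kappa * p%:R by rewrite mulr_gt0.
have np : (n <= p)%N by rewrite -(ler_nat R) -subr_ge0 (le_trans _ kn)// ltW.
have n0 : (0 : R) <= n%:R by [].
have := @perturbed_product R p kappa r 1 0 n (fun j => 1 + \tr (gram_inv x j))
  (fun j => qdev (trace_dir x j) (x j)) (dist2 x) kk (or_introl erefl) (leq0n n) kn rk pr P0.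
rewrite (prod_grow _ (leq0n n) np) subr0 mxtrace0 addr0 !mul1r.
have Ln : 0 < p%:R - n%:R :> R by exact: lt_le_trans kn.
have L1 : 0 < p%:R - n%:R + 1 :> R by lra.
move=> /(_ (fun j h => (gd j (andP h).2).2) f1 f2 (fun j _ => one_qdev_trace_dir_ge0 _ _ _) ler01).
have hs j : (0 <= j < n)%N -> 1 + \tr (gram_inv x j.+1) =
    (1 + \tr (gram_inv x j)) * (1 + 1 * (1 + qdev (trace_dir x j) (x j)) / dist2 x j).
  move=> /= jn; rewrite one_trace_step ?mul1r// => i ij.
  exact: (gd i (leq_trans ij jn)).1.
move=> /(_ hs) h.
have rho : (p%:R + 1) / (p%:R - n%:R + 1) <= 2 / kappa.
  rewrite ler_pdivrMr// mulrAC ler_pdivlMr//.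
  have pp : 1 <= p%:R :> R by rewrite ler1n.
  have : kappa * (p%:R + 1) <= 2 * (kappa * p%:R) by nra.
  lra.
have h2 : 150%:R / kappa ^+ 2 * r * ((p%:R + 1) / (p%:R - n%:R + 1)) <= 300%:R / kappa ^+ 3 * r.
  apply: (@le_trans _ _ (150%:R / kappa ^+ 2 * r * (2 / kappa))).
    by apply: ler_wpM2l => //; rewrite mulr_ge0 ?divr_ge0 ?sqr_ge0// ltW.
  by rewrite le_eqVlt; apply/orP; left; apply/eqP; field; rewrite gt_eqF.
have gap : 0 <= (n%:R : R) / (p%:R - n%:R) - n%:R / (p%:R - n%:R + 1) <= kappa ^- 2 * r.
  have -> : (n%:R : R) / (p%:R - n%:R) - n%:R / (p%:R - n%:R + 1) =
      n%:R / ((p%:R - n%:R) * (p%:R - n%:R + 1)) by field; rewrite !gt_eqF.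
  have LL : 0 < (p%:R - n%:R) * (p%:R - n%:R + 1) :> R by rewrite mulr_gt0.
  rewrite divr_ge0 ?(ltW LL)//=.
  apply: (@le_trans _ _ (p%:R / (kappa * p%:R) ^+ 2)).
    apply: ler_pM; rewrite ?invr_ge0 ?(ltW LL) ?ler_nat//.
    rewrite lef_pV2 ?posrE ?exprn_gt0// expr2; apply: ler_pM; clear -kP kn; lra.
  have -> : p%:R / (kappa * p%:R) ^+ 2 = kappa ^- 2 * p%:R^-1 by field; rewrite !gt_eqF.
  by apply: ler_wpM2l => //; rewrite invr_ge0 sqr_ge0.
have k2 : kappa ^- 2 * r <= kappa ^- 3 * r.
  rewrite ler_pM2r// lef_pV2 ?posrE ?exprn_gt0//; apply: ler_wiXn2l => //; [exact: ltW|clear -k1; lra].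
have one : (p%:R + 1) / (p%:R - n%:R + 1) = 1 + n%:R / (p%:R - n%:R + 1) :> R.
  by field; rewrite gt_eqF.
move: h; rewrite one in h2 * => h.
have h3 := le_trans h h2; case/andP: gap => g1 g2.
have q3 : 0 <= kappa ^- 3 * r by rewrite mulr_ge0 ?invr_ge0 ?exprn_ge0 ?ltW.
clear -h3 g1 g2 k2 q3; move: h3; rewrite !ler_norml => /andP[a b].
by apply/andP; split; lra.
Qed.

Lemma bias_limit (p n : nat) (x : nat -> 'cV[R]_p) (b : 'cV[R]_p) (kappa r : R) :
  0 < kappa <= 2^-1 -> (0 < p)%N -> kappa * p%:R <= p%:R - n%:R ->
  r <= kappa ^+ 2 / 512%:R -> p%:R^-1 <= r ->
  (forall j, (j < n)%N -> `|qdev (resid x j) (x j)| <= r * p%:R) ->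
  small_fluctuations x (fun j => rank1 (resid x j *m b)) 0 n r (-1) ->
  `|sq_norm (resid x n *m b) - (p%:R - n%:R) / p%:R * sq_norm b|
    <= 150%:R / kappa ^+ 2 * r * sq_norm b.
Proof.
move=> kk p0 kn rk pr hq [f1 f2]; have [k0 k1] := andP kk.
have P0 : (0 : R) < p%:R by rewrite ltr0n.
have gd := good_distances kk p0 kn rk hq.
have r0 : 0 < r by apply: lt_le_trans pr; rewrite invr_gt0.
have kP : 0 < kappa * p%:R by rewrite mulr_gt0.
have np : (n < p)%N by rewrite -(ltr_nat R) -subr_gt0 (lt_le_trans _ kn).
have n0 : (0 : R) <= n%:R by [].
have b0 : 0 <= sq_norm b by exact: sq_norm_ge0.
have := @perturbed_product R p kappa r (-1) 0 n (fun j => sq_norm (resid x j *m b))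
  (fun j => qdev (rank1 (resid x j *m b)) (x j)) (dist2 x) kk (or_intror erefl) (leq0n n) kn rk pr P0.
rewrite (prod_shrink _ (leq0n n) np) subr0 mul1mx.
move=> /(_ (fun j h => (gd j (andP h).2).2) f1 f2 (fun j _ => one_qdev_rank1_ge0 _ _) b0).
have hs j : (0 <= j < n)%N -> sq_norm (resid x j.+1 *m b) =
    sq_norm (resid x j *m b) * (1 + -1 * (1 + qdev (rank1 (resid x j *m b)) (x j)) / dist2 x j).
  by move=> _; rewrite bias_step !mulNr mul1r.
move=> /(_ hs) h; rewrite [X in _ - X]mulrC; apply: (le_trans h); apply: ler_wpM2l.
  by rewrite mulr_ge0 ?divr_ge0 ?sqr_ge0// ltW.
rewrite ler_piMr// ler_pdivrMr// mul1r; lra.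
Qed.

(** The first [n1] rows bring the fit to [b] minus its residual, of squared norm
    [n1 / p] times that of [b] by [bias_limit]; the other rows multiply it by about
    [(p - n1) / (p - n)]. The constant is 300 for this product, 150 for the start
    and 1 for the shift by one in the exact product. *)
Lemma transfer_limit (p n1 n : nat) (x : nat -> 'cV[R]_p) (b : 'cV[R]_p) (kappa r : R) :
  0 < kappa <= 2^-1 -> (0 < p)%N -> (n1 <= n)%N -> kappa * p%:R <= p%:R - n%:R ->
  r <= kappa ^+ 2 / 512%:R -> p%:R^-1 <= r ->
  (forall j, (j < n)%N -> `|qdev (resid x j) (x j)| <= r * p%:R) ->
  small_fluctuations x (fun j => rank1 (resid x j *m b)) 0 n1 r (-1) ->
  small_fluctuations x (fun j => rank1 (transfer_fit x n1 j b)) n1 n r 1 ->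
  `|sq_norm (transfer_fit x n1 n b) -
     n1%:R * (p%:R - n1%:R) / (p%:R * (p%:R - n%:R)) * sq_norm b|
    <= 451%:R / kappa ^+ 3 * r * sq_norm b.
Proof.
move=> kk p0 n1n kn rk pr hq fb [f1 f2]; have [k0 k1] := andP kk.
have P0 : (0 : R) < p%:R by rewrite ltr0n.
have gd := good_distances kk p0 kn rk hq.
have r0 : 0 < r by apply: lt_le_trans pr; rewrite invr_gt0.
have kP : 0 < kappa * p%:R by rewrite mulr_gt0.
have np : (n <= p)%N by rewrite -(ler_nat R) -subr_ge0 (le_trans _ kn)// ltW.
have n0 : (0 : R) <= n1%:R by [].
have n1nR : (n1%:R : R) <= n%:R by rewrite ler_nat.
have b0 : 0 <= sq_norm b by exact: sq_norm_ge0.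
have kn1 : kappa * p%:R <= p%:R - n1%:R by lra.
have start := bias_limit kk p0 kn1 rk pr (fun j h => hq j (leq_trans h n1n)) fb.
have t0E : sq_norm (transfer_fit x n1 n1 b) = sq_norm b - sq_norm (resid x n1 *m b).
  by apply: transfer_fit_start => i i1; exact: (gd i (leq_trans i1 n1n)).1.
set t0 := sq_norm (transfer_fit x n1 n1 b) in t0E.
have t00 : 0 <= t0 by exact: sq_norm_ge0.
have t0b : t0 <= sq_norm b by rewrite t0E lerBlDr lerDl sq_norm_ge0.
have := @perturbed_product R p kappa r 1 n1 n (fun j => sq_norm (transfer_fit x n1 j b))
  (fun j => qdev (rank1 (transfer_fit x n1 j b)) (x j)) (dist2 x) kk (or_introl erefl) n1n kn rk pr P0.
rewrite (prod_grow _ n1n np) -/t0.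
move=> /(_ (fun j h => (gd j (andP h).2).2) f1 f2 (fun j _ => one_qdev_rank1_ge0 _ _) t00).
have hs j : (n1 <= j < n)%N -> sq_norm (transfer_fit x n1 j.+1 b) =
    sq_norm (transfer_fit x n1 j b) *
    (1 + 1 * (1 + qdev (rank1 (transfer_fit x n1 j b)) (x j)) / dist2 x j).
  move=> /andP[n1j jn]; rewrite transfer_step ?mul1r// => i ij.
  exact: (gd i (leq_trans ij jn)).1.
move=> /(_ hs).
set t1 := sq_norm (transfer_fit x n1 n b).
set rho := (_ / (p%:R - n%:R + 1)) => h.
have Ln : 0 < p%:R - n%:R :> R by exact: lt_le_trans kn.
have L1 : 0 < p%:R - n%:R + 1 :> R by lra.
pose rho' : R := (p%:R - n1%:R) / (p%:R - n%:R).
have pp : 1 <= p%:R :> R by rewrite ler1n.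
have rho_le : 0 <= rho <= 2 / kappa.
  rewrite divr_ge0 ?(ltW L1)//=; last by lra.
  rewrite ler_pdivrMr// mulrAC ler_pdivlMr//.
  have : kappa * (p%:R - n1%:R + 1) <= 2 * (kappa * p%:R) by nra.
  lra.
have rho'_le : 0 <= rho' <= kappa^-1.
  rewrite divr_ge0 ?(ltW Ln)//=; last by lra.
  rewrite ler_pdivrMr// mulrC ler_pdivlMr//; nra.
have gap : 0 <= rho' - rho <= kappa ^- 2 * r.
  have -> : rho' - rho = (n%:R - n1%:R) / ((p%:R - n%:R) * (p%:R - n%:R + 1)).
    by rewrite /rho /rho'; field; rewrite !gt_eqF.
  have LL : 0 < (p%:R - n%:R) * (p%:R - n%:R + 1) :> R by rewrite mulr_gt0.
  rewrite divr_ge0 ?subr_ge0 ?(ltW LL)//=.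
  apply: (@le_trans _ _ (p%:R / (kappa * p%:R) ^+ 2)).
    apply: ler_pM; rewrite ?invr_ge0 ?(ltW LL) ?subr_ge0//.
      have : (n%:R : R) <= p%:R by rewrite ler_nat.
      lra.
    rewrite lef_pV2 ?posrE ?exprn_gt0// expr2; apply: ler_pM; clear -kP kn; lra.
  have -> : p%:R / (kappa * p%:R) ^+ 2 = kappa ^- 2 * p%:R^-1 by field; rewrite !gt_eqF.
  by apply: ler_wpM2l => //; rewrite invr_ge0 sqr_ge0.
have k2 : kappa ^- 2 * r <= kappa ^- 3 * r.
  rewrite ler_pM2r// lef_pV2 ?posrE ?exprn_gt0//; apply: ler_wiXn2l => //; [exact: ltW|clear -k1; lra].
have st2 : `|t0 - n1%:R / p%:R * sq_norm b| <= 150%:R / kappa ^+ 2 * r * sq_norm b.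
  rewrite distrC t0E; apply: le_trans start; rewrite le_eqVlt; apply/orP; left; apply/eqP.
  by congr `|_|; field; rewrite gt_eqF.
set B := sq_norm b in b0 t0b st2 *.
have e1 : 150%:R / kappa ^+ 2 * r * (t0 * rho) <= 300%:R * (kappa ^- 3 * r * B).
  have -> : 300%:R * (kappa ^- 3 * r * B) = 150%:R / kappa ^+ 2 * r * (B * (2 / kappa)).
    by field; rewrite gt_eqF.
  apply: ler_wpM2l; first by rewrite mulr_ge0 ?divr_ge0 ?sqr_ge0// ltW.
  by case/andP: rho_le => ? ?; exact: ler_pM.
have e2 : t0 * (rho' - rho) <= kappa ^- 3 * r * B.
  rewrite mulrC; case/andP: gap => g1 g2; apply: ler_pM => //; exact: le_trans k2.
have e2' : 0 <= t0 * (rho' - rho) by rewrite mulr_ge0//; case/andP: gap.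
have e3 : `|t0 - n1%:R / p%:R * B| * rho' <= 150%:R * (kappa ^- 3 * r * B).
  have -> : 150%:R * (kappa ^- 3 * r * B) = 150%:R / kappa ^+ 2 * r * B * kappa^-1.
    by field; rewrite gt_eqF.
  by case/andP: rho'_le => ? ?; exact: ler_pM.
have -> : t1 - n1%:R * (p%:R - n1%:R) / (p%:R * (p%:R - n%:R)) * B =
    (t1 - t0 * rho) + (- (t0 * (rho' - rho)) + (t0 - n1%:R / p%:R * B) * rho').
  by rewrite /rho'; field; rewrite !gt_eqF.
apply: (le_trans (ler_normD _ _)).
have e4 : `|- (t0 * (rho' - rho)) + (t0 - n1%:R / p%:R * B) * rho'| <=
    t0 * (rho' - rho) + `|t0 - n1%:R / p%:R * B| * rho'.
  apply: (le_trans (ler_normD _ _)); rewrite normrN ger0_norm// normrM.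
  by rewrite (ger0_norm (andP rho'_le).1).
have := le_trans h e1; rewrite (_ : 451%:R / kappa ^+ 3 * r * B = 451%:R * (kappa ^- 3 * r * B)).
  clear -e2 e3 e4; lra.
by rewrite !mulrA.
Qed.

End GoodRows.

(** * Risk terms of the transfer model *)

Section ModelRows.
Context (R : realType) (M : transfer_model R).
Local Notation p := (num_features M).
Local Notation n1 := (size1 M).
Local Notation n2 := (size2 M).
Local Notation n := (total_size M).
Hypothesis Sigma1_id : Sigma1 M = 1%:M.
Hypothesis Sigma2_id : Sigma2 M = 1%:M.

Definition entry_index (r : 'I_(n1 + n2)) (k : 'I_p) :
    'I_n1 * 'I_p + 'I_n2 * 'I_p + ('I_n1 + 'I_n2) :=
  match fintype.split r with
  | inl a => inl (inl (a, k))
  | inr a => inl (inr (a, k))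
  end.

Lemma entry_index_inj r k r' k' :
  entry_index r k = entry_index r' k' -> r = r' /\ k = k'.
Proof.
rewrite /entry_index -{2}(splitK r) -{2}(splitK r').
by case: (fintype.split r) => a; case: (fintype.split r') => b // [-> ->].
Qed.

Local Notation x := (rows (@entries R M) entry_index).

Lemma rows_X (w : Omega M) (r : 'I_(n1 + n2)) : x w r = (row r (X w))^T.
Proof.
rewrite rowsE; apply/matrixP => k l; rewrite !mxE /entry_index.
rewrite /X1 /X2 Sigma1_id Sigma2_id psd_sqrt1 !mulmx1.
by case: (fintype.split r) => a; rewrite mxE.
Qed.

Lemma gram_rows m q (A : 'M[R]_(m, q)) (y : nat -> 'cV[R]_q) :
  (forall i : 'I_m, y i = (row i A)^T) -> gram y m = A^T *m A.
Proof.
move=> yE.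
have gE k : gram y k = \sum_(j < k) y j *m (y j)^T.
  by elim: k => [|k ih]; rewrite ?big_ord0// big_ord_recr /= ih.
rewrite gE; apply/matrixP => a b; rewrite summxE mxE; apply: eq_bigr => i _.
by rewrite yE trmxK mxE big_ord1 !mxE.
Qed.

Lemma gram_X (w : Omega M) : gram (x w) n = (X w)^T *m X w.
Proof. by apply: gram_rows => i; rewrite rows_X. Qed.

Lemma gram_X1 (w : Omega M) : gram (x w) n1 = (X1 w)^T *m X1 w.
Proof.
apply: gram_rows => i; rewrite -[nat_of_ord i]/(nat_of_ord (lshift n2 i)) rows_X.
by rewrite /X rowKu.
Qed.

(** With an identity covariance the factors [Sigma_hat^+ Sigma_hat - 1] and
    [Sigma_hat^+] are adjacent, and their product vanishes. *)
Lemma B3_zero (w : Omega M) : B3_term w = 0.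
Proof.
have [_ h _ _] := mp_inverseP (Sigma_hat w).
rewrite /B3_term Sigma2_id mulmx1 -(mulmxA _ _ (mp_inverse _)) mulmxBl h mul1mx subrr.
by rewrite mulmx0 !mul0mx mxE mulr0.
Qed.

Section Invertible.
Variable w : Omega M.
Hypothesis n_gt0 : (0 < n)%N.
Hypothesis indep_rows : forall j, (j < n)%N -> dist2 (x w) j != 0.

Lemma Sigma_hat_gram : Sigma_hat w = n%:R^-1 *: gram (x w) n.
Proof. by rewrite gram_X. Qed.

Let n_neq0 : n%:R != 0 :> R.
Proof. by rewrite pnatr_eq0 -lt0n. Qed.

Lemma pinv_Sigma_hat : mp_inverse (Sigma_hat w) = n%:R *: gram_inv (x w) n.
Proof.
apply: (mp_inverse_unique (mp_inverseP _)); rewrite Sigma_hat_gram.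
by have := gram_mp (invr_neq0 n_neq0) indep_rows; rewrite invrK.
Qed.

Lemma pinv_Sigma_hat_mul : mp_inverse (Sigma_hat w) *m Sigma_hat w = 1%:M - resid (x w) n.
Proof.
have [_ _ SB] := recursion_invariants indep_rows.
rewrite pinv_Sigma_hat Sigma_hat_gram -scalemxAl -scalemxAr scalerA mulfV// scale1r.
by rewrite -[LHS]trmxK trmx_mul gram_inv_sym gram_sym SB linearB /= trmx1 resid_sym.
Qed.

Lemma V_termE : V_term w = sigma M ^+ 2 * \tr (gram_inv (x w) n).
Proof.
rewrite /V_term Sigma2_id mulmx1 pinv_Sigma_hat mxtraceZ.
by rewrite mulrA divfK.
Qed.

Lemma B1_termE : B1_term w = sq_norm (resid (x w) n *m beta2 M).
Proof.
rewrite /B1_term Sigma2_id mulmx1 pinv_Sigma_hat_mul addrAC subrr add0r.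
rewrite !(mulmxN, mulNmx) opprK -trmx_mul_sq_norm trmx_mul resid_sym.
by rewrite mulmxA.
Qed.

Lemma B2_termE : B2_term w = sq_norm (transfer_fit (x w) n1 n (beta_diff M)).
Proof.
have E : mp_inverse (Sigma_hat w) *m S1 w *m beta_diff M =
    transfer_fit (x w) n1 n (beta_diff M).
  rewrite pinv_Sigma_hat /S1 -gram_X1 -scalemxAl -scalemxAr scalerA mulfV//.
  by rewrite scale1r /transfer_fit mulmxA.
rewrite -E -trmx_mul_sq_norm !trmx_mul /B2_term Sigma2_id mulmx1.
have -> : (mp_inverse (Sigma_hat w))^T = mp_inverse (Sigma_hat w).
  by rewrite pinv_Sigma_hat linearZ /= gram_inv_sym.
have -> : (S1 w)^T = S1 w by rewrite /S1 linearZ /= trmx_mul trmxK.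
by rewrite !mulmxA.
Qed.

End Invertible.

Lemma risk_terms_limit (kappa r : R) (w : Omega M) :
  0 < kappa <= 2^-1 -> (0 < p)%N -> (0 < n)%N -> kappa * p%:R <= p%:R - n%:R ->
  0 < r -> r <= kappa ^+ 2 / 512%:R -> p%:R^-1 <= r ->
  total_excess (@entries R M) n1 entry_index (beta2 M) (beta_diff M) r w <= 1 ->
  let C := 451%:R / kappa ^+ 3 in
  [/\ `|V_term w - sigma M ^+ 2 * (n%:R / (p%:R - n%:R))| <= C * (sigma M ^+ 2 * r),
      `|B1_term w - (p%:R - n%:R) / p%:R * sq_norm (beta2 M)|
        <= C * (r * sq_norm (beta2 M)),
      `|B2_term w - n1%:R * (p%:R - n1%:R) / (p%:R * (p%:R - n%:R)) *
         sq_norm (beta_diff M)| <= C * (r * sq_norm (beta_diff M)) &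
      B3_term w = 0].
Proof.
move=> kk p0 n0 kn r0 rk pr U1 C; have [k0 k1] := andP kk.
have n1n : (n1 <= n)%N by rewrite leq_addr.
have r0' := ltW r0.
have d0 : 0 <= dist_excess (@entries R M) entry_index r w.
  apply: divr_ge0; last by rewrite exprn_ge0// mulr_ge0.
  by apply: sumr_ge0 => i _; rewrite (exprM _ 2 2) sqr_ge0.
have g0 H i0 i1 eps : 0 <= process_excess (@entries R M) entry_index H i0 i1 r eps w.
  exact: process_excess_ge0.
have := U1; rewrite /total_excess.
set u0 := dist_excess _ _ _ _; set u1 := process_excess _ _ _ _ _ _ _ _.
set u2 := process_excess _ _ _ _ _ _ _ _; set u3 := process_excess _ _ _ _ _ _ _ _.
set u4 := process_excess _ _ _ _ _ _ _ _ => U.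
have [v1 v2 v3 v4] : [/\ 0 <= u1, 0 <= u2, 0 <= u3 & 0 <= u4] by split; exact: g0.
have hq : forall j, (j < n)%N -> `|qdev (resid (x w) j) (x w j)| <= r * p%:R.
  by apply: (dist_excess_le1 r0 p0); rewrite -/u0; move: d0; rewrite -/u0; lra.
have f1 : u1 <= 1 by move: d0; rewrite -/u0; lra.
have f2 : u2 <= 1 by move: d0; rewrite -/u0; lra.
have f3 : u3 <= 1 by move: d0; rewrite -/u0; lra.
have f4 : u4 <= 1 by move: d0; rewrite -/u0; lra.
have {}f1 := process_excess_le1 r0 p0 f1; have {}f2 := process_excess_le1 r0 p0 f2.
have {}f3 := process_excess_le1 r0 p0 f3; have {}f4 := process_excess_le1 r0 p0 f4.
have nz j : (j < n)%N -> dist2 (x w) j != 0.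
  by move=> jn; exact: (good_distances kk p0 kn rk hq jn).1.
have Ck : 150%:R / kappa ^+ 2 <= C.
  rewrite /C ler_pdivrMr ?exprn_gt0// mulrAC ler_pdivlMr ?exprn_gt0//.
  have : kappa ^+ 3 <= kappa ^+ 2 by apply: ler_wiXn2l => //; [exact: ltW|lra].
  have : 0 < kappa ^+ 2 by rewrite exprn_gt0.
  lra.
split.
- rewrite V_termE// -mulrBr normrM ger0_norm ?sqr_ge0// mulrCA.
  apply: ler_wpM2l; first exact: sqr_ge0.
  exact: (trace_gram_inv_limit kk p0 kn rk pr hq f1).
- rewrite B1_termE//; apply: (le_trans (bias_limit kk p0 kn rk pr hq f2)).
  rewrite mulrA; apply: ler_wpM2r; first exact: sq_norm_ge0.
  by apply: ler_wpM2r.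
- rewrite B2_termE// [leRHS]mulrA.
  exact: (transfer_limit kk p0 n1n kn rk pr hq f3 f4).
- exact: B3_zero.
Qed.

End ModelRows.

(** * The rate *)

Section Rate.
Context (R : realType).

Definition rate (p : nat) : R := (p%:R : R) `^ (- (12%:R)^-1).

Lemma rate_pow12 p : (0 < p)%N -> rate p ^+ 12 = p%:R^-1.
Proof.
move=> p0; rewrite /rate -powR_mulrn ?powR_ge0// -powRrM mulNr mulVf//.
by rewrite powR_inv1.
Qed.

Lemma rate_gt0 p : (0 < p)%N -> 0 < rate p.
Proof. by move=> p0; rewrite powR_gt0// ltr0n. Qed.

Lemma rate_le p (e : R) : (0 < p)%N -> 0 < e -> e ^- 12 <= p%:R -> rate p <= e.
Proof.
move=> p0 e0 h; rewrite -(ler_pXn2r (n := 12)) ?nnegrE ?(ltW e0) ?(ltW (rate_gt0 p0))//.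
by rewrite rate_pow12// -[leRHS]invrK lef_pV2 ?posrE ?ltr0n ?invr_gt0 ?exprn_gt0.
Qed.

Lemma rate_le1 p : (0 < p)%N -> rate p <= 1.
Proof. by move=> p0; apply: rate_le => //; rewrite expr1n invr1 ler1n. Qed.

Lemma inv_le_rate p : (0 < p)%N -> p%:R^-1 <= rate p.
Proof.
move=> p0; rewrite -rate_pow12// -[leRHS]expr1.
by apply: ler_wiXn2l => //; [exact: (ltW (rate_gt0 p0))|exact: rate_le1].
Qed.

(** As [p] is the power -12 of the rate, the left-hand side is the rate to the
    power 8. *)
Lemma rate_budget p : (0 < p)%N -> (p%:R * rate p ^+ 4)^-1 <= rate p.
Proof.
move=> p0; have r0 := rate_gt0 p0.
have -> : (p%:R * rate p ^+ 4)^-1 = rate p ^+ 8.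
  rewrite invfM -rate_pow12// (_ : rate p ^+ 12 = rate p ^+ 8 * rate p ^+ 4); last by rewrite -exprD.
  by rewrite mulfK// gt_eqF// exprn_gt0.
by rewrite -[leRHS]expr1; apply: ler_wiXn2l => //; [exact: ltW|exact: rate_le1].
Qed.

Lemma rate_cvg0 (p : nat -> nat) (e : R) : (forall m, (0 < p m)%N) ->
  p @ \oo --> \oo -> 0 < e -> \forall m \near \oo, rate (p m) <= e.
Proof.
move=> p0 poo e0.
have := (archi_boundP (_ : 0 <= e ^- 12)); rewrite invr_ge0 exprn_ge0 ?(ltW e0)// => /(_ isT) hN.
move/cvgnyPge : poo => /(_ (Num.bound (e ^- 12))); apply: filterS => m hm.
apply: rate_le => //; apply: (le_trans (ltW hN)); by rewrite ler_nat.
Qed.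

End Rate.

(** * The asymptotic risk of the pooled interpolator *)

Theorem corollary3p2 (R : realType) (tau : R) (htau : 0 < tau < 1) :
  exists C : R, 0 < C /\
  forall (M : nat -> transfer_model R),
    (fun m => num_features (M m)) @ \oo --> \oo ->
    (forall m, regularity_conditions (M m) tau) ->
    (forall m, gaussian_design (M m)) ->
    (forall m, Sigma1 (M m) = 1%:M /\ Sigma2 (M m) = 1%:M) ->
    with_high_probability (fun m => prob (M m)) (fun m =>
      [set w : Omega (M m) |
        let p := (num_features (M m))%:R : R in
        let n1 := (size1 (M m))%:R : R in
        let n := (total_size (M m))%:R : R in
        let s2 := sigma (M m) ^+ 2 in
        let b2 := sq_norm (beta2 (M m)) in
        let bd := sq_norm (beta_diff (M m)) in
        let rate := p `^ (- (12%:R)^-1) in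
        [/\ `|V_term w - s2 * (n / (p - n))| <= C * (s2 * rate),
            `|B1_term w - (p - n) / p * b2| <= C * (rate * b2),
            `|B2_term w - n1 * (p - n1) / (p * (p - n)) * bd|
               <= C * (rate * bd) &
            B3_term w = 0]]).
Proof.
(* From [p >= (1 + tau) n] one gets [p - n >= tau / (1 + tau) * p], and
   [1 + tau <= 2]. *)
have [t0 t1] := andP htau; pose kappa := tau / 2.
have k0 : 0 < kappa by rewrite divr_gt0.
have kk : 0 < kappa <= 2^-1 by rewrite k0 /kappa; lra.
exists (451%:R / kappa ^+ 3); split.
  by apply: divr_gt0; [rewrite ltr0n | exact: exprn_gt0].
move=> M poo reg gau sig.
pose p m := num_features (M m); pose n m := total_size (M m).
have size_ok m : [/\ (0 < p m)%N, (0 < n m)%N & kappa * (p m)%:R <= (p m)%:R - (n m)%:R].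
  have [_ _ _ [_ _ /andP[h _]]] := reg m.
  have n0 : (0 < n m)%N.
    rewrite lt0n; apply/negP => /eqP nm0; move: h; rewrite -/(n m) nm0 invr0 mulr0; lra.
  have n0R : (0 : R) < (n m)%:R by rewrite ltr0n.
  move: h; rewrite ler_pdivlMr -?/(n m)// => h.
  have p0R : (0 : R) < (p m)%:R by rewrite (lt_le_trans _ h)// mulr_gt0//; lra.
  split=> //; first by rewrite -(ltr0n R).
  rewrite /kappa; have : 0 <= (n m)%:R * (tau * (1 - tau)) :> R.
    by rewrite mulr_ge0 ?mulr_ge0//; lra.
  have : (1 - tau / 2) * ((1 + tau) * (n m)%:R) <= (1 - tau / 2) * (p m)%:R.
    by rewrite ler_wpM2l//; lra.
  rewrite -/(p m); lra.
have p0 m : (0 < p m)%N by have [] := size_ok m.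
pose r m := rate R (p m).
pose U m := total_excess (@entries R (M m)) (size1 (M m)) (@entry_index R (M m))
  (beta2 (M m)) (beta_diff (M m)) (r m).
(* The event is empty for the finitely many [m] at which the rate is not yet
   small; this does not affect the limit. *)
pose F m := if r m <= kappa ^+ 2 / 512%:R then [set w | U m w <= 1] else set0.
pose K := pow4_const R + 20%:R * quad_const R / kappa ^+ 2.
have K0 : 0 <= K.
  apply: addr_ge0; first exact: pow4_const_ge0.
  apply: divr_ge0; last exact: sqr_ge0.
  by apply: mulr_ge0; last exact: quad_const_ge0.
have event m : r m <= kappa ^+ 2 / 512%:R ->
    measurable [set w | U m w <= 1] /\
    ((1 - K * r m)%:E <= prob (M m) [set w | (U m w <= 1)%R])%E.
  move=> rk; have [_ n0 kn] := size_ok m.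
  have [ind _ _ _] := reg m; have [g1 g2] := gau m.
  have gauss' (i : 'I_(size1 (M m) + size2 (M m))) (k : 'I_(num_features (M m))) (A : set R) :
      measurable A ->
      distribution (prob (M m)) (entries (entry_index i k)) A = normal_prob 0 1 A.
    by rewrite /entry_index; case: (fintype.split i) => a mA /=; [exact: g1|exact: g2].
  have kp2 : 2 <= kappa * (p m)%:R.
    have P0 : (0 : R) < (p m)%:R by rewrite ltr0n.
    have := le_trans (inv_le_rate R (p0 m)) rk.
    rewrite -(ler_pM2r P0) mulVf ?gt_eqF// => h.
    have : kappa ^+ 2 * (p m)%:R <= kappa * (p m)%:R.
      by rewrite ler_pM2r// expr2 ler_piMl ?(ltW k0)//; lra.
    lra.
  have [mU PU] := @total_excess_event R _ _ (prob (M m)) _ _ ind (size1 (M m)) _ _ _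
    (@entry_index_inj R (M m)) gauss' (beta2 (M m)) (beta_diff (M m)) kappa (r m) kk
    (introT andP (conj (rate_gt0 R (p0 m)) (rate_le1 R (p0 m)))) (p0 m) (leq_addr _ _) kn kp2.
  split; first exact: mU.
  apply: le_trans PU; rewrite lee_fin lerD2l lerN2.
  by apply: ler_wpM2l; [exact: K0 | exact (rate_budget R (p0 m))].
exists F; split.
- by move=> m; rewrite /F; case: ifP => // /event[].
- move=> m w; rewrite /F; case: ifP => // rk Uw /=.
  have [_ n0 kn] := size_ok m; have [s1 s2] := sig m.
  exact: (risk_terms_limit s1 s2 kk (p0 m) n0 kn (rate_gt0 R (p0 m)) rk
    (inv_le_rate R (p0 m)) Uw).
have mF m : measurable (F m) by rewrite /F; case: ifP => // /event[].
have -> : (fun m => prob (M m) (F m)) = (fun m => (fine (prob (M m) (F m)))%:E).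
  by apply/funext => m; rewrite fineK// fin_num_measure.
apply: cvg_EFin; first exact: nearW.
apply/cvgrPdist_le => e e0.
have e1 : 0 < Num.min (kappa ^+ 2 / 512%:R) (e / (K + 1)).
  rewrite lt_min; apply/andP; split; apply: divr_gt0.
  - exact: exprn_gt0.
  - by rewrite ltr0n.
  - exact: e0.
  - exact: (ltr_wpDl K0 ltr01).
apply: filterS (rate_cvg0 p0 poo e1) => m; rewrite le_min => /andP[rk re] /=.
have P1 : fine (prob (M m) (F m)) <= 1.
  by rewrite -lee_fin fineK ?fin_num_measure// probability_le1.
rewrite ger0_norm ?subr_ge0// lerBlDr -lerBlDl.
have : ((1 - K * r m)%:E <= prob (M m) (F m))%E by rewrite /F rk; exact: (event m rk).2.
rewrite -[X in (_ <= X)%E]fineK ?fin_num_measure// lee_fin; apply: le_trans.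
rewrite lerD2l lerN2; apply: (@le_trans _ _ (K * (e / (K + 1)))); first exact: ler_wpM2l.
by rewrite mulrA ler_pdivrMr ?ltr_wpDl// mulrC ler_pM2l// lerDl.
Qed.
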